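(* Let $P,Q\in\mathbb{C}[X]$ be polynomials such that the leading coefficient $b$ of $Q$ satisfies $\Re b>0$ and $\Re Q(k)>0$ for all integers $k\ge 0$. Write $Q(X)=b\prod_\omega (X+\omega)^{n_\omega}$, so that the roots of $Q$ are the numbers $-\omega$, with multiplicities $n_\omega$. Then the General Stirling-Ramanujan constant $S_{\mathcal R}(P(k-1)\log Q(k-1))$ is an exponential period over the field $\mathbb{K}_P((\omega))(t,e^{-t},(e^{-\omega t}))$, where $\mathbb{K}_P$ is the field of definition of $P$ and $\mathbb{K}_P((\omega))$ is the splitting field of $Q$ over $\mathbb{K}_P$.
   Context: Logarithms are principal branches. If the partial sums $\sum_{k=1}^s f(k)$ have, as the integer $s\to+\infty$, an asymptotic expansion in the functions $s^m\log s$ ($m\ge 0$) and $s^m$ ($m\in\mathbb{Z}$), this expansion is unique and $S_{\mathcal R}(f(k))$ denotes its constant term (coefficient of $s^0$). Thus $S_{\mathcal R}(P(k-1)\log Q(k-1))$ is the constant term in the expansion of $\sum_{k=0}^{s-1}P(k)\log Q(k)$; for such $P,Q$ the expansion exists. $\mathbb{K}_P$ is the subfield of $\mathbb{C}$ generated over $\mathbb{Q}$ by the coefficients of $P$; $\mathbb{K}_P((\omega))$ is obtained by adjoining all the $\omega$; and $\mathbb{K}_P((\omega))(t,e^{-t},(e^{-\omega t}))$ is the field of meromorphic functions of $t$ generated over $\mathbb{K}_P((\omega))$ by $t$, $e^{-t}$ and all the functions $e^{-\omega t}$. A complex number is an exponential period over a field $\mathbb{F}$ of meromorphic functions of $t$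 if it equals a convergent integral $\int_0^{+\infty}f(t)\,dt$ with $f\in\mathbb{F}$. *)

(* Defs.v *)
From HB Require Import structures.
From mathcomp Require Import all_boot all_order all_algebra complex.
From mathcomp Require Import all_classical all_reals all_analysis.

Set Implicit Arguments.
Unset Strict Implicit.
Unset Printing Implicit Defensive.

Import Order.TTheory GRing.Theory Num.Theory.
Import numFieldNormedType.Exports.

Local Open Scope classical_set_scope.
Local Open Scope ring_scope.
Local Open Scope complex_scope.

(* R[i] gets its topology through the alias R[i]^o, which is why that alias
   appears wherever a limit or a derivative is taken. *)

Definition cexp (R : realType) (z : R[i]) : R[i] :=
  (expR (complex.Re z) * cos (complex.Im z))
    +i* (expR (complex.Re z) * sin (complex.Im z)).

(* Principal argument, in ]-pi, pi]; meaningful for z != 0 only. *)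
Definition carg (R : realType) (z : R[i]) : R :=
  let a := acos (complex.Re z / Normc.normc z) in
  if 0 <= complex.Im z then a else - a.

Definition clog (R : realType) (z : R[i]) : R[i] :=
  ln (Normc.normc z) +i* carg z.

(* u(s) ~ A(s) log s + B(s) + \sum_(j >= 1) d_j s^(-j) as s -> +oo: A collects
   the terms in s^m log s with m >= 0, B those in s^m with m >= 0 (an asymptotic
   expansion has finitely many growing terms), d those in s^m with m < 0; for
   every N the remainder after s^(-N) is o(s^(-N)). *)
Definition asymptotic_expansion (R : realType) (u : nat -> R[i])
    (A B : {poly R[i]}) (d : nat -> R[i]) : Prop :=
  forall N : nat,
    (fun s : nat => s%:R ^+ N *
      (u s - (A.[s%:R] * (ln (s%:R : R))%:C + B.[s%:R]
              + \sum_(1 <= j < N.+1) d j * s%:R ^- j)) : R[i]^o)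
      @ \oo --> (0 : R[i]^o).

Definition is_SR (R : realType) (f : nat -> R[i]) (c : R[i]) : Prop :=
  exists A B d,
    asymptotic_expansion (fun s => \sum_(1 <= k < s.+1) f k) A B d /\ c = B`_0.

(* Equal to 0 by convention when there is no asymptotic expansion. *)
Definition SR (R : realType) (f : nat -> R[i]) : R[i] :=
  xget 0 [set c | is_SR f c].

Definition subfield_gen (R : realType) (G : set R[i]) : set R[i] :=
  smallest (fun K : set R[i] => divring_closed (mem K)) G.

Definition coef_field (R : realType) (P : {poly R[i]}) : set R[i] :=
  subfield_gen [set P`_i | i in [set: nat]].

Definition adjoin (R : realType) (K G : set R[i]) : set R[i] :=
  subfield_gen (K `|` G).

(* Meromorphic functions on the whole plane are represented by total functions
   whose values on closed discrete sets (in particular at poles) are irrelevant;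
   mero_eq is equality of the meromorphic functions so represented. *)
Definition meromorphic (R : realType) (f : R[i] -> R[i]) : Prop :=
  forall a : R[i]^o, exists (g : R[i]^o -> R[i]^o) (n : nat),
    (\forall z \near a, derivable g z 1) /\
    (\forall z \near a^', f z = g z / (z - a) ^+ n).

Definition mero_eq (R : realType) (f g : R[i] -> R[i]) : Prop :=
  forall a : R[i]^o, \forall z \near a^', f z = g z.

Definition mero_subfield (R : realType) (F : set (R[i] -> R[i])) : Prop :=
  [/\ forall f, F f -> meromorphic f,
      forall f g, F f -> mero_eq f g -> F g,
      F (fun=> 1),
      forall f g, F f -> F g -> F (fun z => f z - g z)
    & forall f g, F f -> F g -> F (fun z => f z / g z)].

(* K(t, e^(-t), (e^(- w t))_(w in W)) *)
Definition exp_field (R : realType) (K W : set R[i]) : set (R[i] -> R[i]) :=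
  smallest (@mero_subfield R)
    ([set (fun=> c) | c in K]
     `|` [set (fun t => t)]
     `|` [set (fun t => cexp (- t))]
     `|` [set (fun t => cexp (- (w * t))) | w in W]).

Definition improper_integral (R : realType) (g : R -> R) (l : R) : Prop :=
  (forall T : R, 0 < T ->
     (@lebesgue_measure R).-integrable `[0, T] (EFin \o g)) /\
  (fun T : R => \int[@lebesgue_measure R]_(t in `[0, T]) g t) @ +oo --> l.

(* The integral is improper at +oo only: a meromorphic function whose integral
   converges has no pole on [0, +oo[. *)
Definition exponential_period (R : realType) (F : set (R[i] -> R[i]))
    (z : R[i]) : Prop :=
  exists f, [/\ F f,
    improper_integral (fun t => complex.Re (f t%:C)) (complex.Re z)
  & improper_integral (fun t => complex.Im (f t%:C)) (complex.Im z)].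

(* Main.v *)
(* Write Q = b q with q monic. Since Re b > 0 and Re Q(k) > 0, log Q(k) =
   log b + log q(k), and log b only contributes a polynomial in s without
   constant term. For small k, log q(k) is the integral of 1/(1+t) - 1/(q(k)+t).
   For large k, log q(k) is the sum of the log(k+w), and expanding P in powers of
   X + w reduces the problem to the sums of (k+w)^n log(k+w).

   Up to a polynomial, (-1)^(n+1) x^n log x / n! is the finite part of the
   integral of t^(-n-1) e^(-xt). Let B_j be the Taylor coefficients of
   t e^(-wt) / (1 - e^(-t)) and theta(t) = t^(-n-2) (t e^(-wt) / (1 - e^(-t)) -
   sum_(j < n+2) B_j t^j). Then e^(-kt) (1 - e^(-t)) theta(t) is
   t^(-n-1) e^(-(k+w)t) - sum_j B_j t^(j-n-2) (e^(-kt) - e^(-(k+1)t)), so that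
   integrating over t telescopes the sum over k: what remains at k = s is a
   combination of the s^i log s and s^i, plus the integral of e^(-st) theta(t),
   which Watson's lemma expands in negative powers of s; what remains at k = k0 is
   an element of the splitting field, a multiple of log k0, and the integral of
   e^(-k0 t) theta(t), whose integrand belongs to the function field. *)
Require Import Defs.
From HB Require Import structures.
From mathcomp Require Import all_boot all_order all_algebra complex ring lra.
From mathcomp Require Import all_classical all_reals all_analysis measurable_realfun.
Import Order.TTheory GRing.Theory Num.Theory.
Import numFieldNormedType.Exports.
Local Open Scope classical_set_scope.
Local Open Scope ring_scope.
Local Open Scope complex_scope.

(** Principal logarithms are not additive, and this shapes the proof. log b splits off log Q(k)
    because b and Q(k) lie in the right half-plane, so that their arguments differ by less than pi;
    this also keeps q(k) = Q(k) / b off ]-oo, 0], as the integral for log q(k) requires. log q(k)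
    splits into the log(k + w) only once all their arguments are below pi / (deg Q + 1) in absolute
    value, which fixes k0; there Re(k + w) > 0 as well, so that the exponentials decay. log b is not
    shown to be a period: it must be multiplied by a constant term that is exactly 0. Finite parts
    are replaced by convergent integrals: e^(-t) times a Taylor polynomial is subtracted from
    e^(-xt), which changes the value by a polynomial in x only. The cancellation of these
    counterterms in the telescoping is not computed; it follows from boundedness at 0. The
    regularized integrals start from Frullani's formula for complex x, obtained by comparing
    derivatives along horizontal rays and the behaviour at +oo. Since [SR] picks any admissible
    constant term, the uniqueness of expansions is proved too. *)

(** * Improper integrals of real functions over ]0, +oo[ *)

Section RealIntegrals.
Context {R : realType}.
Implicit Types (g h G : R -> R) (l k C T d : R).
Let mu := @lebesgue_measure R.

(** Nothing is asked at 0, where a factor such as 1/t only has the conventional value 0; a single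
    point does not affect the integrals. *)
Definition pos_continuous g := forall t : R, 0 < t -> {for t, continuous g}.
Definition pos_lbounded g :=
  forall T : R, 0 < T -> exists C, forall t : R, 0 < t <= T -> `|g t| <= C.

Lemma pos_integrable g T : pos_continuous g -> pos_lbounded g -> 0 < T ->
  mu.-integrable `[0, T] (EFin \o g).
Proof.
move=> cg bg T0.
have mg : measurable_fun `]0, T] g.
  apply: subspace_continuous_measurable_fun => //.
  apply: continuous_in_subspaceT => x; rewrite inE/= in_itv/= => /andP[x0 _].
  exact: cg.
have mg' : measurable_fun `[0, T] g.
  by apply/measurable_fun_itv_obnd_cbndP.
apply: measurable_bounded_integrable => //.
  by rewrite /= lebesgue_measure_itv/= lte_fin T0 -EFinD ltry.
have [C hC] := bg _ T0.
(* The bound C holds on ]0, T] only, so the arbitrary value at 0 is added to it. *)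
exists (`|C| + `|g 0|); split => // M hM t /=; rewrite in_itv/= => /andP[t0 tT].
have := normr_ge0 C; have := normr_ge0 (g 0); have := ler_norm C.
move: t0; rewrite le_eqVlt => /predU1P[<- *|t0 *].
  lra.
have := hC t; rewrite t0 tT => /(_ isT); lra.
Qed.

Definition iprim g T : R := \int[mu]_(t in `[0, T]) g t.

Lemma iprim_derive g (x : R) : pos_continuous g -> pos_lbounded g -> 0 < x ->
  is_derive x 1 (iprim g) (g x).
Proof.
move=> cg bg x0.
have xx : x < x + 1 by rewrite ltrDl.
have ig : mu.-integrable `[0, x + 1] (EFin \o g).
  by apply: pos_integrable => //; lra.
have [df <-] := @continuous_FTC1_closed _ g 0 x (x + 1) xx ig x0 (cg _ x0).
by rewrite derive1E; apply: DeriveDef.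
Qed.

Lemma iprim_bound g C (x : R) : pos_continuous g -> pos_lbounded g -> 0 < x ->
  (forall t : R, 0 < t <= x -> `|g t| <= C) -> `|iprim g x| <= C * x.
Proof.
move=> cg bg x0 hC; rewrite /iprim.
have ig := pos_integrable _ _ cg bg x0.
have ig' : mu.-integrable `]0, x] (EFin \o g).
  by apply: integrableS ig => //; move=> t /=; rewrite !in_itv/= => /andP[/ltW-> ->].
rewrite -Rintegral_itv_obnd_cbnd//.
apply: le_trans (le_normr_Rintegral _ ig') _ => //.
apply: (@le_trans _ _ (\int[mu]_(t in `]0, x]) C)).
  apply: le_Rintegral => //.
  - exact: integrable_norm ig'.
  - apply: measurable_bounded_integrable => //=.
      by rewrite /mu lebesgue_measure_itv/= lte_fin x0 -EFinD ltry.
    by exists `|C|; split => // M hM t _; exact: ltW.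
rewrite Rintegral_cst//= lebesgue_measure_itv/= lte_fin x0 /=.
by rewrite oppr0 addr0.
Qed.

Lemma zero_derive_const h : (forall x : R, 0 < x -> is_derive x 1 h 0) ->
  forall x y : R, 0 < x -> 0 < y -> h x = h y.
Proof.
move=> dh.
have main (x y : R) : 0 < x -> x < y -> h x = h y.
  move=> x0 xy.
  have [||c _] := @MVT _ h (fun=> 0) x y xy.
  - by move=> z; rewrite in_itv/= => /andP[xz _]; apply: dh; exact: lt_trans xz.
  - apply: derivable_within_continuous => z; rewrite in_itv/= => /andP[xz _].
    by have [] := dh z (lt_le_trans x0 xz).
  by rewrite mul0r => /eqP; rewrite subr_eq0 => /eqP.
move=> x y x0 y0; have [xy|xy|->//] := ltgtP x y; first exact: main.
by apply/esym/main.
Qed.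

Lemma iprim0 g : pos_continuous g -> pos_lbounded g -> iprim g x @[x --> (0:R)^'+] --> (0:R).
Proof.
move=> cg bg.
have [C hC] := bg 1 ltr01.
have C0 : 0 <= C by apply: le_trans (hC 1 _); rewrite ?ltr01 ?lexx.
apply/cvgr0Pnorm_lt => e e0.
near=> x.
have x0 : 0 < x by near: x; exact: nbhs_right_gt.
have x1 : x <= 1 by near: x; apply: nbhs_right_le.
apply: le_lt_trans (iprim_bound _ C _ cg bg x0 _) _.
  by move=> t /andP[t0 tx]; apply: hC; rewrite t0 (le_trans tx).
have xe : x < e / (C + 1) by near: x; apply: nbhs_right_lt; apply: divr_gt0; lra.
apply: le_lt_trans (_ : C * (e / (C + 1)) < e).
  by apply: ler_wpM2l => //; exact: ltW.
by rewrite mulrA ltr_pdivrMr; nra.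
Unshelve. all: by end_near. Qed.

(** [iprim g - G] has derivative 0 on ]0, +oo[, hence is constant, equal to its limit - l at 0: a
    primitive needs only a limit there. *)
Lemma iprim_ftc g G l T : pos_continuous g -> pos_lbounded g ->
  (forall t : R, 0 < t -> is_derive t 1 G (g t)) -> G x @[x --> (0:R)^'+] --> l ->
  0 < T -> iprim g T = G T - l.
Proof.
move=> cg bg dG Gl T0.
pose h := fun x => iprim g x - G x.
have dh (x : R) : 0 < x -> is_derive x 1 h 0.
  move=> x0; have := iprim_derive _ _ cg bg x0; have := dG _ x0 => *.
  by rewrite /h; apply: is_derive_eq; rewrite subrr.
have hT := zero_derive_const h dh.
have hl : h x @[x --> (0:R)^'+] --> 0 - l by apply: cvgB => //; exact: iprim0.
have hl2 : h x @[x --> (0:R)^'+] --> h T.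
  apply: cvg_near_cst; near=> x; apply: hT => //; near: x; exact: nbhs_right_gt.
have : 0 - l = h T by exact: (cvg_unique _ hl hl2).
rewrite /h; lra.
Unshelve. all: by end_near. Qed.

Lemma improper_ftc g G l k : pos_continuous g -> pos_lbounded g ->
  (forall t : R, 0 < t -> is_derive t 1 G (g t)) -> G x @[x --> (0:R)^'+] --> l ->
  G x @[x --> +oo] --> k -> improper_integral g (k - l).
Proof.
move=> cg bg dG Gl Gk; split; first by move=> T; exact: pos_integrable.
apply: cvg_trans (_ : G x - l @[x --> +oo] --> k - l); last first.
  by apply: cvgB => //; exact: cvg_cst.
apply: near_eq_cvg; near=> x.
by rewrite -[RHS]/(iprim g x) (iprim_ftc _ _ _ _ cg bg dG Gl).
Unshelve. all: by end_near. Qed.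

Lemma improper_unique g l k :
  improper_integral g l -> improper_integral g k -> l = k.
Proof. by move=> [_ gl] [_ gk]; exact: cvg_unique _ gl gk. Qed.

Lemma improperD g h l k : improper_integral g l -> improper_integral h k ->
  improper_integral (fun t => g t + h t) (l + k).
Proof.
move=> [ig gl] [ih hk]; split.
  move=> T T0.
  by apply: (@integrableD _ _ _ mu _ _ (EFin \o g) (EFin \o h)) => //; [exact: ig|exact: ih].
apply: cvg_trans (cvgD gl hk).
apply: near_eq_cvg; near=> T.
by rewrite RintegralD//; [exact: ig|exact: ih].
Unshelve. all: by end_near. Qed.

Lemma improperZ g l (c : R) : improper_integral g l ->
  improper_integral (fun t => c * g t) (c * l).
Proof.
move=> [ig gl]; split.
  move=> T T0; have := ig T T0.
  by move=> /(@integrableZl _ _ _ mu _ _ c (EFin \o g)); apply.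
have h : c * iprim g x @[x --> +oo] --> c * l by apply: cvgM => //; exact: cvg_cst.
apply: cvg_trans h.
apply: near_eq_cvg; near=> T.
by rewrite RintegralZl//; exact: ig.
Unshelve. all: by end_near. Qed.

Lemma improper_eq g h l : (forall t : R, 0 < t -> g t = h t) ->
  improper_integral g l -> improper_integral h l.
Proof.
move=> gh [ig gl].
have ih T : 0 < T -> mu.-integrable `[0, T] (EFin \o h).
  move=> T0.
  have : mu.-integrable `]0, T] (EFin \o h).
    apply: eq_integrable (integrableS _ _ _ (ig _ T0)) => //.
      by move=> t; rewrite inE/= in_itv/= => /andP[t0 _]; rewrite gh.
    by move=> t /=; rewrite !in_itv/= => /andP[/ltW-> ->].
  move=> /integrableP[/measurable_EFinP mh ih].
  have mh' : measurable_fun `[0, T] h by apply/measurable_fun_itv_obnd_cbndP.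
  apply/integrableP; split; first exact/measurable_EFinP.
  rewrite -integral_itv_obnd_cbnd//.
  exact/measurableT_comp/measurable_EFinP.
split => //.
apply: cvg_trans gl; apply: near_eq_cvg; near=> T.
have T0 : 0 < T by [].
rewrite -!Rintegral_itv_obnd_cbnd//.
- by apply: eq_Rintegral => t; rewrite inE/= in_itv/= => /andP[t0 _]; exact: gh.
- by apply: integrableS (ih _ T0) => //; move=> t /=; rewrite !in_itv/= => /andP[/ltW-> ->].
- by apply: integrableS (ig _ T0) => //; move=> t /=; rewrite !in_itv/= => /andP[/ltW-> ->].
Unshelve. all: by end_near. Qed.

Lemma improper_ge0 g l : (forall t : R, 0 < t -> 0 <= g t) ->
  improper_integral g l -> 0 <= l.
Proof.
move=> g0 gl0; have [ig gl] := improper_eq g (fun t => `|g t|) l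
   (fun t t0 => esym (ger0_norm (g0 t t0))) gl0.
apply: (cvgr_to_ge gl); near=> T; exact: Rintegral_ge0.
Unshelve. all: by end_near. Qed.

Lemma improper_le g h l k : (forall t : R, 0 < t -> g t <= h t) ->
  improper_integral g l -> improper_integral h k -> l <= k.
Proof.
move=> gh gl hk; rewrite -subr_ge0 -mulN1r.
apply: improper_ge0 (improperD _ _ _ _ hk (improperZ _ _ (-1) gl)) => t t0.
by rewrite mulN1r subr_ge0 gh.
Qed.

Lemma improper_norm_le g h l k : (forall t : R, 0 < t -> `|g t| <= h t) ->
  improper_integral g l -> improper_integral h k -> `|l| <= k.
Proof.
move=> gh gl hk; rewrite ler_norml; apply/andP; split; last first.
  apply: improper_le gl hk => t /gh.
  by rewrite ler_norml => /andP[].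
rewrite lerNl -mulN1r.
apply: improper_le (improperZ _ _ (-1) gl) hk => t /gh.
by rewrite ler_norml mulN1r lerNl => /andP[].
Qed.

Lemma iprim_le g h T : pos_continuous g -> pos_lbounded g ->
  pos_continuous h -> pos_lbounded h -> (forall t : R, 0 < t -> g t <= h t) ->
  0 < T -> iprim g T <= iprim h T.
Proof.
move=> cg bg ch bh gh T0.
have S : `]0, T] `<=` `[0, T]%classic by move=> t /=; rewrite !in_itv/= => /andP[/ltW-> ->].
have ig : mu.-integrable `]0, T] (EFin \o g).
  by apply: integrableS (pos_integrable _ _ cg bg T0).
have ih : mu.-integrable `]0, T] (EFin \o h).
  by apply: integrableS (pos_integrable _ _ ch bh T0).
rewrite /iprim -!Rintegral_itv_obnd_cbnd//.
apply: le_Rintegral => // t /=; rewrite in_itv/= => /andP[t0 _]; exact: gh.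
Qed.

Lemma nonneg_derive_ndecr (h dh : R -> R) : (forall x : R, 0 < x -> is_derive x 1 h (dh x)) ->
  (forall x, 0 < x -> 0 <= dh x) -> forall x y : R, 0 < x -> x <= y -> h x <= h y.
Proof.
move=> hd d0 x y x0; rewrite le_eqVlt => /predU1P[->//|xy].
have [||c] := @MVT _ h dh x y xy.
- by move=> z; rewrite in_itv/= => /andP[xz _]; apply: hd; exact: lt_trans xz.
- apply: derivable_within_continuous => z; rewrite in_itv/= => /andP[xz _].
  by have [] := hd z (lt_le_trans x0 xz).
rewrite in_itv/= => /andP[xc _]; rewrite -subr_ge0 => ->.
by rewrite mulr_ge0 ?subr_ge0 ?(ltW xy)// d0// (lt_trans x0).
Qed.

Lemma cvg_expR_decay d : 0 < d -> expR (- (d * x)) @[x --> +oo] --> (0 : R).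
Proof.
move=> d0; apply: (@cvg_comp _ _ _ (fun x => d * x) (fun x => expR (- x)) _ +oo).
  by apply: gt0_cvgMry => //; exact: cvg_id.
exact: cvgr_expR.
Qed.

Lemma is_derive_expRN d (x : R) :
  is_derive x 1 (fun t => expR (- (d * t))) (- d * expR (- (d * x))).
Proof.
have h : is_derive x 1 (fun t => - (d * t)) (- d).
  have := @is_deriveN _ _ _ (fun t => d * t) x 1 d.
  apply; have := @is_deriveZ _ _ _ id d x 1 1 _.
  by rewrite /GRing.scale/= mulr1; apply.
have := @is_derive1_comp _ expR (fun t => - (d * t)) x _ _ (is_derive_expR _) h.
by rewrite /comp mulrC.
Qed.

Lemma pos_derivable_continuous (h dh : R -> R) :
  (forall x : R, 0 < x -> is_derive x 1 h (dh x)) -> pos_continuous h.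
Proof.
move=> hd x x0; apply: differentiable_continuous; apply/derivable1_diffP.
by have [] := hd x x0.
Qed.

Lemma expR_improper d : 0 < d -> improper_integral (fun t => expR (- (d * t))) d^-1.
Proof.
move=> d0.
have cE : pos_continuous (fun t => expR (- (d * t))).
  exact: pos_derivable_continuous (fun x _ => is_derive_expRN d x).
have -> : d^-1 = 0 - - d^-1 by rewrite sub0r opprK.
apply: (@improper_ftc _ (fun t => - d^-1 * expR (- (d * t)))) => //.
- move=> T T0; exists 1 => t /andP[t0 _].
  by rewrite ger0_norm ?expR_ge0// -expR0 ler_expR oppr_le0 mulr_ge0 ?ltW.
- move=> t t0; have := is_derive_expRN d t => h.
  apply: is_derive_eq; rewrite /GRing.scale/= mulrA mulrNN mulVf ?mul1r//.
  by rewrite gt_eqF.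
- rewrite -[X in _ --> X]mulr1; apply: cvgM; first exact: cvg_cst.
  apply: cvg_at_right_filter.
  rewrite -[X in _ --> X]expR0.
  have : {for (0:R), continuous (fun t => expR (- (d * t)))}.
    apply: differentiable_continuous; apply/derivable1_diffP.
    by have [] := is_derive_expRN d 0.
  by rewrite /prop_for /continuous_at mulr0 oppr0.
- rewrite -[X in _ --> X](mulr0 (- d^-1)); apply: cvgM; first exact: cvg_cst.
  exact: cvg_expR_decay.
Qed.

Lemma expR_decay_lbounded g C d : 0 < d ->
  (forall t : R, 0 < t -> `|g t| <= C * expR (- (d * t))) -> pos_lbounded g.
Proof.
move=> d0 gC T T0; exists C => t /andP[t0 _]; apply: le_trans (gC t t0) _.
have := gC _ t0; have := normr_ge0 (g t) => a b; have := le_trans a b.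
rewrite pmulr_lge0 ?expR_gt0// => C0.
by rewrite ler_piMr// -expR0 ler_expR oppr_le0 mulr_ge0 ?ltW.
Qed.

(** Absolute convergence by monotonicity: with E the exponential majorant, g + E lies between 0 and
    2E, so its primitive is nondecreasing and bounded; E is subtracted at the end. *)
Lemma improper_exists g C d : 0 < d -> pos_continuous g ->
  (forall t : R, 0 < t -> `|g t| <= C * expR (- (d * t))) ->
  exists l, improper_integral g l.
Proof.
move=> d0 cg gC.
have bg := expR_decay_lbounded _ _ _ d0 gC.
pose E t := C * expR (- (d * t)).
have iE : improper_integral E (C * d^-1) by apply: improperZ; exact: expR_improper.
have cE : pos_continuous E.
  move=> t t0; apply: cvgM; first exact: cvg_cst.
  exact: (pos_derivable_continuous _ _ (fun x _ => is_derive_expRN d x)).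
have E0 t : 0 < t -> 0 <= E t by move=> t0; apply: le_trans (gC _ t0).
have bE : pos_lbounded E.
  by apply: (@expR_decay_lbounded _ C d d0) => t t0; rewrite ger0_norm// E0.
pose h t := g t + E t.
have ch : pos_continuous h by move=> t t0; apply: cvgD; [exact: cg|exact: cE].
have hE t : 0 < t -> h t <= 2 * E t.
  by move=> t0; have := gC _ t0; rewrite /h -/(E t) ler_norml => /andP[_]; lra.
have h0 t : 0 < t -> 0 <= h t.
  by move=> t0; have := gC _ t0; rewrite /h -/(E t) ler_norml => /andP[+ _]; lra.
have bh : pos_lbounded h.
  apply: (@expR_decay_lbounded _ (2 * C) d d0) => t t0.
  by rewrite ger0_norm ?h0// -mulrA hE.
(* The maximum makes the primitive monotone on the whole line, negative arguments included. *)
pose F x := iprim h (Num.max x 1).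
have m0 x : 0 < Num.max x 1 :> R by rewrite lt_max ltr01 orbT.
have nF : nondecreasing_fun F.
  move=> x y xy; rewrite /F; apply: (nonneg_derive_ndecr (iprim h) h) => //.
    by move=> z z0; exact: iprim_derive.
  by rewrite ge_max !le_max xy lexx orbT.
have ubF : has_ubound (range F).
  exists (2 * (C * d^-1)) => _ [x _ <-]; rewrite /F.
  have b2 : pos_lbounded (fun t => 2 * E t).
    move=> T T0; have [K hK] := bE T T0; exists (2 * K) => t /hK.
    by rewrite [`|2 * _|]normrM (ger0_norm (ler0n _ 2)) ler_pM2l.
  have c2 : pos_continuous (fun t => 2 * E t).
    by move=> t t0; apply: cvgM; [exact: cvg_cst|exact: cE].
  apply: le_trans (iprim_le _ (fun t => 2 * E t) _ ch bh c2 b2 hE (m0 x)) _.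
  have [_ lim] := improperZ _ _ 2 iE.
  apply: (cvgr_to_ge lim); near=> T.
  apply: (nonneg_derive_ndecr (iprim (fun t => 2 * E t)) (fun t => 2 * E t)).
  - by move=> z z0; exact: iprim_derive.
  - by move=> z /E0; lra.
  - exact: m0.
  - by near: T; apply: nbhs_pinfty_ge; exact: num_real.
have lF := nondecreasing_cvgr nF ubF.
have ih : improper_integral h (sup (range F)).
  split; first by move=> T; exact: pos_integrable.
  apply: cvg_trans lF; apply: near_eq_cvg; near=> T.
  by rewrite /F max_l.
exists (sup (range F) + (-1) * (C * d^-1)).
apply: improper_eq (improperD _ _ _ _ ih (improperZ _ _ (-1) iE)) => t t0.
by rewrite /h mulN1r addrK.
Unshelve. all: by end_near. Qed.

(** For n > 0, this is the n-th power of x / n <= e^(x / n). *)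
Lemma exprn_le_expR n (x : R) : 0 <= x -> x ^+ n <= n%:R ^+ n * expR x.
Proof.
case: n => [|n] x0; first by rewrite !expr0 mul1r -expR0 ler_expR.
have n0 : 0 < n.+1%:R :> R by rewrite ltr0n.
have h : x / n.+1%:R <= expR (x / n.+1%:R).
  by apply: le_trans (expR_ge1Dx _); rewrite lerDr.
have -> : expR x = expR (x / n.+1%:R) ^+ n.+1.
  by rewrite -expRM_natl mulrC divfK// gt_eqF.
rewrite -exprMn lerXn2r ?nnegrE ?mulr_ge0 ?expR_ge0 ?(ltW n0)//.
by move: h; rewrite ler_pdivrMr// mulrC.
Qed.

(** Half of the exponential absorbs the power, by [exprn_le_expR] at d t / 2. *)
Lemma exprn_decay n d : 0 < d -> exists2 C, 0 <= C &
  forall t : R, 0 <= t -> t ^+ n * expR (- (d * t)) <= C * expR (- (d / 2 * t)).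
Proof.
move=> d0; exists ((2 / d) ^+ n * n%:R ^+ n).
  by rewrite mulr_ge0 ?exprn_ge0 ?divr_ge0 ?(ltW d0) ?ler0n.
move=> t t0.
have e0 : 0 <= d / 2 * t by rewrite mulr_ge0// divr_ge0// ltW.
have -> : t ^+ n = (2 / d) ^+ n * (d / 2 * t) ^+ n.
  by rewrite -exprMn; congr (_ ^+ _); field; rewrite gt_eqF.
have -> : - (d * t) = - (d / 2 * t) - (d / 2 * t) by field.
rewrite expRD -!mulrA ler_wpM2l ?exprn_ge0 ?divr_ge0 ?(ltW d0)//.
rewrite mulrA mulrA ler_wpM2r ?expR_ge0// expRN.
by rewrite ler_pdivrMr ?expR_gt0// exprn_le_expR.
Qed.

(** Integration by parts: t^(n+1) e^(-dt) vanishes at both ends, so its derivative has integral 0,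
    an equation that is solved for the integral of t^(n+1) e^(-dt). *)
Lemma exprn_improper n d : 0 < d ->
  improper_integral (fun t => t ^+ n * expR (- (d * t))) (n`!%:R / d ^+ n.+1).
Proof.
move=> d0; elim: n => [|n IH].
  apply: (improper_eq (fun t => expR (- (d * t)))).
    by move=> t _; rewrite expr0 mul1r.
  by rewrite fact0 expr1 div1r; exact: expR_improper.
pose g n (t : R) := t ^+ n * expR (- (d * t)).
have dg m (x : R) : is_derive x 1 (g m) (m%:R * g m.-1 x - d * g m x).
  have h1 := is_derive_expRN d x.
  have h2 : is_derive x 1 (fun t : R => t ^+ m) (m%:R * x ^+ m.-1).
    apply: DeriveDef; first exact: exprn_derivable.
    by rewrite exp_derive /GRing.scale/= mulr1.
  have := @is_deriveM _ _ (fun t : R => t ^+ m) (fun t => expR (- (d * t))) x 1 _ _ h2 h1.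
  move=> h3; apply: (is_derive_eq h3).
  by rewrite /GRing.scale/= /g; ring.
have cg m : pos_continuous (g m) by exact: pos_derivable_continuous (fun x _ => dg m x).
have g0 m t : 0 < t -> 0 <= g m t.
  by move=> t0; rewrite mulr_ge0 ?expR_ge0// exprn_ge0// ltW.
have gb m : exists2 C, 0 <= C & forall t : R, 0 < t -> `|g m t| <= C * expR (- (d / 2 * t)).
  have [C C0 hC] := exprn_decay m d d0; exists C => // t t0.
  by rewrite ger0_norm ?g0// hC// ltW.
have d20 : 0 < d / 2 by rewrite divr_gt0.
have lg m : pos_lbounded (g m).
  by have [C C0 hC] := gb m; exact: expR_decay_lbounded hC.
have gl m : g m x @[x --> +oo] --> (0 : R).
  have [C C0 hC] := gb m.
  apply: (@squeeze_cvgr _ _ _ _ (fun=> 0) (fun t => C * expR (- (d / 2 * t)))).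
  - near=> t; have t0 : 0 < t by [].
    by rewrite g0//=; apply: le_trans (hC _ t0); exact: ler_norm.
  - exact: cvg_cst.
  - rewrite -[X in _ --> X](mulr0 C); apply: cvgM; first exact: cvg_cst.
    exact: cvg_expR_decay.
have gz : g n.+1 x @[x --> (0:R)^'+] --> (0 : R).
  apply: cvg_at_right_filter.
  have : {for (0:R), continuous (g n.+1)}.
    apply: differentiable_continuous; apply/derivable1_diffP.
    by have [] := dg n.+1 0.
  by rewrite /prop_for /continuous_at /g expr0n/= mul0r.
have c' : pos_continuous (fun t => n.+1%:R * g n t - d * g n.+1 t).
  by move=> t t0; apply: cvgB; (apply: cvgM; [exact: cvg_cst|exact: cg]).
have b' : pos_lbounded (fun t => n.+1%:R * g n t - d * g n.+1 t).
  move=> T T0; have [C1 h1] := lg n T T0; have [C2 h2] := lg n.+1 T T0.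
  exists (n.+1%:R * C1 + d * C2) => t tT.
  apply: le_trans (ler_normB _ _) _; rewrite (normrM n.+1%:R) (normrM d) (gtr0_norm d0) (ger0_norm (ler0n _ _)).
  by apply: lerD; [apply: ler_wpM2l; rewrite ?ler0n ?h1|apply: ler_wpM2l; rewrite ?(ltW d0) ?h2].
have := improper_ftc _ (g n.+1) 0 0 c' b' (fun t _ => dg n.+1 t) gz (gl n.+1).
rewrite subr0 => /(improperZ _ _ (- d^-1)).
move/(improperD _ _ _ _ (improperZ _ _ (n.+1%:R / d) IH)).
have -> : n.+1%:R / d * (n`!%:R / d ^+ n.+1) + - d^-1 * 0 = n.+1`!%:R / d ^+ n.+2.
  by rewrite mulr0 addr0 mulf_div -exprS factS natrM.
by apply: improper_eq => t _; rewrite /g; field; rewrite gt_eqF.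
Unshelve. all: by end_near. Qed.

End RealIntegrals.

(** * Modulus, real and imaginary parts, complex exponential *)

Section ComplexBasics.
Context {R : realType}.
Implicit Types (z w : R[i]) (x y t : R).
Local Notation normc := Normc.normc.

Lemma norm_normcE z : `|z| = (normc z)%:C.
Proof. by []. Qed.

Lemma normc_ge0 z : 0 <= normc z.
Proof. by case: z => a b; rewrite /normc sqrtr_ge0. Qed.

Lemma normcD z w : normc (z + w) <= normc z + normc w.
Proof. by have := ler_normD z w; rewrite !norm_normcE -rmorphD/= lecR. Qed.

Lemma normcN z : normc (- z) = normc z.
Proof. by apply: complexI; rewrite -!norm_normcE normrN. Qed.

Lemma normcB z w : normc (z - w) <= normc z + normc w.
Proof. by rewrite -(normcN w) normcD. Qed.

Lemma normcX z n : normc (z ^+ n) = normc z ^+ n.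
Proof. by apply: complexI; rewrite -norm_normcE normrX norm_normcE rmorphXn. Qed.

Lemma normc_real x : normc x%:C = `|x|.
Proof. by rewrite /Normc.normc /= expr0n/= addr0 sqrtr_sqr. Qed.

Lemma normc_nat n : normc n%:R = n%:R :> R.
Proof. by rewrite -[n%:R](rmorph_nat (real_complex R)) normc_real ger0_norm. Qed.

Lemma normc_sum (I : Type) (r : seq I) (P : pred I) (F : I -> R[i]) :
  normc (\sum_(i <- r | P i) F i) <= \sum_(i <- r | P i) normc (F i).
Proof.
elim/big_ind2 : _ => [|a b c d ab cd|//]; first by rewrite Normc.normc0.
exact: le_trans (normcD _ _) (lerD ab cd).
Qed.

Lemma Re_le_normc z : `|complex.Re z| <= normc z.
Proof.
by case: z => a b /=; rewrite -sqrtr_sqr ler_wsqrtr// lerDl sqr_ge0.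
Qed.

Lemma Im_le_normc z : `|complex.Im z| <= normc z.
Proof.
by case: z => a b /=; rewrite -sqrtr_sqr ler_wsqrtr// lerDr sqr_ge0.
Qed.

Lemma normc_le_ReIm z : normc z <= `|complex.Re z| + `|complex.Im z|.
Proof.
case: z => a b /=; rewrite -[leRHS]ger0_norm ?addr_ge0// -sqrtr_sqr.
rewrite ler_wsqrtr// sqrrD !real_normK ?num_real//.
by have := normr_ge0 a; have := normr_ge0 b; nra.
Qed.

Lemma ReD z w : complex.Re (z + w) = complex.Re z + complex.Re w.
Proof. by case: z w => ? ? []. Qed.
Lemma ImD z w : complex.Im (z + w) = complex.Im z + complex.Im w.
Proof. by case: z w => ? ? []. Qed.
Lemma ReN z : complex.Re (- z) = - complex.Re z.
Proof. by case: z. Qed.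
Lemma ImN z : complex.Im (- z) = - complex.Im z.
Proof. by case: z. Qed.
Lemma Re_mul z w : complex.Re (z * w) =
  complex.Re z * complex.Re w - complex.Im z * complex.Im w.
Proof. by case: z w => ? ? []. Qed.
Lemma Im_mul z w : complex.Im (z * w) =
  complex.Re z * complex.Im w + complex.Im z * complex.Re w.
Proof. by case: z w => ? ? []. Qed.
Lemma Re_mulr z x : complex.Re (z * x%:C) = complex.Re z * x.
Proof. by rewrite Re_mul /= mulr0 subr0. Qed.
Lemma Im_mulr z x : complex.Im (z * x%:C) = complex.Im z * x.
Proof. by rewrite Im_mul /= mulr0 add0r. Qed.

Lemma eq_complexP z w : complex.Re z = complex.Re w ->
  complex.Im z = complex.Im w -> z = w.
Proof. by case: z w => ? ? [? ?] /= -> ->. Qed.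

Lemma cexpD z w : cexp (z + w) = cexp z * cexp w.
Proof.
apply: eq_complexP; rewrite /cexp ?Re_mul ?Im_mul /= ReD ImD expRD ?cosD ?sinD; ring.
Qed.

Lemma cexp0 : cexp 0 = 1 :> R[i].
Proof. by apply: eq_complexP; rewrite /= expR0 ?cos0 ?sin0 ?mulr0 ?mul1r. Qed.

Lemma normc_cexp z : normc (cexp z) = expR (complex.Re z).
Proof.
rewrite /cexp /normc !exprMn -mulrDr cos2Dsin2 mulr1 sqrtr_sqr ger0_norm//.
Qed.

Lemma cexp_neq0 z : cexp z != 0.
Proof.
apply/eqP => h; have := normc_cexp z; rewrite h Normc.normc0 => /eqP.
by rewrite lt_eqF// expR_gt0.
Qed.

Lemma cexpN z : cexp (- z) = (cexp z)^-1.
Proof.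
by apply: (mulIf (cexp_neq0 z)); rewrite mulVf ?cexp_neq0// -cexpD addNr cexp0.
Qed.

Lemma cexp_real x : cexp x%:C = (expR x)%:C.
Proof. by apply: eq_complexP; rewrite /= ?cos0 ?sin0 ?mulr0 ?mulr1. Qed.

Lemma cexpX z n : cexp (n%:R * z) = cexp z ^+ n.
Proof.
elim: n => [|n IH]; first by rewrite mul0r cexp0.
by rewrite -natr1 mulrDl mul1r cexpD IH exprSr.
Qed.

End ComplexBasics.

(** * Derivation rules for real functions written pointwise *)

Section RealDerive.
Context {R : realType}.
Implicit Types (f g : R -> R) (t a b : R).

Lemma rderD f g t a b : is_derive t 1 f a -> is_derive t 1 g b ->
  is_derive t 1 (fun t => f t + g t) (a + b).
Proof. by move=> ? ?; exact: is_deriveD. Qed.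

Lemma rderB f g t a b : is_derive t 1 f a -> is_derive t 1 g b ->
  is_derive t 1 (fun t => f t - g t) (a - b).
Proof. by move=> ? ?; exact: is_deriveB. Qed.

Lemma rderM f g t a b : is_derive t 1 f a -> is_derive t 1 g b ->
  is_derive t 1 (fun t => f t * g t) (a * g t + f t * b).
Proof.
move=> hf hg; apply: (is_derive_eq (is_deriveM hf hg)).
by rewrite /GRing.scale/= addrC mulrC.
Qed.

Lemma rder_cst c t : is_derive t 1 (fun=> c : R) 0.
Proof. exact: is_derive_cst. Qed.

Lemma rder_id t : is_derive t 1 (fun t : R => t) 1.
Proof. exact: is_derive_id. Qed.

Lemma rderX t n : is_derive t 1 (fun t : R => t ^+ n) (n%:R * t ^+ n.-1).
Proof.
apply: DeriveDef; first exact: exprn_derivable.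
by rewrite exp_derive /GRing.scale/= mulr1.
Qed.

Lemma rder_comp f g t a b : is_derive (g t) 1 f a -> is_derive t 1 g b ->
  is_derive t 1 (fun t => f (g t)) (a * b).
Proof. by move=> hf hg; exact: is_derive1_comp. Qed.

Lemma rderV f t a : f t != 0 -> is_derive t 1 f a ->
  is_derive t 1 (fun t => (f t)^-1) (- a / f t ^+ 2).
Proof.
move=> f0 hf; apply: (is_derive_eq (is_deriveV f0 hf)).
by rewrite /GRing.scale/= mulrC mulNr mulrN -exprVn.
Qed.

End RealDerive.

(** * Calculus of complex-valued functions of a real variable *)

Section ComplexCalculus.
Context {R : realType}.
Implicit Types (f g : R -> R[i]) (z w v : R[i]) (t : R).
Local Notation normc := Normc.normc.

(** Differentiation in a real variable, component by component: all the calculus below takes place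
    along rays parallel to the real axis. *)
Definition cder f v t :=
  is_derive t 1 (fun t => complex.Re (f t)) (complex.Re v) /\
  is_derive t 1 (fun t => complex.Im (f t)) (complex.Im v).

Lemma cder_eq f v w t : v = w -> cder f v t -> cder f w t.
Proof. by move=> ->. Qed.

Lemma cder_ext f g v t : (forall t, f t = g t) -> cder f v t -> cder g v t.
Proof. by move=> /funext ->. Qed.

Lemma cderD f g v w t : cder f v t -> cder g w t ->
  cder (fun t => f t + g t) (v + w) t.
Proof.
move=> [f1 f2] [g1 g2]; split.
  by under eq_fun do rewrite ReD; rewrite ReD; exact: rderD.
by under eq_fun do rewrite ImD; rewrite ImD; exact: rderD.
Qed.

Lemma cderM f g v w t : cder f v t -> cder g w t ->
  cder (fun t => f t * g t) (v * g t + f t * w) t.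
Proof.
move=> [f1 f2] [g1 g2]; split.
  under eq_fun do rewrite Re_mul.
  apply: is_derive_eq (rderB _ _ _ _ _ (rderM _ _ _ _ _ f1 g1) (rderM _ _ _ _ _ f2 g2)) _.
  rewrite ReD !Re_mul; ring.
under eq_fun do rewrite Im_mul.
apply: is_derive_eq (rderD _ _ _ _ _ (rderM _ _ _ _ _ f1 g2) (rderM _ _ _ _ _ f2 g1)) _.
rewrite ImD !Im_mul; ring.
Qed.

Lemma cder_cst z t : cder (fun=> z) 0 t.
Proof. by split; exact: rder_cst. Qed.

Lemma cder_real (h : R -> R) a t : is_derive t 1 h a -> cder (fun t => (h t)%:C) a%:C t.
Proof. by move=> dh; split => //=; exact: rder_cst. Qed.

Lemma cderZ f z v t : cder f v t -> cder (fun t => z * f t) (z * v) t.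
Proof.
move=> df; apply: cder_eq (cderM _ _ _ _ _ (cder_cst z t) df).
by rewrite mul0r add0r.
Qed.

Lemma cderN f v t : cder f v t -> cder (fun t => - f t) (- v) t.
Proof.
move=> df; rewrite -mulN1r; apply: cder_ext (cderZ _ (-1) _ _ df) => s.
by rewrite mulN1r.
Qed.

Lemma cderB f g v w t : cder f v t -> cder g w t ->
  cder (fun t => f t - g t) (v - w) t.
Proof. by move=> df dg; apply: cderD => //; exact: cderN. Qed.

Lemma cder_id t : cder (fun t => t%:C) 1 t.
Proof. exact: (cder_real _ _ _ (rder_id t)). Qed.

Lemma cderX n t : cder (fun t => t%:C ^+ n) (n%:R * t%:C ^+ n.-1) t.
Proof.
have -> : (fun t : R => t%:C ^+ n) = (fun t => (t ^+ n)%:C).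
  by apply/funext => s; rewrite rmorphXn.
apply: cder_eq (cder_real _ _ _ (rderX t n)).
by rewrite rmorphM rmorphXn rmorph_nat.
Qed.

Lemma cder_exp z t : cder (fun t => cexp (z * t%:C)) (z * cexp (z * t%:C)) t.
Proof.
have lin a : is_derive t 1 (fun t => a * t) a.
  apply: is_derive_eq (rderM _ _ _ _ _ (rder_cst a t) (rder_id t)) _.
  by rewrite mul0r add0r mulr1.
have dE := rder_comp expR _ _ _ _ (is_derive_expR _) (lin (complex.Re z)).
have dC := rder_comp (@cos R) _ _ _ _ (is_derive_cos _) (lin (complex.Im z)).
have dS := rder_comp (@sin R) _ _ _ _ (is_derive_sin _) (lin (complex.Im z)).
split; rewrite /cexp /=.
  under eq_fun do rewrite Re_mulr Im_mulr.
  apply: is_derive_eq (rderM _ _ _ _ _ dE dC) _.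
  rewrite Re_mul /= Re_mulr Im_mulr; ring.
under eq_fun do rewrite Re_mulr Im_mulr.
apply: is_derive_eq (rderM _ _ _ _ _ dE dS) _.
rewrite Im_mul /= Re_mulr Im_mulr; ring.
Qed.

Definition ccont f := pos_continuous (fun t => complex.Re (f t)) /\
  pos_continuous (fun t => complex.Im (f t)).

Lemma cder_ccont f df : (forall t, 0 < t -> cder f (df t) t) -> ccont f.
Proof.
move=> h; split.
  by apply: (@pos_derivable_continuous _ _ (fun t => complex.Re (df t))) => t /h[].
by apply: (@pos_derivable_continuous _ _ (fun t => complex.Im (df t))) => t /h[].
Qed.

Lemma ccontD f g : ccont f -> ccont g -> ccont (fun t => f t + g t).
Proof.
move=> [f1 f2] [g1 g2]; split.
  by under eq_fun do rewrite ReD; move=> t t0; apply: cvgD; [exact: f1|exact: g1].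
by under eq_fun do rewrite ImD; move=> t t0; apply: cvgD; [exact: f2|exact: g2].
Qed.

Lemma ccontM f g : ccont f -> ccont g -> ccont (fun t => f t * g t).
Proof.
move=> [f1 f2] [g1 g2]; split.
  under eq_fun do rewrite Re_mul; move=> t t0; apply: cvgB; apply: cvgM;
  [exact: f1|exact: g1|exact: f2|exact: g2].
under eq_fun do rewrite Im_mul; move=> t t0; apply: cvgD; apply: cvgM;
[exact: f1|exact: g2|exact: f2|exact: g1].
Qed.

Lemma ccont_cst z : ccont (fun=> z).
Proof. by apply: cder_ccont => t _; exact: cder_cst. Qed.

Lemma ccontN f : ccont f -> ccont (fun t => - f t).
Proof.
move=> cf; have := ccontM _ _ (ccont_cst (-1)) cf.
by under eq_fun do rewrite mulN1r.
Qed.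

Lemma ccontX n : ccont (fun t => t%:C ^+ n).
Proof. by apply: cder_ccont => t _; exact: cderX. Qed.

Lemma ccont_exp z : ccont (fun t => cexp (z * t%:C)).
Proof. by apply: cder_ccont => t _; exact: cder_exp. Qed.

Lemma ccont_eq f g : (forall t, 0 < t -> f t = g t) -> ccont f -> ccont g.
Proof.
move=> fg [f1 f2].
have nt t : 0 < t -> \forall s \near t, g s = f s.
  by move=> t0; near=> s; rewrite fg//; near: s; exact: (cvgr_gt t (@cvg_id _ _) 0 t0).
split => t t0.
  have := f1 t t0; rewrite /prop_for /continuous_at fg// => h.
  apply: cvg_trans h; apply: near_eq_cvg.
  by have := nt t t0; apply: filterS => s ->.
have := f2 t t0; rewrite /prop_for /continuous_at fg// => h.
apply: cvg_trans h; apply: near_eq_cvg.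
by have := nt t t0; apply: filterS => s ->.
Unshelve. all: by end_near. Qed.

Lemma ccont_invX n : ccont (fun t => t%:C ^- n).
Proof.
apply: (ccont_eq (fun t : R => (t ^- n)%:C)) => [t t0|].
  by rewrite fmorphV rmorphXn.
apply: (cder_ccont _ (fun t => (- (n%:R * t ^+ n.-1) / (t ^+ n) ^+ 2)%:C)) => t t0.
apply: cder_real; apply: rderV; last exact: rderX.
by rewrite expf_eq0 gt_eqF ?andbF.
Qed.

Definition cint f v :=
  improper_integral (fun t => complex.Re (f t)) (complex.Re v) /\
  improper_integral (fun t => complex.Im (f t)) (complex.Im v).

Lemma cint_unique f v w : cint f v -> cint f w -> v = w.
Proof.
move=> [f1 f2] [g1 g2]; apply: eq_complexP.
  exact: improper_unique f1 g1.
exact: improper_unique f2 g2.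
Qed.

Lemma cint_eq f g v : (forall t, 0 < t -> f t = g t) -> cint f v -> cint g v.
Proof.
move=> fg [f1 f2]; split.
  by apply: improper_eq f1 => t t0; rewrite fg.
by apply: improper_eq f2 => t t0; rewrite fg.
Qed.

Lemma cintD f g v w : cint f v -> cint g w -> cint (fun t => f t + g t) (v + w).
Proof.
move=> [f1 f2] [g1 g2]; split.
  by rewrite ReD; apply: improper_eq (improperD _ _ _ _ f1 g1) => t _; rewrite ReD.
by rewrite ImD; apply: improper_eq (improperD _ _ _ _ f2 g2) => t _; rewrite ImD.
Qed.

Lemma cintZ f z v : cint f v -> cint (fun t => z * f t) (z * v).
Proof.
move=> [f1 f2]; split.
  have := improperD _ _ _ _ (improperZ _ _ (complex.Re z) f1)
    (improperZ _ _ (- complex.Im z) f2).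
  rewrite Re_mul mulNr; apply: improper_eq => t _; rewrite Re_mul; ring.
have := improperD _ _ _ _ (improperZ _ _ (complex.Re z) f2)
  (improperZ _ _ (complex.Im z) f1).
by rewrite Im_mul; apply: improper_eq => t _; rewrite Im_mul.
Qed.

Lemma cintN f v : cint f v -> cint (fun t => - f t) (- v).
Proof.
move=> /(cintZ _ (-1)); rewrite mulN1r; apply: cint_eq => t _.
by rewrite mulN1r.
Qed.

Lemma cintB f g v w : cint f v -> cint g w -> cint (fun t => f t - g t) (v - w).
Proof. by move=> hf hg; apply: cintD => //; exact: cintN. Qed.

Lemma cint0 : cint (fun=> 0) 0.
Proof.
have h : improper_integral (fun=> 0 : R) 0.
  have h := improperZ _ _ (0 : R) (expR_improper 1 (@ltr01 R)).
  have -> : (0 : R) = 0 * 1^-1 by rewrite mul0r.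
  by apply: improper_eq h => t _; rewrite !mul0r.
by split.
Qed.

Lemma cint_sum n (F : nat -> R -> R[i]) (v : nat -> R[i]) :
  (forall i, (i < n)%N -> cint (F i) (v i)) ->
  cint (fun t => \sum_(i < n) F i t) (\sum_(i < n) v i).
Proof.
elim: n => [_|n IH hF].
  by under eq_fun do rewrite big_ord0; rewrite big_ord0; exact: cint0.
under eq_fun do rewrite big_ord_recr/=; rewrite big_ord_recr/=.
apply: cintD; last exact: hF.
by apply: IH => i ni; apply: hF; rewrite ltnS ltnW.
Qed.

Lemma cint_real (h : R -> R) l : improper_integral h l -> cint (fun t => (h t)%:C) l%:C.
Proof. by move=> hl; split => //; have [_] := cint0. Qed.

Lemma cint_exists f C d : 0 < d -> ccont f ->
  (forall t, 0 < t -> normc (f t) <= C * expR (- (d * t))) -> exists v, cint f v.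
Proof.
move=> d0 [f1 f2] hC.
have [|a ha] := improper_exists _ C d d0 f1.
  by move=> t /hC; apply: le_trans; exact: Re_le_normc.
have [|b hb] := improper_exists _ C d d0 f2.
  by move=> t /hC; apply: le_trans; exact: Im_le_normc.
by exists (a +i* b).
Qed.

(** Real and imaginary parts are bounded separately, hence the factor 2, which reappears in the
    constants of later estimates. *)
Lemma cint_le f h v k : (forall t, 0 < t -> normc (f t) <= h t) ->
  cint f v -> improper_integral h k -> normc v <= 2 * k.
Proof.
move=> fh [f1 f2] hk; apply: le_trans (normc_le_ReIm _) _.
have := improper_norm_le _ _ _ _ (fun u u0 => le_trans (Re_le_normc _) (fh u u0)) f1 hk.
have := improper_norm_le _ _ _ _ (fun u u0 => le_trans (Im_le_normc _) (fh u u0)) f2 hk.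
lra.
Qed.

Lemma linear_bound_cvg0 F C : (forall t, 0 < t <= 1 -> normc (F t) <= C * t) ->
  (fun t => normc (F t)) @ (0:R)^'+ --> (0 : R).
Proof.
move=> Fl.
have C0 : 0 <= C.
  apply: (@le_trans _ _ (C * 1)); last by rewrite mulr1.
  by apply: le_trans (Fl 1 _); rewrite ?normc_ge0// ltr01 lexx.
apply/cvgr0Pnorm_le => e e0; near=> t.
have t0 : 0 < t by near: t; exact: nbhs_right_gt.
rewrite ger0_norm ?normc_ge0//; apply: le_trans (Fl t _) _.
  by rewrite t0/=; near: t; exact: nbhs_right_le.
have : t <= e / (C + 1).
  by near: t; apply: nbhs_right_le; rewrite divr_gt0// ltr_wpDl.
rewrite ler_pdivlMr ?ltr_wpDl// mulrC; apply: le_trans.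
by rewrite ler_wpM2r ?(ltW t0)// lerDl.
Unshelve. all: by end_near. Qed.

Lemma cder_cvg0 F v : cder F v 0 ->
  (fun t => normc (F t - F 0)) @ (0:R)^'+ --> (0 : R).
Proof.
move=> [h1 h2].
have c1 : {for (0:R), continuous (fun t => complex.Re (F t))}.
  by apply: differentiable_continuous; apply/derivable1_diffP; have [] := h1.
have c2 : {for (0:R), continuous (fun t => complex.Im (F t))}.
  by apply: differentiable_continuous; apply/derivable1_diffP; have [] := h2.
apply: cvg_at_right_filter.
apply/cvgr0Pnorm_le => e e0.
have e2 : 0 < e / 2 by rewrite divr_gt0.
move/cvgrPdist_le : c1 => /(_ _ e2) c1; move/cvgrPdist_le : c2 => /(_ _ e2) c2.
near=> t; rewrite ger0_norm ?normc_ge0//; apply: le_trans (normc_le_ReIm _) _.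
rewrite ReD ReN ImD ImN distrC [X in _ + X]distrC -[e](addrNK (e / 2)).
have -> : e - e / 2 = e / 2 by lra.
by apply: lerD; near: t.
Unshelve. all: by end_near. Qed.

Lemma cint_ftc f F l k : ccont f ->
  (forall T : R, 0 < T -> exists C, forall t, 0 < t <= T -> normc (f t) <= C) ->
  (forall t, 0 < t -> cder F (f t) t) ->
  (fun t => normc (F t - l)) @ (0:R)^'+ --> (0 : R) ->
  (fun t => normc (F t - k)) @ +oo --> (0 : R) -> cint f (k - l).
Proof.
move=> [c1 c2] bf dF Fl Fk.
(* p stands for the real part or the imaginary part. *)
have main (p : R[i] -> R) : (forall z w, p (z - w) = p z - p w) ->
    (forall z, `|p z| <= normc z) -> pos_continuous (fun t => p (f t)) ->
    (forall t, 0 < t -> is_derive t 1 (fun t => p (F t)) (p (f t))) ->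
    improper_integral (fun t => p (f t)) (p (k - l)).
  move=> pB pn pc pd; rewrite pB; apply: (improper_ftc _ (fun t => p (F t))) => //.
  - move=> T T0; have [K hK] := bf T T0; exists K => t /hK.
    by apply: le_trans.
  - apply/cvgrPdist_le => e e0; move/cvgrPdist_le : Fl => /(_ e e0) Fl.
    near=> t; rewrite distrC -pB; apply: le_trans (pn _) _.
    have : `|0 - normc (F t - l)| <= e by near: t.
    by rewrite sub0r normrN ger0_norm ?normc_ge0.
  - apply/cvgrPdist_le => e e0; move/cvgrPdist_le : Fk => /(_ e e0) Fk.
    near=> t; rewrite distrC -pB; apply: le_trans (pn _) _.
    have : `|0 - normc (F t - k)| <= e by near: t.
    by rewrite sub0r normrN ger0_norm ?normc_ge0.
split.
  apply: main => //; [by move=> z w; rewrite ReD ReN|exact: Re_le_normc|].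
  by move=> t /dF[].
apply: main => //; [by move=> z w; rewrite ImD ImN|exact: Im_le_normc|].
by move=> t /dF[].
Unshelve. all: by end_near. Qed.

(** The mean value theorem is applied to both components, hence the factor 2. One integration raises
    the order of vanishing at 0 by one. *)
Lemma cder_bound f df C n : f 0 = 0 -> (forall t, cder f (df t) t) ->
  (forall t, 0 <= t <= 1 -> normc (df t) <= C * t ^+ n) ->
  forall t, 0 <= t <= 1 -> normc (f t) <= 2 * C * t ^+ n.+1.
Proof.
move=> f0 hd hC t /andP[]; rewrite le_eqVlt => /predU1P[<- _|t0 t1].
  by rewrite f0 Normc.normc0 expr0n mulr0.
have main (h dh : R -> R) : h 0 = 0 -> (forall t, is_derive t 1 h (dh t)) ->
    (forall t, 0 <= t <= 1 -> `|dh t| <= C * t ^+ n) -> `|h t| <= C * t ^+ n.+1.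
  move=> h0 dhh hb.
  have [|c] := @MVT _ h dh 0 t t0 (fun x _ => dhh x).
  - by apply: derivable_within_continuous => z _; have [] := dhh z.
  rewrite in_itv/= => /andP[c0 ct]; rewrite h0 !subr0 => ->.
  rewrite normrM (gtr0_norm t0) exprSr mulrA ler_wpM2r ?(ltW t0)//.
  have c01 : 0 <= c <= 1 by rewrite ltW//= ltW// (lt_le_trans ct).
  apply: le_trans (hb c c01) _; rewrite ler_wpM2l//.
    have := hb 1; rewrite ler01 lexx expr1n mulr1 => /(_ isT).
    exact: le_trans.
  by rewrite lerXn2r ?nnegrE ?(ltW c0) ?(ltW t0) ?(ltW ct).
apply: le_trans (normc_le_ReIm _) _.
have := main (fun t => complex.Re (f t)) (fun t => complex.Re (df t)).
rewrite f0 => /(_ erefl (fun t => (hd t).1)) => h1.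
have := main (fun t => complex.Im (f t)) (fun t => complex.Im (df t)).
rewrite f0 => /(_ erefl (fun t => (hd t).2)) => h2.
have := h1 (fun u u1 => le_trans (Re_le_normc _) (hC u u1)).
have := h2 (fun u u1 => le_trans (Im_le_normc _) (hC u u1)).
lra.
Qed.

End ComplexCalculus.

(** * The principal logarithm *)

Section ComplexLog.
Context {R : realType}.
Implicit Types (z w : R[i]) (x y : R).
Local Notation normc := Normc.normc.

Lemma normc_sqr z : normc z ^+ 2 = complex.Re z ^+ 2 + complex.Im z ^+ 2.
Proof. by case: z => a b; rewrite /Normc.normc sqr_sqrtr// addr_ge0 ?sqr_ge0. Qed.

Lemma normc_gt0 z : z != 0 -> 0 < normc z.
Proof.
move=> z0; rewrite lt_neqAle normc_ge0 andbT eq_sym.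
by apply: contra_neq z0; exact: Normc.eq0_normc.
Qed.

Lemma cos_carg_bound z : -1 <= complex.Re z / normc z <= 1.
Proof.
have [->|z0] := eqVneq z 0; first by rewrite /= mul0r lerN10 ler01.
rewrite -ler_norml normrM normfV (ger0_norm (normc_ge0 z)).
by rewrite ler_pdivrMr ?normc_gt0// mul1r Re_le_normc.
Qed.

Lemma cos_carg z : cos (carg z) = complex.Re z / normc z.
Proof.
have b := cos_carg_bound z.
by rewrite /carg; case: ifP => _; rewrite ?cosN acosK.
Qed.

Lemma carg_norm z : `|carg z| = acos (complex.Re z / normc z).
Proof.
have b := cos_carg_bound z.
by rewrite /carg; case: ifP => _; rewrite ?normrN ger0_norm// acos_ge0.
Qed.

Lemma sin_carg z : z != 0 -> sin (carg z) = complex.Im z / normc z.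
Proof.
move=> z0; have b := cos_carg_bound z; have n0 := normc_gt0 _ z0.
have s : Num.sqrt (1 - (complex.Re z / normc z) ^+ 2) = `|complex.Im z| / normc z.
  have -> : 1 - (complex.Re z / normc z) ^+ 2 = (complex.Im z / normc z) ^+ 2.
    have := normc_sqr z => h.
    rewrite !exprMn exprVn h; have h0 : normc z ^+ 2 != 0 by rewrite expf_neq0 ?gt_eqF.
    by rewrite h in h0; field.
  by rewrite sqrtr_sqr normrM normfV (gtr0_norm n0).
rewrite /carg; case: ifPn => [i0|]; first by rewrite sin_acos// s ger0_norm.
by rewrite -ltNge => i0; rewrite sinN sin_acos// s ltr0_norm// mulNr opprK.
Qed.

Lemma cexp_clog z : z != 0 -> cexp (clog z) = z.
Proof.
move=> z0; have n0 := normc_gt0 _ z0; rewrite /cexp /clog /=.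
rewrite lnK ?posrE// cos_carg sin_carg//.
by apply: eq_complexP => /=; rewrite mulrC divfK// gt_eqF.
Qed.

(** Every splitting of a logarithm below reduces to this: only the imaginary part of the expected
    result has to be controlled. *)
Lemma clog_cexp w : -pi < complex.Im w < pi -> clog (cexp w) = w.
Proof.
move=> /andP[w1 w2]; have e0 := expR_gt0 (complex.Re w).
apply: eq_complexP.
  by rewrite -[LHS]/(ln (normc (cexp w))) normc_cexp expRK.
rewrite -[LHS]/(carg (cexp w)) /carg normc_cexp /cexp /= mulrAC divff ?gt_eqF// mul1r pmulr_rge0//.
have [w0|w0] := leP 0 (complex.Im w).
  rewrite sin_ge0_pi ?w0 ?(ltW w2)//=.
  by rewrite cosK// in_itv/= w0 ltW.
rewrite leNgt -oppr_gt0 -sinN sin_gt0_pi/= ?oppr_gt0 ?w0 1?ltrNl//.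
by rewrite cosKN ?opprK// (ltW w0) (ltW w1).
Qed.

Lemma clog_real x : 0 < x -> clog x%:C = (ln x)%:C.
Proof.
move=> x0; rewrite -{1}(lnK x0) -cexp_real clog_cexp//=.
by rewrite oppr_lt0 pi_gt0.
Qed.

Lemma clogM z w : z != 0 -> w != 0 -> -pi < carg z + carg w < pi ->
  clog (z * w) = clog z + clog w.
Proof.
move=> z0 w0 zw; rewrite -{1}(cexp_clog z)// -{1}(cexp_clog w)// -cexpD.
by rewrite clog_cexp// ImD.
Qed.

Lemma clog_div z w : z != 0 -> w != 0 -> -pi < carg z - carg w < pi ->
  clog (z / w) = clog z - clog w.
Proof.
move=> z0 w0 zw; rewrite -{1}(cexp_clog z)// -{1}(cexp_clog w)// -cexpN -cexpD.
by rewrite clog_cexp// ImD ImN.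
Qed.

(** The cosine decreases on [0, pi], so a lower bound on the cosine of the argument is an upper
    bound on its absolute value. *)
Lemma carg_lt e z : 0 < e -> e < pi -> cos e * normc z < complex.Re z -> `|carg z| < e.
Proof.
move=> e0 ep h.
have [z0|z0] := eqVneq z 0.
  by move: h; rewrite z0 Normc.normc0 mulr0 ltxx.
have b := cos_carg_bound z.
rewrite carg_norm -ltr_cos ?in_itv/= ?acos_ge0 ?acos_lepi ?(ltW e0) ?(ltW ep)//.
by rewrite acosK// ltr_pdivlMr// normc_gt0.
Qed.

Lemma carg_Re_gt0 z : 0 < complex.Re z -> `|carg z| < pi / 2.
Proof.
move=> z0; apply: carg_lt; rewrite ?divr_gt0 ?pi_gt0//.
  by rewrite ltr_pdivrMr// ltr_pMr ?pi_gt0// ltr1n.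
by rewrite cos_pihalf mul0r.
Qed.

Lemma cvg_carg_shift z e : 0 < e -> exists T : R, forall t : R, T <= t -> `|carg (z + t%:C)| < e.
Proof.
move=> e0; wlog ep : e e0 / e < pi.
  move=> H; have p0 := @pi_gt0 R.
  have m0 : 0 < Num.min e (pi / 2) by rewrite lt_min e0 divr_gt0.
  have mp : Num.min e (pi / 2) < pi.
    by rewrite gt_min ltr_pdivrMr// ltr_pMr// ltr1n orbT.
  have [T hT] := H _ m0 mp; exists T => t /hT.
  by rewrite lt_min => /andP[].
have ce1 : cos e < 1.
  rewrite -cos0 ltr_cos ?in_itv/= ?lexx ?(ltW e0) ?(ltW ep)// ltW ?pi_gt0//.
(* Once s = a + t exceeds |b| / (1 - cos e), one has cos e (s + |b|) < s. Since |s + ib| <= s + |b|,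
   this gives the criterion of [carg_lt] when cos e > 0; otherwise s > 0 is enough. *)
case: z => a b; exists (`|a| + `|b| + `|b| / (1 - cos e) + 1) => t ht.
apply: carg_lt => //; rewrite /= addr0.
set s := a + t.
have s0 : `|b| / (1 - cos e) < s.
  have := ler_norm (- a); rewrite normrN; have := normr_ge0 b.
  rewrite /s; lra.
have d0 : 0 <= `|b| / (1 - cos e) by rewrite divr_ge0// subr_ge0 ltW.
have sp : 0 < s by exact: le_lt_trans s0.
have n1 : normc (s +i* b) <= s + `|b|.
  by apply: le_trans (normc_le_ReIm _) _; rewrite /= (gtr0_norm sp).
have [c0|c0] := leP (cos e) 0.
  apply: le_lt_trans sp; rewrite mulr_le0_ge0//; exact: sqrtr_ge0.
have : cos e * normc (s +i* b) <= cos e * (s + `|b|) by rewrite ler_pM2l.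
move=> /le_lt_trans; apply.
move: s0; rewrite ltr_pdivrMr ?subr_gt0// => h.
have := cos_le1 e; have := normr_ge0 b; nra.
Qed.

(* The points from which the ray to +oo avoids ]-oo, 0]. *)
Definition slit z := (complex.Im z != 0) || (0 < complex.Re z).

Lemma slit_neq0 z : slit z -> z != 0.
Proof. by apply: contraL => /eqP->; rewrite /slit /= eqxx ltxx. Qed.

Lemma slit_shift z x : slit z -> 0 <= x -> slit (z + x%:C).
Proof.
by rewrite /slit ReD ImD /= addr0 => /orP[->//|z0 x0]; rewrite ltr_wpDr ?orbT.
Qed.

Lemma slit_Re z : 0 < complex.Re z -> slit z.
Proof. by move=> h; rewrite /slit h orbT. Qed.

Lemma cder_clog_shift z (t : R) : slit (z + t%:C) ->
  cder (fun t => clog (z + t%:C)) (z + t%:C)^-1 t.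
Proof.
case: z => a b; rewrite /slit /= addr0 => hs.
pose N := fun s : R => (a + s) ^+ 2 + b ^+ 2.
have N0 : 0 < N t.
  have [b0|b0] := eqVneq b 0.
    move: hs; rewrite b0 eqxx/= => hs; rewrite /N b0 expr0n/= addr0.
    by rewrite exprn_even_gt0//= gt_eqF.
  by rewrite /N ltr_wpDl ?sqr_ge0// exprn_even_gt0.
have ds : is_derive t 1 (fun s => a + s) 1.
  by apply: is_derive_eq (rderD _ _ _ _ _ (rder_cst a t) (rder_id t)) _; rewrite add0r.
have dN : is_derive t 1 N (2 * (a + t)).
  apply: is_derive_eq (rderD _ _ _ _ _ (rder_comp (fun x => x ^+ 2) _ _ _ _ (rderX _ 2) ds) (rder_cst _ t)) _.
  by rewrite /= expr1 mulr1 addr0.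
have s0 : 0 < Num.sqrt (N t) by rewrite sqrtr_gt0.
have sE : Num.sqrt (N t) ^+ 2 = N t by rewrite sqr_sqrtr// ltW.
set S := Num.sqrt (N t) in s0 sE.
have dS : is_derive t 1 (fun s => Num.sqrt (N s)) ((a + t) / Num.sqrt (N t)).
  apply: is_derive_eq (rder_comp Num.sqrt _ _ _ _ (is_derive1_sqrt N0) dN) _.
  by rewrite -/S; field; rewrite gt_eqF.
have dL : is_derive t 1 (fun s => ln (Num.sqrt (N s))) ((a + t) / N t).
  have h := rder_comp (@ln R) (fun s => Num.sqrt (N s)) t _ _ (is_derive1_ln s0) dS.
  apply: (is_derive_eq h).
  by rewrite -/S -sE; field; rewrite gt_eqF.
have iE : ((a +i* b) + t%:C)^-1 = ((a + t) / N t) +i* (- (b / N t)).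
  have n0 : (a +i* b) + t%:C != 0.
    apply/eqP => -[h1]; rewrite addr0 => h2.
    by move: N0; rewrite /N h1 h2 expr0n/= addr0 ltxx.
  apply: (mulfI n0); rewrite divff//.
  apply: eq_complexP; rewrite ?Re_mul ?Im_mul /= addr0.
    by rewrite mulrN opprK !mulrA -mulrDl -!expr2 divff// gt_eqF.
  by rewrite mulrN !mulrA mulrC [b * (a + t)]mulrC; ring.
rewrite iE; split => /=.
  by under eq_fun do rewrite addr0.
(* acos is not differentiable at 1, but on the positive real axis the argument is identically 0 near
   t. *)
have [b0|b0] := eqVneq b 0.
  move: hs; rewrite b0 eqxx/= => hs.
  rewrite mul0r oppr0.
  apply: (near_eq_is_derive _ (rder_cst 0 t)).
  near=> s.
  have s1 : 0 < a + s.
    by rewrite -(subrr a) ltrD2l; near: s;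
    apply: (cvgr_gt t (@cvg_id _ _)); rewrite -(ltrD2l a) subrr.
  rewrite /carg /= addr0 lexx expr0n/= addr0 sqrtr_sqr gtr0_norm// divff ?gt_eqF//.
  by rewrite acos1.
have cE s : -1 < (a + s) / Num.sqrt (N s) < 1.
  have Ns : 0 < N s by rewrite /N ltr_wpDl ?sqr_ge0// exprn_even_gt0.
  have ss : 0 < Num.sqrt (N s) by rewrite sqrtr_gt0.
  rewrite -ltr_norml normrM normfV (gtr0_norm ss) ltr_pdivrMr// mul1r.
  by rewrite -sqrtr_sqr ltr_sqrt// /N ltrDl exprn_even_gt0.
have dq : is_derive t 1 (fun s => (a + s) / Num.sqrt (N s))
    (b ^+ 2 / (Num.sqrt (N t) * N t)).
  have h := rderM _ _ _ _ _ ds (rderV (fun s => Num.sqrt (N s)) t _ (negbT (gt_eqF s0)) dS).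
  apply: is_derive_eq h _.
  have -> : b ^+ 2 = S ^+ 2 - (a + t) ^+ 2 by rewrite sE /N; ring.
  by rewrite -/S -sE; field; rewrite gt_eqF.
have sq : Num.sqrt (1 - ((a + t) / Num.sqrt (N t)) ^+ 2) = `|b| / Num.sqrt (N t).
  have -> : 1 - ((a + t) / Num.sqrt (N t)) ^+ 2 = (b / Num.sqrt (N t)) ^+ 2.
    rewrite -/S !exprMn exprVn.
    have -> : b ^+ 2 = S ^+ 2 - (a + t) ^+ 2 by rewrite sE /N; ring.
    by field; rewrite gt_eqF.
  by rewrite sqrtr_sqr normrM normfV (gtr0_norm s0).
have da := rder_comp (@acos R) (fun s => (a + s) / Num.sqrt (N s)) t _ _ (is_derive1_acos (cE t)) dq.
rewrite sq in da.
rewrite /carg /=; under eq_fun do rewrite addr0.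
have [bp|bn] := leP 0 b.
  apply: is_derive_eq da _; rewrite ger0_norm//.
  by rewrite -/S -sE; field; rewrite b0 gt_eqF.
apply: is_derive_eq (is_deriveN da) _; rewrite ltr0_norm//.
by rewrite -/S -sE; field; rewrite b0 gt_eqF.
Unshelve. all: by end_near. Qed.

(** Both arguments tend to 0 and the ratio of the moduli tends to 1. *)
Lemma clog_shift_cvg z w :
  (fun t : R => normc (clog (z + t%:C) - clog (w + t%:C))) @ +oo --> (0 : R).
Proof.
apply/cvgr0Pnorm_le => e e0.
have e4 : 0 < e / 4 by rewrite divr_gt0.
have [T1 h1] := cvg_carg_shift z (e / 4) e4.
have [T2 h2] := cvg_carg_shift w (e / 4) e4.
(* ln (1 + q) = e / 4: a modulus that grows by a relative amount of at most q moves its logarithm by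
   at most e / 4. [ratio] is then used in both directions. *)
pose q := expR (e / 4) - 1.
have q0 : 0 < q by rewrite subr_gt0 expR_gt1.
have grow u : exists T : R, forall t : R, T <= t -> 0 < normc (u + t%:C) /\
    normc (z - w) <= q * normc (u + t%:C).
  exists (normc u + normc (z - w) / q + 1) => t ht.
  have : t <= normc (u + t%:C) + normc u.
    have := normcB (u + t%:C) u; rewrite [u + _]addrC addrK normc_real; apply: le_trans; exact: ler_norm.
  have d0 : 0 <= normc (z - w) / q by rewrite divr_ge0 ?normc_ge0// ltW.
  move=> h; split; first lra.
  rewrite mulrC -ler_pdivrMr//; lra.
have [T3 h3] := grow z; have [T4 h4] := grow w.
near=> t.
have t1 : T1 <= t by near: t; apply: nbhs_pinfty_ge; exact: num_real.
have t2 : T2 <= t by near: t; apply: nbhs_pinfty_ge; exact: num_real.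
have t3 : T3 <= t by near: t; apply: nbhs_pinfty_ge; exact: num_real.
have t4 : T4 <= t by near: t; apply: nbhs_pinfty_ge; exact: num_real.
rewrite ger0_norm ?normc_ge0//; apply: le_trans (normc_le_ReIm _) _.
have -> : e = e / 2 + e / 2 by field.
rewrite ReD ReN ImD ImN; apply: lerD; last first.
  apply: le_trans (ler_normB _ _) _; have := h1 t t1; have := h2 t t2.
  rewrite /clog /=; lra.
have ratio u v : normc (z - w) = normc (u - v) -> 0 < normc (u + t%:C) ->
    0 < normc (v + t%:C) -> normc (z - w) <= q * normc (v + t%:C) ->
    ln (normc (u + t%:C)) - ln (normc (v + t%:C)) <= e / 4.
  move=> uv u0 v0 hv; rewrite -ln_div ?posrE// -[leRHS]expRK ler_ln ?posrE ?divr_gt0 ?expR_gt0//.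
  rewrite ler_pdivrMr//.
  have := normcD (v + t%:C) (u - v); rewrite addrC addrA subrK -uv /=.
  rewrite /q in hv; lra.
have [z1 z2] := h3 t t3; have [w1 w2] := h4 t t4.
have := ratio z w erefl z1 w1 w2.
have := ratio w z _ w1 z1 z2; rewrite -(normcN (w - z)) opprB => /(_ erefl).
rewrite -[complex.Re (clog _)]/(ln _) -[complex.Re (clog (w + _))]/(ln _).
rewrite ler_norml; lra.
Unshelve. all: by end_near. Qed.

Lemma slit_bound z : slit z -> exists2 d : R, 0 < d &
  forall t : R, 0 <= t -> d <= normc (z + t%:C).
Proof.
rewrite /slit; case: (eqVneq (complex.Im z) 0) => [_ /= z0|z0 _].
  exists (complex.Re z) => // t t0; apply: le_trans (Re_le_normc _).
  by rewrite ReD /= ger0_norm ?lerDl// addr_ge0// ltW.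
exists `|complex.Im z|; first by rewrite normr_gt0.
by move=> t t0; apply: le_trans (Im_le_normc _); rewrite ImD /= addr0.
Qed.

Lemma complex_invE z : z != 0 ->
  z^-1 = (complex.Re z +i* - complex.Im z) * ((normc z ^+ 2)^-1)%:C.
Proof.
move=> z0; have n2 : normc z ^+ 2 != 0 by rewrite expf_neq0// gt_eqF// normc_gt0.
apply: (mulfI z0); rewrite divff//.
move: n2; rewrite normc_sqr; case: z z0 => a b z0 /= n2.
by apply: eq_complexP; rewrite ?Re_mul ?Im_mul /=; field.
Qed.

Lemma ccont_slitV z : slit z -> ccont (fun t => (z + t%:C)^-1).
Proof.
move=> sz; have [d d0 hd] := slit_bound _ sz.
have [a b] : ccont (fun t => z + t%:C).
  by apply: ccontD; [exact: ccont_cst|exact: (ccontX 1)].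
have iE (t : R) : 0 < t -> (z + t%:C)^-1 = (complex.Re (z + t%:C) +i* - complex.Im (z + t%:C)) *
    ((normc (z + t%:C) ^+ 2)^-1)%:C.
  move=> t0; apply: complex_invE; apply: slit_neq0; apply: slit_shift => //.
  exact: ltW.
apply: ccont_eq (fun u u0 => esym (iE u u0)) _; apply: ccontM.
  by split => //= t t0; apply: cvgN; exact: b.
have cn : pos_continuous (fun t : R => (normc (z + t%:C) ^+ 2)^-1).
  move=> t t0; apply: cvgV.
    by rewrite expf_neq0// gt_eqF//; apply: lt_le_trans (hd _ (ltW t0)).
  under eq_fun do rewrite normc_sqr !expr2.
  rewrite normc_sqr !expr2.
  by apply: cvgD; apply: cvgM; (exact: a || exact: b).
split => //= t _; exact: cvg_cst.
Qed.

(** The primitive log(1 + t) - log(z + t) is - log z at 0 and tends to 0 at +oo; the slit condition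
    keeps z + t off the cut for all t >= 0. *)
Lemma clog_integral z : slit z ->
  cint (fun t => (1 + t%:C)^-1 - (z + t%:C)^-1) (clog z).
Proof.
move=> sz; have s1 : slit 1 by rewrite slit_Re//= ltr01.
pose F t := clog (1 + t%:C) - clog (z + t%:C).
pose dF t : R[i] := (1 + t%:C)^-1 - (z + t%:C)^-1.
have ex t : 0 <= t -> cder F (dF t) t.
  by move=> t0; apply: cderB; apply: cder_clog_shift; exact: slit_shift.
have -> : clog z = 0 - F 0.
  by rewrite /F !addr0 clog_real ?ltr01// ln1 !sub0r opprK.
apply: (cint_ftc dF F).
- by apply: ccontD; [exact: ccont_slitV|apply: ccontN; exact: ccont_slitV].
- move=> T T0; have [d d0 hd] := slit_bound _ sz; have [d' d0' hd'] := slit_bound _ s1.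
  exists (d'^-1 + d^-1) => t /andP[t0 _]; apply: le_trans (normcB _ _) _.
  rewrite !Normc.normcV; apply: lerD; rewrite lef_pV2 ?posrE ?hd ?hd' ?ltW//.
    exact: lt_le_trans (hd' _ (ltW t0)).
  exact: lt_le_trans (hd _ (ltW t0)).
- by move=> t t0; apply: ex; exact: ltW.
- exact: cder_cvg0 (ex _ (lexx _)).
- under eq_fun do rewrite subr0; exact: clog_shift_cvg.
Qed.

End ComplexLog.

(** * Integrands bounded near 0 and exponentially small at +oo *)

Section Decay.
Context {R : realType}.
Implicit Types (f g : R -> R[i]) (x y z : R[i]) (t : R).
Local Notation normc := Normc.normc.

Definition bounded0 f := exists C, forall t, 0 < t <= 1 -> normc (f t) <= C.

(** Constant and rate are existential, so that the rate may shrink when the function is multiplied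
    by a polynomial. *)
Definition exp_decay f := exists C d : R, [/\ 0 < d, 0 <= C &
  forall t, 1 <= t -> normc (f t) <= C * expR (- (d * t))].

Lemma expR_decay_mono (d d' t : R) : d' <= d -> 0 <= t -> expR (- (d * t)) <= expR (- (d' * t)).
Proof. by move=> dd t0; rewrite ler_expR lerN2 ler_wpM2r. Qed.

Lemma exp_decayD f g : exp_decay f -> exp_decay g -> exp_decay (fun t => f t + g t).
Proof.
move=> [C [d [d0 C0 hC]]] [C' [d' [d'0 C'0 hC']]].
exists (C + C'), (Num.min d d'); split; [by rewrite lt_min d0|exact: addr_ge0|].
move=> t t1; have t0 : 0 <= t by exact: le_trans t1.
apply: le_trans (normcD _ _) _; rewrite mulrDl; apply: lerD.
  by apply: le_trans (hC _ t1) _; rewrite ler_wpM2l// expR_decay_mono// ge_min lexx.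
by apply: le_trans (hC' _ t1) _; rewrite ler_wpM2l// expR_decay_mono// ge_min lexx orbT.
Qed.

Lemma exp_decayZ f z : exp_decay f -> exp_decay (fun t => z * f t).
Proof.
move=> [C [d [d0 C0 hC]]]; exists (normc z * C), d; split => //.
  by rewrite mulr_ge0 ?normc_ge0.
by move=> t t1; rewrite Normc.normcM -mulrA ler_wpM2l ?normc_ge0// hC.
Qed.

Lemma exp_decayN f : exp_decay f -> exp_decay (fun t => - f t).
Proof.
by move=> /(exp_decayZ _ (-1)); congr exp_decay; apply/funext => t; rewrite mulN1r.
Qed.

Lemma exp_decay_mulX f : exp_decay f -> exp_decay (fun t => f t * t%:C).
Proof.
move=> [C [d [d0 C0 hC]]]; have [K K0 hK] := exprn_decay 1 d d0.
exists (C * K), (d / 2); split; [by rewrite divr_gt0|exact: mulr_ge0|].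
move=> t t1; have t0 : 0 <= t by exact: le_trans t1.
rewrite Normc.normcM normc_real ger0_norm//.
apply: le_trans (ler_wpM2r t0 (hC _ t1)) _.
have := ler_wpM2l C0 (hK t t0); rewrite expr1; lra.
Qed.

Lemma exp_decay_poly f (p : {poly R[i]}) : exp_decay f ->
  exp_decay (fun t => f t * p.[t%:C]).
Proof.
move=> hf; elim/poly_ind: p => [|p c IH].
  exists 0, 1; split => // t _.
  by rewrite horner0 mulr0 Normc.normc0 mul0r.
have := exp_decayD _ _ (exp_decay_mulX _ IH) (exp_decayZ _ c hf).
congr exp_decay; apply/funext => t.
by rewrite hornerMXaddC; ring.
Qed.

Lemma exp_decay_invX f n : exp_decay f -> exp_decay (fun t => t%:C ^- n * f t).
Proof.
move=> [C [d [d0 C0 hC]]]; exists C, d; split => // t t1.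
apply: le_trans (hC _ t1); rewrite Normc.normcM Normc.normcV normcX normc_real.
rewrite ler_piMl ?normc_ge0// invf_le1 ?exprn_gt0 ?normr_gt0 ?gt_eqF ?(lt_le_trans _ t1)//.
by rewrite exprn_ege1// ler_normr t1.
Qed.

Lemma exp_decay_exp x : 0 < complex.Re x -> exp_decay (fun t => cexp (- x * t%:C)).
Proof.
move=> x0; exists 1, (complex.Re x); split => // t _.
by rewrite normc_cexp Re_mulr ReN mul1r mulNr.
Qed.

Definition integrable_exp f := [/\ ccont f, bounded0 f & exp_decay f].

Lemma integrable_exp_bound f : bounded0 f -> exp_decay f -> exists C d : R,
  [/\ 0 < d, 0 <= C & forall t, 0 < t -> normc (f t) <= C * expR (- (d * t))].
Proof.
move=> [K hK] [C [d [d0 C0 hC]]].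
have K0 : 0 <= K by apply: le_trans (hK 1 _); rewrite ?normc_ge0// ltr01 lexx.
(* The term K e^d serves on ]0, 1], where e^(d - dt) >= 1. *)
exists (C + K * expR d), d; split => //.
  by rewrite addr_ge0// mulr_ge0// expR_ge0.
move=> t t0; rewrite mulrDl; have [t1|t1] := leP t 1.
  apply: le_trans (hK t _) _; first by rewrite t0 t1.
  rewrite -[leLHS]add0r lerD ?mulr_ge0 ?expR_ge0// -mulrA -expRD ler_peMr//.
  by rewrite -expR0 ler_expR subr_ge0 ler_piMr// ltW.
apply: le_trans (hC _ (ltW t1)) _.
by rewrite lerDl !mulr_ge0 ?expR_ge0.
Qed.

Lemma integrable_exp_cint f : integrable_exp f -> exists v, cint f v.
Proof.
move=> [cf bf df]; have [C [d [d0 C0 hC]]] := integrable_exp_bound _ bf df.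
exact: cint_exists hC.
Qed.

Lemma bounded0D f g : bounded0 f -> bounded0 g -> bounded0 (fun t => f t + g t).
Proof.
move=> [C hC] [K hK]; exists (C + K) => t t1; apply: le_trans (normcD _ _) _.
by rewrite lerD ?hC ?hK.
Qed.

Lemma bounded0Z f z : bounded0 f -> bounded0 (fun t => z * f t).
Proof.
move=> [C hC]; exists (normc z * C) => t t1.
by rewrite Normc.normcM ler_wpM2l ?normc_ge0 ?hC.
Qed.

Lemma bounded0_cexp z : bounded0 (fun t => cexp (z * t%:C)).
Proof.
exists (expR (normc z)) => t /andP[t0 t1]; rewrite normc_cexp ler_expR Re_mulr.
have := Re_le_normc z; rewrite ler_norml => /andP[_ h].
apply: le_trans (ler_wpM2r (ltW t0) h) _.
by rewrite ler_piMr ?normc_ge0.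
Qed.

Lemma bounded0_poly (p : {poly R[i]}) : bounded0 (fun t => p.[t%:C]).
Proof.
elim/poly_ind: p => [|p c [C hC]].
  by exists 0 => t _; rewrite horner0 Normc.normc0.
exists (C + normc c) => t t1; have /andP[t0 t1'] := t1.
rewrite hornerMXaddC; apply: le_trans (normcD _ _) _; rewrite lerD2r.
rewrite Normc.normcM normc_real gtr0_norm//.
apply: le_trans (hC t t1); by rewrite ler_piMr ?normc_ge0.
Qed.

Lemma integrable_expD f g : integrable_exp f -> integrable_exp g ->
  integrable_exp (fun t => f t + g t).
Proof.
move=> [? ? ?] [? ? ?]; split; [exact: ccontD|exact: bounded0D|exact: exp_decayD].
Qed.

Lemma integrable_expZ f z : integrable_exp f -> integrable_exp (fun t => z * f t).
Proof.
move=> [? ? ?]; split; [|exact: bounded0Z|exact: exp_decayZ].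
by apply: ccontM => //; exact: ccont_cst.
Qed.

Lemma integrable_exp_exp x : 0 < complex.Re x -> integrable_exp (fun t => cexp (- x * t%:C)).
Proof.
by move=> x0; split; [exact: ccont_exp|exact: bounded0_cexp|exact: exp_decay_exp].
Qed.

Lemma integrable_exp_lbound f : integrable_exp f ->
  forall T : R, 0 < T -> exists C, forall t, 0 < t <= T -> normc (f t) <= C.
Proof.
move=> [cf bf df] T T0; have [C [d [d0 C0 hC]]] := integrable_exp_bound _ bf df.
exists C => t /andP[t0 _]; apply: le_trans (hC t t0) _.
by rewrite ler_piMr// -expR0 ler_expR oppr_le0 mulr_ge0// ltW.
Qed.

Lemma exp_decay_cvg0 f : exp_decay f -> (fun t => normc (f t)) @ +oo --> (0 : R).
Proof.
move=> [C [d [d0 C0 hC]]].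
apply: (@squeeze_cvgr _ _ _ _ (fun=> 0) (fun t => C * expR (- (d * t)))).
- near=> t; rewrite normc_ge0/= hC//; near: t; apply: nbhs_pinfty_ge; exact: num_real.
- exact: cvg_cst.
- rewrite -[X in _ --> X](mulr0 C); apply: cvgM; first exact: cvg_cst.
  exact: cvg_expR_decay.
Unshelve. all: by end_near. Qed.

(** A primitive that vanishes at both ends: the form in which every integration by parts of complex
    integrands is carried out. *)
Lemma cint_ftc0 f F : integrable_exp f -> (forall t, 0 < t -> cder F (f t) t) ->
  (exists C, forall t, 0 < t <= 1 -> normc (F t) <= C * t) -> exp_decay F ->
  cint f 0.
Proof.
move=> fi dF [C hC] dec; rewrite -[0](subrr 0).
have [cf _ _] := fi.
apply: (cint_ftc f F) => //; first exact: integrable_exp_lbound.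
  by under eq_fun do rewrite subr0; exact: linear_bound_cvg0 hC.
by under eq_fun do rewrite subr0; exact: exp_decay_cvg0.
Qed.

Lemma Re_gt0_neq0 x : 0 < complex.Re x -> x != 0.
Proof. by move=> x0; apply: slit_neq0; exact: slit_Re. Qed.

Lemma cexp_integral x : 0 < complex.Re x -> cint (fun t => cexp (- x * t%:C)) x^-1.
Proof.
move=> x0; have xn0 := Re_gt0_neq0 _ x0.
have fi := integrable_exp_exp _ x0; have [cf _ _] := fi.
pose F t := - x^-1 * cexp (- x * t%:C).
have dF t : cder F (cexp (- x * t%:C)) t.
  by apply: cder_eq (cderZ _ (- x^-1) _ _ (cder_exp (- x) t)); rewrite mulrA mulrNN mulVf ?mul1r.
have -> : x^-1 = 0 - F 0 by rewrite /F mulr0 cexp0 mulr1 sub0r opprK.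
apply: (cint_ftc _ F) => //; first exact: integrable_exp_lbound.
  exact: cder_cvg0 (dF 0).
under eq_fun do rewrite subr0.
by apply: exp_decay_cvg0; apply: exp_decayZ; exact: exp_decay_exp.
Qed.

End Decay.

(** * Taylor remainders of e^(yt) and the regularized integrals of t^(-n-1) e^(-xt) *)

Section Taylor.
Context {R : realType}.
Implicit Types (x y z : R[i]) (t : R).
Local Notation normc := Normc.normc.

Lemma cder_poly (p : {poly R[i]}) t : cder (fun t => p.[t%:C]) p^`().[t%:C] t.
Proof.
elim/poly_ind: p => [|p c IH].
  under eq_fun do rewrite horner0; rewrite deriv0 horner0; exact: cder_cst.
under eq_fun do rewrite hornerMXaddC.
apply: cder_eq (cderD _ _ _ _ _ (cderM _ _ _ _ _ IH (cder_id t)) (cder_cst c t)).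
by rewrite derivMXaddC hornerD hornerMX; ring.
Qed.

(** The terms of degree < n of the power series of e^(yt) in t. *)
Definition taylorp y n : {poly R[i]} := \poly_(i < n) (y ^+ i / i`!%:R).

Lemma taylorp0 y : taylorp y 0 = 0.
Proof. by apply/polyP => i; rewrite coef_poly coef0. Qed.

Lemma fact_neq0 n : n`!%:R != 0 :> R[i].
Proof. by rewrite pnatr_eq0 -lt0n fact_gt0. Qed.

Lemma taylorpS y n : (taylorp y n.+1) = taylorp y n + (y ^+ n / n`!%:R) *: 'X^n.
Proof.
apply/polyP => i; rewrite coefD !coef_poly coefZ coefXn ltnS leq_eqVlt.
by case: ltngtP => /=; rewrite ?mulr0 ?mulr1 ?addr0 ?add0r// => ->.
Qed.

Lemma deriv_taylorp y n : (taylorp y n.+1)^`() = y *: taylorp y n.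
Proof.
apply/polyP => i; rewrite coef_deriv coefZ !coef_poly ltnS.
case: ifP => _; last by rewrite mul0rn mulr0.
rewrite factS natrM exprS -[_ *+ _]mulr_natr; have := fact_neq0 i.
have : i.+1%:R != 0 :> R[i] by rewrite pnatr_eq0.
by move: (i.+1%:R) (i`!%:R) => u v u0 v0; field; rewrite u0 v0.
Qed.

Definition exp_rem y n t := cexp (y * t%:C) - (taylorp y n).[t%:C].

Lemma cder_exp_rem y n t : cder (exp_rem y n.+1) (y * exp_rem y n t) t.
Proof.
apply: cder_eq (cderB _ _ _ _ _ (cder_exp y t) (cder_poly (taylorp y n.+1) t)).
by rewrite deriv_taylorp hornerZ mulrBr.
Qed.

Lemma exp_rem0 y n : exp_rem y n.+1 0 = 0.
Proof.
rewrite /exp_rem mulr0 cexp0 horner_coef0 coef_poly/= expr0 fact0 divr1.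
by rewrite subrr.
Qed.

(** The remainder of order n + 1 vanishes at 0 and its derivative is y times the remainder of order
    n, so [cder_bound] gains one power of t at each step. *)
Lemma exp_rem_bound y n : exists C, forall t, 0 <= t <= 1 ->
  normc (exp_rem y n t) <= C * t ^+ n.
Proof.
elim: n => [|n [C hC]].
  have [C hC] := bounded0_cexp y; exists (C + 1) => t /andP[].
  rewrite le_eqVlt expr0 mulr1 /exp_rem.
  rewrite taylorp0 horner0 subr0 => /predU1P[<- _|t0 t1].
    rewrite mulr0 cexp0 Normc.normc1 lerDr.
    by apply: le_trans (hC 1 _); rewrite ?normc_ge0// ltr01 lexx.
  by rewrite (le_trans (hC t _)) ?t0// lerDl.
exists (2 * (normc y * C)) => t t1.
apply: (cder_bound _ _ (normc y * C) n (exp_rem0 y n) (cder_exp_rem y n) _ t t1).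
by move=> s s1; rewrite Normc.normcM -mulrA ler_wpM2l ?normc_ge0// hC.
Qed.

(* t^(-n-1) e^(-xt), made integrable at 0 by subtracting e^(-t) times a Laurent
   polynomial in t; its integral regint n x is - (-x)^n / n! log x plus a
   polynomial in x. *)
Definition regpow n x t : R[i] :=
  t%:C ^- n.+1 * (cexp (- x * t%:C) - cexp (- 1 * t%:C) * (taylorp (1 - x) n.+1).[t%:C]).

(** Since e^(-xt) = e^(-t) e^((1-x)t), what multiplies t^(-n-1) is e^(-t) times a Taylor remainder
    of order n + 1: hence boundedness at 0, while the factor e^(-t) makes the subtracted polynomial
    decay at +oo. *)
Lemma regpowE n x t :
  regpow n x t = t%:C ^- n.+1 * (cexp (- 1 * t%:C) * exp_rem (1 - x) n.+1 t).
Proof.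
rewrite /regpow /exp_rem; congr (_ * _).
rewrite [RHS]mulrBr -cexpD; congr (cexp _ - _); ring.
Qed.

Lemma normc_invX (t : R) n : normc (t%:C ^- n) = `|t| ^- n.
Proof. by rewrite Normc.normcV normcX normc_real. Qed.

Lemma normc_cexpN1 t : 0 <= t -> normc (cexp (- 1 * t%:C)) <= 1.
Proof. by move=> t0; rewrite normc_cexp -expR0 ler_expR Re_mulr ReN /= mulN1r oppr_le0. Qed.

Lemma regpow_integrable n x : 0 < complex.Re x -> integrable_exp (regpow n x).
Proof.
move=> x0; split.
- apply: ccontM; first exact: ccont_invX.
  apply: ccontD; first exact: ccont_exp.
  apply: ccontN; apply: ccontM; first exact: ccont_exp.
  by apply: cder_ccont => t _; exact: cder_poly.
- have [C hC] := exp_rem_bound (1 - x) n.+1; exists C => t /andP[t0 t1].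
  rewrite regpowE !Normc.normcM normc_invX (gtr0_norm t0) mulrC ler_pdivrMr ?exprn_gt0//.
  apply: le_trans (hC t _); last by rewrite (ltW t0).
  by rewrite ler_piMl ?normc_ge0// normc_cexpN1// ltW.
- apply: exp_decay_invX; apply: exp_decayD; first exact: exp_decay_exp.
  apply: exp_decayN.
  by apply: exp_decay_poly; apply: exp_decay_exp; rewrite /= ltr01.
Qed.

Fixpoint regint n x : R[i] :=
  if n is m.+1 then (- x * regint m x + (1 - x) ^+ m.+1 / m.+1`!%:R) / m.+1%:R
  else - clog x.

Lemma cder_invX n t : 0 < t -> cder (fun t => t%:C ^- n) (- n%:R * t%:C ^- n.+1) t.
Proof.
move=> t0; have -> : (fun t : R => t%:C ^- n) = (fun t => (t ^- n)%:C).
  by apply/funext => s; rewrite fmorphV rmorphXn.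
have tn0 : t != 0 by rewrite gt_eqF.
have h : is_derive t 1 (fun t : R => t ^- n) (- n%:R * t ^- n.+1).
  apply: is_derive_eq (rderV _ _ _ _ (rderX t n)) _; first by rewrite expf_neq0.
  case: n => [|n]; first by rewrite mul0r oppr0 !mul0r.
  have : t ^+ n != 0 by rewrite expf_neq0.
  by rewrite /= !exprS; move: (t ^+ n) => u u0; field; rewrite tn0 u0.
apply: cder_eq (cder_real _ _ _ h).
by rewrite rmorphM rmorphN rmorph_nat fmorphV rmorphXn.
Qed.

(** Integration by parts. F is [regpow n x] with one more Taylor term removed, so that it is O(t) at
    0 and its derivative f has integral 0; f combines [regpow n.+1 x], [regpow n x] and c e^(-t),
    where c is the coefficient of the removed term. *)
Lemma regpow_step n x : 0 < complex.Re x -> forall v, cint (regpow n x) v ->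
  cint (regpow n.+1 x) ((- x * v + (1 - x) ^+ n.+1 / n.+1`!%:R) / n.+1%:R).
Proof.
move=> x0 v hv; set y := 1 - x.
pose c : R[i] := y ^+ n.+1 / n.+1`!%:R.
pose F t := t%:C ^- n.+1 * (cexp (- 1 * t%:C) * exp_rem y n.+2 t).
pose f t := - (n.+1%:R * regpow n.+1 x t) - x * regpow n x t + c * cexp (- 1 * t%:C).
have dF t : 0 < t -> cder F (f t) t.
  move=> t0; apply: cder_eq (cderM _ _ _ _ _ (cder_invX n.+1 t t0)
    (cderM _ _ _ _ _ (cder_exp (-1) t) (cder_exp_rem y n.+1 t))).
  rewrite /f !regpowE -/y.
  have -> : exp_rem y n.+2 t = exp_rem y n.+1 t - c * t%:C ^+ n.+1.
    by rewrite /exp_rem taylorpS hornerD hornerZ hornerXn opprD addrA.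
  have tn : t%:C != 0 :> R[i] by rewrite eq_complex /= eqxx andbT gt_eqF.
  have -> : x = 1 - y by rewrite /y opprB addrC subrK.
  have : t%:C ^+ n != 0 :> R[i] by rewrite expf_neq0.
  move: (exp_rem y n.+1 t) (cexp (- 1 * t%:C)) => E r; rewrite !exprS.
  move: (t%:C ^+ n) => u u0.
  by field; rewrite tn u0.
have gi : integrable_exp f.
  apply: integrable_expD.
    apply: integrable_expD; rewrite -?mulN1r.
      have := integrable_expZ _ (- n.+1%:R) (regpow_integrable n.+1 _ x0).
      by congr integrable_exp; apply/funext => t; rewrite mulNr.
    have := integrable_expZ _ (- x) (regpow_integrable n _ x0).
    by congr integrable_exp; apply/funext => t; rewrite mulNr.
  by apply: integrable_expZ; apply: integrable_exp_exp; rewrite /= ltr01.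
have hf : cint f 0.
  apply: (cint_ftc0 f F gi dF).
    have [C hC] := exp_rem_bound y n.+2; exists C => t /andP[t0 t1].
    rewrite /F !Normc.normcM normc_invX (gtr0_norm t0) mulrC ler_pdivrMr ?exprn_gt0//.
    rewrite -mulrA -exprS; apply: le_trans (hC t _); last by rewrite (ltW t0).
    by rewrite ler_piMl ?normc_ge0// normc_cexpN1// ltW.
  have -> : F = fun t => t%:C ^- n.+1 * (cexp (- x * t%:C) -
      cexp (- 1 * t%:C) * (taylorp y n.+2).[t%:C]).
    apply/funext => t; rewrite /F /exp_rem; congr (_ * _).
    by rewrite mulrBr -cexpD; congr (cexp _ - _); rewrite /y; ring.
  apply: exp_decay_invX; apply: exp_decayD; first exact: exp_decay_exp.
  by apply: exp_decayN; apply: exp_decay_poly; apply: exp_decay_exp; rewrite /= ltr01.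
have h1 : cint (fun t => cexp (- 1 * t%:C)) (1 : R[i]).
  by rewrite -[X in cint _ X]invr1; apply: cexp_integral; rewrite /= ltr01.
have := cintZ _ (n.+1%:R)^-1 _ (cintB _ _ _ _ (cintD _ _ _ _ (cintZ _ (- x) _ hv) (cintZ _ c _ h1)) hf).
rewrite subr0 mulr1 mulrC; apply: cint_eq => t t0.
have n0 : n.+1%:R != 0 :> R[i] by rewrite pnatr_eq0.
by rewrite /f; field.
Qed.

Lemma taylorp1 y : taylorp y 1 = 1.
Proof. by rewrite taylorpS taylorp0 add0r !expr0 fact0 divr1 scale1r. Qed.

Lemma regpow0E x t : regpow 0 x t = t%:C^-1 * (cexp (- x * t%:C) - cexp (- 1 * t%:C)).
Proof. by rewrite /regpow taylorp1 hornerC mulr1 expr1. Qed.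

(** The Frullani integral of (e^(-zt) - e^(-t)) / t, to be identified with - log z in
    [regpow_base]. *)
Let L z : R[i] := xget 0 [set v | cint (regpow 0 z) v].

Let L_cint z : 0 < complex.Re z -> cint (regpow 0 z) (L z).
Proof.
move=> z0; have [v hv] := integrable_exp_cint _ (regpow_integrable 0 z z0).
by apply: (@xgetPex _ 0 [set v | cint (regpow 0 z) v]); exists v.
Qed.

(** A first-order approximation with quadratic error determines the derivative; this turns the
    integral estimate [L_quad] into [L_cder]. *)
Lemma quadratic_is_derive (f : R -> R) (u a K r : R) : 0 < r ->
  (forall h, `|h| < r -> `|f (u + h) - f u - h * a| <= K * h ^+ 2) ->
  is_derive u 1 f a.
Proof.
move=> r0 hf.
have main : (fun h => h^-1 *: (f (h *: 1 + u) - f u)) @ (0:R)^' --> a.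
  apply/cvgrPdist_le => e e0.
  near=> h.
  have h0 : h != 0 by near: h; exact: nbhs_dnbhs_neq.
  have hr : `|h| < r.
    near: h; exact: dnbhs0_lt.
  have he : `|h| * (`|K| + 1) < e.
    rewrite -ltr_pdivlMr ?ltr_wpDl//.
    near: h; apply: dnbhs0_lt.
    by rewrite divr_gt0// ltr_wpDl.
  have -> : a - h^-1 *: (f (h *: 1 + u) - f u) = - h^-1 * (f (u + h) - f u - h * a).
    by rewrite /GRing.scale/= mulr1 [h + u]addrC; field.
  rewrite normrM normrN normfV mulrC ler_pdivrMr ?normr_gt0//.
  apply: le_trans (hf h hr) _; have := ler_norm K; have := normr_ge0 h.
  have -> : h ^+ 2 = `|h| ^+ 2 by rewrite real_normK ?num_real.
  nra.
by apply: DeriveDef; [apply/cvg_ex; exists a|exact: cvg_lim].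
Unshelve. all: by end_near. Qed.

Lemma expR_quad (s : R) : `|expR s - 1 - s| <= s ^+ 2 * expR `|s|.
Proof.
have h1 := expR_ge1Dx s.
have h2 : expR s * (1 - s) <= 1.
  have := expR_ge1Dx (- s); rewrite -(ler_pM2l (expR_gt0 s)) -expRD subrr expR0.
  exact.
rewrite ger0_norm; last lra.
have h3 : expR s - 1 - s <= s * (expR s - 1) by lra.
apply: le_trans h3 _; have [s0|s0] := leP 0 s.
  rewrite ger0_norm// expr2 -mulrA ler_wpM2l//; lra.
apply: (@le_trans _ _ (s ^+ 2)).
  have : 0 <= - s * (- s - (1 - expR s)) by apply: mulr_ge0; lra.
  by nra.
by rewrite ler_peMr ?sqr_ge0// -expR0 ler_expR.
Qed.

(** This takes the place of differentiation under the integral sign. With d = Re z / 2 and |h| < d,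
    half of the decay of e^(-zt) survives, so the second-order error has an integrand of modulus at
    most h^2 t e^(-dt), of integral h^2 / d^2; the 2 comes from [cint_le]. *)
Let L_quad z : 0 < complex.Re z -> forall h : R, `|h| < complex.Re z / 2 ->
  normc (L (z + h%:C) - L z + h%:C / z) <= 2 / (complex.Re z / 2) ^+ 2 * h ^+ 2.
Proof.
move=> z0 h hz; set d := complex.Re z / 2 in hz *.
have d0 : 0 < d by rewrite divr_gt0.
have zh0 : 0 < complex.Re (z + h%:C).
  rewrite ReD /=; move: hz; rewrite ltr_norml => /andP[h1 _].
  have : complex.Re z = d + d by rewrite /d; field.
  lra.
have I := cintD _ _ _ _ (cintB _ _ _ _ (L_cint _ zh0) (L_cint _ z0))
   (cintZ _ h%:C _ (cexp_integral _ z0)).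
have J := improperZ _ _ (h ^+ 2) (exprn_improper 1 d d0).
have := cint_le _ _ _ _ _ I J.
have -> : 1`!%:R = 1 :> R by [].
rewrite div1r => H; apply: le_trans (H _) _; last first.
  by rewrite le_eqVlt; apply/orP; left; apply/eqP; ring.
move=> t t0.
have -> : regpow 0 (z + h%:C) t - regpow 0 z t + h%:C * cexp (- z * t%:C) =
   (t^-1)%:C * cexp (- z * t%:C) * (expR (- (h * t)) - 1 - - (h * t))%:C.
  have -> : (expR (- (h * t)) - 1 - - (h * t))%:C = cexp (- h%:C * t%:C) - 1 + h%:C * t%:C :> R[i].
    by rewrite -rmorphN -rmorphM cexp_real opprK rmorphD rmorphB -rmorphM mulNr.
  rewrite !regpow0E opprD mulrDl cexpD fmorphV.
  have tn0 : t%:C != 0 :> R[i] by rewrite eq_complex /= eqxx andbT gt_eqF.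
  by field.
rewrite !Normc.normcM !normc_real normc_cexp Re_mulr ReN gtr0_norm ?invr_gt0//.
have q := expR_quad (- (h * t)); rewrite normrN normrM (gtr0_norm t0) sqrrN in q.
apply: le_trans (ler_wpM2l _ q) _; first by rewrite mulr_ge0 ?invr_ge0 ?expR_ge0// ltW.
have -> : t^-1 * expR (- complex.Re z * t) * ((h * t) ^+ 2 * expR (`|h| * t)) =
    h ^+ 2 * (t ^+ 1 * expR (- complex.Re z * t + `|h| * t)).
  by rewrite expRD; field; rewrite gt_eqF.
rewrite ler_wpM2l ?sqr_ge0// ler_wpM2l ?exprn_ge0 ?(ltW t0)// ler_expR.
rewrite -mulrDl -mulNr ler_wpM2r ?(ltW t0)//.
have : complex.Re z = d + d by rewrite /d; field.
lra.
Qed.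

Let L_cder z u : 0 < complex.Re (z + u%:C) ->
  cder (fun u => L (z + u%:C)) (- (z + u%:C)^-1) u.
Proof.
move=> z0; have q := L_quad _ z0; set w := z + u%:C in z0 q *.
have r0 : 0 < complex.Re w / 2 by rewrite divr_gt0.
have wE h : z + (u + h)%:C = w + h%:C by rewrite rmorphD addrA.
split; apply: (quadratic_is_derive _ _ _ _ _ r0) => h hr;
  apply: le_trans (q h hr); rewrite wE.
  apply: le_trans (Re_le_normc _); rewrite !ReD !ReN [h%:C / w]mulrC Re_mulr.
  by rewrite mulrN opprK mulrC.
apply: le_trans (Im_le_normc _); rewrite !ImD !ImN [h%:C / w]mulrC Im_mulr.
by rewrite mulrN opprK mulrC.
Qed.

(** For imaginary z, |e^(-zt)| = 1, so |e^(-zt) - 1| / t is at most C0 on ]0, 1], by Taylor, and at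
    most 2 beyond; it remains to integrate e^(-ut). *)
Let L_shift_bound z : complex.Re z = 0 -> exists C, forall u : R, 0 < u ->
  normc (L (z + u%:C) - L u%:C) <= C / u.
Proof.
move=> z0; have [C0 hC] := exp_rem_bound (- z) 1.
have C00 : 0 <= C0.
  by have := hC 1; rewrite expr1n mulr1 ler01 lexx => /(_ isT); apply: le_trans; exact: normc_ge0.
exists (2 * (C0 + 2)) => u u0.
have r1 : 0 < complex.Re (z + u%:C) by rewrite ReD z0 add0r.
have I := cintB _ _ _ _ (L_cint _ r1) (L_cint u%:C u0).
have J := improperZ _ _ (C0 + 2) (expR_improper u u0).
rewrite -mulrA; apply: (cint_le _ _ _ _ _ I J) => t t0.
have -> : regpow 0 (z + u%:C) t - regpow 0 u%:C t =
   (t^-1)%:C * (cexp (- u%:C * t%:C) * (cexp (- z * t%:C) - 1)).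
  have tn0 : t%:C != 0 :> R[i] by rewrite eq_complex /= eqxx andbT gt_eqF.
  by rewrite !regpow0E opprD mulrDl cexpD fmorphV; field.
have Ru : complex.Re u%:C = u by [].
rewrite !Normc.normcM normc_real normc_cexp Re_mulr ReN Ru mulNr.
rewrite gtr0_norm ?invr_gt0// mulrCA mulrC ler_wpM2r ?expR_ge0//.
rewrite mulrC ler_pdivrMr//.
have [t1|t1] := leP t 1.
  have := hC t; rewrite (ltW t0) t1 expr1 => /(_ isT).
  rewrite /exp_rem taylorp1 hornerC => h.
  by apply: le_trans h _; rewrite ler_wpM2r ?(ltW t0)// lerDl.
apply: le_trans (normcB _ _) _; rewrite normc_cexp Re_mulr ReN z0 oppr0 mul0r expR0.
rewrite Normc.normc1; nra.
Qed.

(** D = L + log has derivative 0 along horizontal rays of the right half-plane. It vanishes on the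
    positive real axis since it does at 1; on any other ray it approaches its values on the real
    axis at +oo, by [L_shift_bound] and [clog_shift_cvg], and so vanishes too. *)
Lemma regpow_base x : 0 < complex.Re x -> cint (regpow 0 x) (- clog x).
Proof.
move=> x0; suff -> : - clog x = L x by exact: L_cint.
set z := 0 +i* complex.Im x.
have xE : x = z + (complex.Re x)%:C by apply: eq_complexP; rewrite /= ?add0r ?addr0.
pose D w u := L (w + u%:C) + clog (w + u%:C).
have dD w u : complex.Re w = 0 -> 0 < u -> cder (D w) 0 u.
  move=> w0 u0; have wu : 0 < complex.Re (w + u%:C) by rewrite ReD w0 add0r.
  apply: cder_eq (cderD _ _ _ _ _ (L_cder w u wu) (cder_clog_shift _ _ (slit_Re _ wu))).
  by rewrite addNr.
have Dc w u v : complex.Re w = 0 -> 0 < u -> 0 < v -> D w u = D w v.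
  move=> w0 u0 v0; apply: eq_complexP.
    apply: (zero_derive_const (fun u => complex.Re (D w u))) => // s s0.
    by have [] := dD w s w0 s0.
  apply: (zero_derive_const (fun u => complex.Im (D w u))) => // s s0.
  by have [] := dD w s w0 s0.
have D0 u : 0 < u -> D 0 u = 0.
  move=> u0; rewrite (Dc 0 u 1)// /D add0r clog_real// ln1 addr0.
  apply: (cint_unique _ _ _ (L_cint 1%:C ltr01)).
  apply: cint_eq cint0 => t t0; by rewrite regpow0E subrr mulr0.
have Dz : D z (complex.Re x) = 0.
  apply: Normc.eq0_normc; apply/eqP; rewrite eq_le normc_ge0 andbT.
  have [C hC] := L_shift_bound z erefl.
  have lim : (fun u : R => C / u + normc (clog (z + u%:C) - clog (0 + u%:C))) @ +oo --> 0 + (0 : R).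
    apply: cvgD; last exact: clog_shift_cvg.
    rewrite -(mulr0 C); apply: cvgM; first exact: cvg_cst.
    by apply/gtr0_cvgV0; [apply: nbhs_pinfty_gt; exact: num_real|exact: cvg_id].
  rewrite -[leRHS]addr0; apply: (cvgr_to_ge lim); near=> u.
  have u0 : 0 < u by [].
  rewrite (Dc z _ u)//; apply: le_trans (lerD (hC u u0) (lexx _)).
  apply: le_trans (normcD _ _); rewrite le_eqVlt; apply/orP; left; apply/eqP.
  congr normc; transitivity (D z u - D 0 u); first by rewrite D0// subr0.
  by rewrite /D !add0r opprD addrACA.
by move: Dz; rewrite /D -xE => /eqP; rewrite addr_eq0 => /eqP->.
Unshelve. all: by end_near. Qed.

Lemma regpow_int n x : 0 < complex.Re x -> cint (regpow n x) (regint n x).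
Proof.
move=> x0; elim: n => [|n IH]; first exact: regpow_base.
exact: regpow_step.
Qed.

End Taylor.

(** * Order of vanishing at 0 *)

Section PolyOrder.
Context {R : realType}.
Implicit Types (f g : R -> R[i]) (p q : {poly R[i]}) (t : R).
Local Notation normc := Normc.normc.

Definition order0 n f := exists C : R, forall t, 0 < t <= 1 -> normc (f t) <= C * t ^+ n.

Lemma order0D n f g : order0 n f -> order0 n g -> order0 n (fun t => f t + g t).
Proof.
move=> [C hC] [K hK]; exists (C + K) => t t1; apply: le_trans (normcD _ _) _.
by rewrite mulrDl lerD ?hC ?hK.
Qed.

Lemma order0_bM n f g : bounded0 g -> order0 n f -> order0 n (fun t => g t * f t).
Proof.
move=> [K hK] [C hC]; exists (K * C) => t t1; rewrite Normc.normcM -mulrA.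
by apply: ler_pM; rewrite ?normc_ge0 ?hK ?hC.
Qed.

Lemma bounded0N f : bounded0 f -> bounded0 (fun t => - f t).
Proof. by move=> [C hC]; exists C => u u1; rewrite normcN hC. Qed.

Lemma order0_mulX n f : order0 n f -> order0 n.+1 (fun t => t%:C * f t).
Proof.
move=> [C hC]; exists C => t t1; have /andP[t0 _] := t1.
by rewrite Normc.normcM normc_real gtr0_norm// exprS mulrCA ler_pM2l// hC.
Qed.

Lemma order0_bounded n f : order0 n f -> bounded0 (fun t => t%:C ^- n * f t).
Proof.
move=> [C hC]; exists C => t t1; have /andP[t0 _] := t1.
by rewrite Normc.normcM normc_invX gtr0_norm// mulrC ler_pdivrMr ?exprn_gt0// hC.
Qed.

Lemma order0_poly n p : (forall i, (i < n)%N -> p`_i = 0) -> order0 n (fun t => p.[t%:C]).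
Proof.
move=> h; rewrite -(poly_take_drop n p).
have -> : take_poly n p = 0.
  by apply/polyP => i; rewrite coef_take_poly coef0; case: ifP => // /h.
have [C hC] := bounded0_poly (drop_poly n p); exists C => t t1.
have /andP[t0 _] := t1.
rewrite add0r hornerM hornerXn Normc.normcM normcX normc_real gtr0_norm//.
by rewrite ler_wpM2r ?exprn_ge0 ?(ltW t0)// hC.
Qed.

(** Letting t tend to 0 kills the constant term, and dividing by t lowers n. In [psi_step] this
    takes the place of a computation with the counterterms. *)
Lemma poly_order0_eq0 n p : (size p <= n)%N -> order0 n (fun t => p.[t%:C]) -> p = 0.
Proof.
elim: n p => [|n IH] p; first by rewrite leqn0 size_poly_eq0 => /eqP.
move: p; apply: poly_ind => [//|p c _] sz [C hC].
have [K hK] := bounded0_poly p.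
have c0 : c = 0.
  apply: Normc.eq0_normc; apply/eqP; rewrite eq_le normc_ge0 andbT leNgt.
  apply/negP => cp.
  have hb t : 0 < t <= 1 -> normc c <= (`|C| + `|K|) * t.
    move=> t1; have /andP[t0 t1'] := t1.
    have -> : c = (p * 'X + c%:P).[t%:C] - p.[t%:C] * t%:C.
      by rewrite hornerMXaddC addrC addKr.
    apply: le_trans (normcB _ _) _; rewrite mulrDl; apply: lerD.
      apply: le_trans (hC t t1) _; apply: le_trans (_ : `|C| * t ^+ n.+1 <= _).
        by rewrite ler_wpM2r ?ler_norm ?exprn_ge0 ?(ltW t0).
      by rewrite ler_wpM2l// exprS ler_piMr ?(ltW t0)// exprn_ile1// ltW.
    rewrite Normc.normcM normc_real gtr0_norm// ler_wpM2r ?(ltW t0)//.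
    by apply: le_trans (hK t t1) _; exact: ler_norm.
  have s0 : 0 <= `|C| + `|K| by rewrite addr_ge0.
  have d0 : 0 < `|C| + `|K| + normc c + 1 by lra.
  (* A point t of ]0, 1] at which (|C| + |K|) t < |c|, against [hb]. *)
  have := hb (normc c / (`|C| + `|K| + normc c + 1)).
  rewrite divr_gt0//= ler_pdivrMr// mul1r => /(_ ltac:(lra)).
  rewrite mulrA ler_pdivlMr//; nra.
rewrite c0 polyC0 addr0 in sz hC *.
rewrite (IH p) ?mul0r//.
  have [->|p0] := eqVneq p 0; first by rewrite size_poly0.
  by move: sz; rewrite size_mulX.
exists C => t t1; have /andP[t0 _] := t1; have := hC t t1.
rewrite hornerMX Normc.normcM normc_real gtr0_norm// exprSr mulrA.
by rewrite ler_pM2r.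
Qed.

End PolyOrder.

(** * Bernoulli-type coefficients and the antidifference of [regint] *)

Section Bernoulli.
Context {R : realType} (w : R[i]).
Implicit Types (t : R) (n N : nat).
Local Notation normc := Normc.normc.

(** The power series of 1 - e^(-t) up to degree N. *)
Let expm1 N : {poly R[i]} := 1 - taylorp (-1) N.+1.

(* Truncations of the power series of t e^(-w t) / (1 - e^(-t)), i.e. of the
   generating series of the values at 1 - w of the Bernoulli polynomials. *)
Fixpoint bernp N : {poly R[i]} :=
  if N is M.+1 then
    bernp M + ((- w) ^+ M / M`!%:R - (expm1 N * bernp M)`_N) *: 'X^M
  else 0.

(** Chosen so that t e^(-wt) and (1 - e^(-t)) [bernp N.+1] agree in degree N + 1; solvable because 1
    - e^(-t) starts with t, with coefficient 1. *)
Definition bern N : R[i] := (- w) ^+ N / N`!%:R - (expm1 N.+1 * bernp N)`_N.+1.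

Lemma bernpS N : bernp N.+1 = bernp N + bern N *: 'X^N.
Proof. by []. Qed.

Lemma bernpE N : bernp N = \sum_(j < N) bern j *: 'X^j.
Proof. by elim: N => [|N IH]; rewrite ?big_ord0// big_ord_recr/= -IH. Qed.

Lemma coef_expm1_0 N : (expm1 N)`_0 = 0.
Proof. by rewrite coefB coef1 coef_poly/= expr0 fact0 divr1 subrr. Qed.

Lemma coef_expm1_1 N : (expm1 N.+1)`_1 = 1.
Proof. by rewrite coefB coef1 coef_poly/= expr1 (_ : 1`! = 1)%N// divr1 sub0r opprK. Qed.

Lemma expm1S N : expm1 N.+1 = expm1 N - ((-1) ^+ N.+1 / N.+1`!%:R) *: 'X^(N.+1).
Proof. by rewrite /expm1 [in LHS]taylorpS opprD addrA. Qed.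

(** The new term of degree N, times a series starting with t, and the longer truncations all act in
    degree N + 1 or more, so the coefficients already matched stay matched. *)
Lemma coef_bernp_eq N i : (i <= N)%N ->
  ('X * taylorp (- w) N - expm1 N * bernp N)`_i = 0.
Proof.
elim: N i => [|N IH] i iN.
  move: iN; rewrite leqn0 => /eqP->.
  by rewrite taylorp0 mulr0 sub0r mulr0 oppr0 coef0.
rewrite bernpS mulrDr opprD addrA coefB.
have e0 : expm1 N.+1 * (bern N *: 'X^N) = bern N *: (expm1 N.+1 * 'X^N).
  by rewrite scalerAr.
rewrite e0 coefZ coefMXn.
move: iN; rewrite leq_eqVlt => /predU1P[->|iN].
  rewrite ltnNge leqnSn/= subSnn coef_expm1_1 mulr1 /bern coefB.
  by rewrite coefXM/= coef_poly ltnSn subrr.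
have iN' : (i <= N)%N by rewrite -ltnS.
have -> : (if (i < N)%N then 0 else (expm1 N.+1)`_(i - N)) = 0.
  case: ifPn => //; rewrite -leqNgt => Ni.
  have -> : (i - N)%N = 0%N by apply/eqP; rewrite subn_eq0.
  exact: coef_expm1_0.
rewrite mulr0 subr0 taylorpS expm1S mulrDr mulrBl opprB [X in _ + X]addrC addrACA coefD.
rewrite [X in X + _ = _](_ : _ = ('X * taylorp (- w) N - expm1 N * bernp N)`_i); last first.
  by rewrite coefB.
rewrite IH// add0r.
rewrite -scalerAr -scalerAl coefD !coefZ -exprS coefXn [_ * bernp N]mulrC coefMXn.
by rewrite iN mulr0 [i == _]ltn_eqF// mulr0 addr0.
Qed.

Lemma bernp_order N :
  order0 N.+1 (fun t => t%:C * cexp (- w * t%:C) -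
    (1 - cexp (- 1 * t%:C)) * (bernp N).[t%:C]).
Proof.
have h1 : order0 N.+1 (fun t => t%:C * exp_rem (- w) N t).
  apply: order0_mulX; have [C hC] := exp_rem_bound (- w) N.
  by exists C => t /andP[t0 t1]; apply: hC; rewrite (ltW t0).
have h2 : order0 N.+1 (fun t => (bernp N).[t%:C] * exp_rem (-1) N.+1 t).
  apply: order0_bM; first exact: bounded0_poly.
  have [C hC] := exp_rem_bound (-1 : R[i]) N.+1.
  by exists C => t /andP[t0 t1]; apply: hC; rewrite (ltW t0).
have h3 := order0_poly N.+1 _ (fun i => coef_bernp_eq N i).
have := order0D _ _ _ (order0D _ _ _ h1 h2) h3.
congr order0; apply/funext => t.
rewrite /exp_rem hornerD hornerN !hornerM hornerX /expm1 hornerD hornerN hornerC; ring.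
Qed.

Lemma one_sub_exp_ge t : 0 < t <= 1 -> t / 2 <= 1 - expR (- t).
Proof.
move=> /andP[t0 t1]; have := expR_ge1Dx t; rewrite expRN => h.
have e0 : 0 < expR t by exact: expR_gt0.
have : (expR t)^-1 <= (1 + t)^-1 by rewrite lef_pV2 ?posrE//; lra.
have : (1 + t)^-1 <= 1 - t / 2.
  by rewrite -[leLHS]mul1r ler_pdivrMr; [nra|lra].
lra.
Qed.

Lemma one_sub_cexpE t : 1 - cexp (- 1 * t%:C) = (1 - expR (- t))%:C :> R[i].
Proof. by rewrite mulN1r -rmorphN cexp_real rmorphB. Qed.

Lemma one_sub_exp_gt0 t : 0 < t -> 0 < 1 - expR (- t).
Proof. by move=> t0; rewrite subr_gt0 expR_lt1 oppr_lt0. Qed.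

(** The theta of the overview is the case N = n + 2. All N are kept because peeling off Taylor terms
    ([thetaS]) raises N. *)
Definition theta N t : R[i] :=
  t%:C ^- N * (t%:C * cexp (- w * t%:C) / (1 - cexp (- 1 * t%:C)) - (bernp N).[t%:C]).

Lemma thetaS N t : 0 < t -> theta N t = bern N + t%:C * theta N.+1 t.
Proof.
move=> t0; rewrite /theta bernpS hornerD hornerZ hornerXn exprS.
have tn0 : t%:C != 0 :> R[i] by rewrite eq_complex /= eqxx andbT gt_eqF.
have : t%:C ^+ N != 0 :> R[i] by rewrite expf_neq0.
move: (t%:C ^+ N) (_ / _) ((bernp N).[_]) => u v b u0.
by field; rewrite u0 tn0.
Qed.

Lemma theta_iter N J t : 0 < t ->
  theta N t = \sum_(j < J) bern (N + j) * t%:C ^+ j + t%:C ^+ J * theta (N + J) t.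
Proof.
move=> t0; elim: J => [|J IH]; first by rewrite big_ord0 add0r expr0 mul1r addn0.
rewrite IH big_ord_recr/= (thetaS (N + J))// addnS exprSr; ring.
Qed.

Lemma ccont_one_sub : ccont (fun t => (1 - cexp (- 1 * t%:C))^-1).
Proof.
under eq_fun do rewrite one_sub_cexpE -fmorphV.
have d t : 0 < t -> is_derive t 1 (fun t => (1 - expR (- t))^-1)
    (- (expR (- t)) / (1 - expR (- t)) ^+ 2).
  move=> t0; have t1 := one_sub_exp_gt0 _ t0.
  have h := rderB _ _ _ _ _ (rder_cst 1 t) (is_derive_expRN 1 t).
  have h' : is_derive t 1 (fun t => 1 - expR (- t)) (expR (- t)).
    have -> : (fun t => 1 - expR (- t)) = (fun t : R => 1 - expR (- (1 * t))).
      by apply/funext => s; rewrite mul1r.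
    by apply: (is_derive_eq h); rewrite mul1r mulN1r opprK add0r.
  by apply: rderV => //; rewrite gt_eqF.
by apply: cder_ccont => t t0; apply: cder_real; exact: d.
Qed.

Lemma theta_bounded0 N : bounded0 (theta N).
Proof.
have [C hC] := order0_bounded _ _ (bernp_order N); exists (2 * C) => t t1.
have /andP[t0 _] := t1; have e1 := one_sub_exp_gt0 _ t0.
have tn0 : t%:C != 0 :> R[i] by rewrite eq_complex /= eqxx andbT gt_eqF.
have en0 : (1 - expR (- t))%:C != 0 :> R[i] by rewrite eq_complex /= eqxx andbT gt_eqF.
have -> : theta N t = (t / (1 - expR (- t)))%:C * (t%:C ^- N.+1 *
    (t%:C * cexp (- w * t%:C) - (1 - cexp (- 1 * t%:C)) * (bernp N).[t%:C])).
  rewrite /theta one_sub_cexpE exprS.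
  have -> : (t / (1 - expR (- t)))%:C = t%:C / (1 - expR (- t))%:C :> R[i] by rewrite rmorphM fmorphV.
  have : t%:C ^+ N != 0 :> R[i] by rewrite expf_neq0.
  move: (t%:C ^+ N) (cexp _) ((bernp N).[_]) en0 => u v b; move: ((1 - expR (- t))%:C) => e e0 u0.
  by field; rewrite u0 tn0 e0.
rewrite Normc.normcM; apply: ler_pM; rewrite ?normc_ge0 ?hC//.
rewrite normc_real ger0_norm; last by rewrite divr_ge0// ltW.
by rewrite ler_pdivrMr//; have := one_sub_exp_ge _ t1; lra.
Qed.

Lemma exp_decay_bM (f g : R -> R[i]) K : (forall t, 1 <= t -> normc (g t) <= K) ->
  exp_decay f -> exp_decay (fun t => g t * f t).
Proof.
move=> hK [C [d [d0 C0 hC]]].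
have K0 : 0 <= K by apply: le_trans (hK 1 (lexx _)); exact: normc_ge0.
exists (K * C), d; split => //; first exact: mulr_ge0.
by move=> t t1; rewrite Normc.normcM -mulrA ler_pM ?normc_ge0 ?hK ?hC.
Qed.

(** The two hypotheses are the decay of the two terms: the polynomial one carries e^(-st), the other
    e^(-(s+w)t), with 1 - e^(-t) bounded below for t >= 1. *)
Lemma theta_integrable N (s : R[i]) : 0 < complex.Re s -> 0 < complex.Re (s + w) ->
  integrable_exp (fun t => cexp (- s * t%:C) * theta N t).
Proof.
move=> s0 sw0; split.
- apply: ccontM; first exact: ccont_exp.
  apply: ccontM; first exact: ccont_invX.
  apply: ccontD.
    apply: ccontM; last exact: ccont_one_sub.
    by apply: ccontM; [exact: (ccontX 1)|exact: ccont_exp].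
  by apply: ccontN; apply: cder_ccont => t _; exact: cder_poly.
- have [C hC] := theta_bounded0 N; have [K hK] := bounded0_cexp (- s).
  exists (K * C) => t t1; rewrite Normc.normcM.
  by rewrite ler_pM ?normc_ge0 ?hK ?hC.
have -> : (fun t => cexp (- s * t%:C) * theta N t) = (fun t => t%:C ^- N *
   ((1 - cexp (- 1 * t%:C))^-1 * (cexp (- (s + w) * t%:C) * t%:C) -
     cexp (- s * t%:C) * (bernp N).[t%:C])).
  apply/funext => t; rewrite /theta opprD mulrDl cexpD; ring.
apply: exp_decay_invX; apply: exp_decayD; last first.
  by apply: exp_decayN; apply: exp_decay_poly; exact: exp_decay_exp.
apply: (exp_decay_bM _ _ (1 - expR (-1))^-1); last first.
  by apply: exp_decay_mulX; exact: exp_decay_exp.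
move=> t t1; have t0 : 0 < t by exact: lt_le_trans t1.
rewrite one_sub_cexpE Normc.normcV normc_real gtr0_norm ?one_sub_exp_gt0//.
rewrite lef_pV2 ?posrE ?one_sub_exp_gt0// lerD2l lerN2 ler_expR lerN2//.
Qed.

Definition psi N (s : R[i]) : R[i] :=
  xget 0 [set v | cint (fun t => cexp (- s * t%:C) * theta N t) v].

Lemma psi_cint N s : 0 < complex.Re s -> 0 < complex.Re (s + w) ->
  cint (fun t => cexp (- s * t%:C) * theta N t) (psi N s).
Proof.
move=> s0 sw0; have [v hv] := integrable_exp_cint _ (theta_integrable N s s0 sw0).
apply: (@xgetPex _ 0 [set v | cint (fun t => cexp (- s * t%:C) * theta N t) v]).
by exists v.
Qed.

(* - (phi + psi) is an antidifference of k |-> regint n (k + w), by psi_step: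
   phi carries the growth at +oo, whereas psi vanishes there. *)
Definition phi n (s : R[i]) : R[i] := \sum_(j < n.+2) bern j * regint (n.+1 - j) s.

(* The integrands of the two sides differ by e^(-t) times a Laurent polynomial
   with only negative powers of t; being bounded at 0, it vanishes. *)
Lemma psi_step n (k : R[i]) : 0 < complex.Re k -> 0 < complex.Re (k + w) ->
  psi n.+2 k - psi n.+2 (k + 1) = regint n (k + w) - (phi n k - phi n (k + 1)).
Proof.
move=> k0 kw0.
have k10 : 0 < complex.Re (k + 1) by rewrite ReD /= addr_gt0.
have kw10 : 0 < complex.Re (k + 1 + w) by rewrite addrAC ReD /= addr_gt0.
have I := cintB _ _ _ _ (psi_cint n.+2 _ k0 kw0) (psi_cint n.+2 _ k10 kw10).
pose A j t := bern j * (regpow (n.+1 - j) k t - regpow (n.+1 - j) (k + 1) t).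
have J : cint (fun t => regpow n (k + w) t - \sum_(j < n.+2) A j t)
    (regint n (k + w) - (phi n k - phi n (k + 1))).
  apply: cintB; first exact: regpow_int.
  rewrite /phi -sumrB.
  under eq_bigr do rewrite -mulrBr.
  apply: (cint_sum _ A (fun j => bern j * (regint (n.+1 - j) k - regint (n.+1 - j) (k + 1)))).
  by move=> j _; apply: cintZ; apply: cintB; exact: regpow_int.
apply: cint_unique I _; apply: cint_eq J => t t0.
(* p collects the Taylor polynomials subtracted in [regpow n (k + w)] and in the [A j], over the
   common denominator t^(n+2). *)
pose p : {poly R[i]} := 'X * taylorp (1 - (k + w)) n.+1 -
  \sum_(j < n.+2) bern j *: ('X^j * (taylorp (1 - k) (n.+2 - j) - taylorp (1 - (k + 1)) (n.+2 - j))).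
have key u : 0 < u -> regpow n (k + w) u - \sum_(j < n.+2) A j u =
    (cexp (- k * u%:C) * theta n.+2 u - cexp (- (k + 1) * u%:C) * theta n.+2 u)
    - u%:C ^- n.+2 * (cexp (- 1 * u%:C) * p.[u%:C]).
  move=> u0.
  have un0 : u%:C != 0 :> R[i] by rewrite eq_complex /= eqxx andbT gt_eqF.
  have en0 : 1 - cexp (- 1 * u%:C) != 0.
    by rewrite one_sub_cexpE eq_complex /= eqxx andbT gt_eqF ?one_sub_exp_gt0.
  have AE : \sum_(j < n.+2) A j u = u%:C ^- n.+2 *
     ((cexp (- k * u%:C) - cexp (- (k + 1) * u%:C)) * (bernp n.+2).[u%:C] -
      cexp (- 1 * u%:C) * (\sum_(j < n.+2) bern j *: ('X^j *
        (taylorp (1 - k) (n.+2 - j) - taylorp (1 - (k + 1)) (n.+2 - j)))).[u%:C]).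
    rewrite bernpE !horner_sum mulr_sumr [X in _ - X]mulr_sumr -sumrB mulr_sumr.
    apply: eq_bigr => j _; rewrite /A /regpow -subSn -1?ltnS//.
    rewrite !hornerZ hornerM hornerXn hornerD hornerN.
    have -> : u%:C ^- (n.+2 - j) = u%:C ^- n.+2 * u%:C ^+ j.
      have -> : u%:C ^+ n.+2 = u%:C ^+ (n.+2 - j) * u%:C ^+ j :> R[i].
        by rewrite -exprD subnK// ltnW.
      by rewrite invfM -mulrA mulVf ?mulr1// expf_neq0.
    ring.
  rewrite AE /p [('X * _ - _).[_]]hornerD [(- _).[_]]hornerN [('X * _).[_]]hornerM hornerX.
  rewrite /theta /regpow.
  have -> : cexp (- (k + 1) * u%:C) = cexp (- k * u%:C) * cexp (- 1 * u%:C).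
    by rewrite opprD mulrDl cexpD.
  have -> : cexp (- (k + w) * u%:C) = cexp (- k * u%:C) * cexp (- w * u%:C).
    by rewrite opprD mulrDl cexpD.
  rewrite [u%:C ^+ n.+2]exprS.
  have : u%:C ^+ n.+1 != 0 :> R[i] by rewrite expf_neq0.
  move: (u%:C ^+ n.+1) (cexp (- 1 * _)) en0 (cexp (- k * _)) (cexp (- w * _)) => U e en0 Ek Ew U0.
  move: ((bernp n.+2).[_]) ((\sum_(j < _) _).[_]) ((taylorp _ _).[_]) => b s tt.
  by field; rewrite U0 un0 en0.
have szp : (size p <= n.+2)%N.
  apply: leq_trans (size_polyD _ _) _; rewrite size_polyN geq_max; apply/andP; split.
    apply: leq_trans (size_polyMleq _ _) _; rewrite size_polyX /= add1n ltnS.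
    exact: size_poly.
  apply: leq_trans (size_sum _ _ _) _; apply/bigmax_leqP => j _.
  apply: leq_trans (size_scale_leq _ _) _; apply: leq_trans (size_polyMleq _ _) _.
  rewrite size_polyXn addSn /= -leq_subRL ?(ltnW (ltn_ord j))//.
  by apply: leq_trans (size_polyD _ _) _; rewrite size_polyN geq_max !size_poly.
have p0 : p = 0.
  apply: (poly_order0_eq0 n.+2) => //.
  pose G u := (cexp (- k * u%:C) * theta n.+2 u - cexp (- (k + 1) * u%:C) * theta n.+2 u)
    - (regpow n (k + w) u - \sum_(j < n.+2) A j u).
  have bA : bounded0 (fun u => \sum_(j < n.+2) A j u).
    elim: {+}n.+2 => [|m IH].
      by exists 0 => u _; rewrite big_ord0 Normc.normc0.
    under eq_fun do rewrite big_ord_recr/=.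
    apply: bounded0D => //; apply: bounded0Z; apply: bounded0D.
      by have [] := regpow_integrable (n.+1 - m) _ k0.
    by apply: bounded0N; have [] := regpow_integrable (n.+1 - m) _ k10.
  have bG : bounded0 G.
    apply: bounded0D; last apply: bounded0N.
      apply: bounded0D; last apply: bounded0N.
        by have [] := theta_integrable n.+2 _ k0 kw0.
      by have [] := theta_integrable n.+2 _ k10 kw10.
    apply: bounded0D; last exact: bounded0N.
    by have [] := regpow_integrable n _ kw0.
  have [C hC] := bG; have [K hK] := bounded0_cexp (1 : R[i]).
  exists (K * C) => u u1; have /andP[u0 _] := u1.
  have un0 : u%:C != 0 :> R[i] by rewrite eq_complex /= eqxx andbT gt_eqF.
  have -> : p.[u%:C] = cexp (1 * u%:C) * G u * u%:C ^+ n.+2.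
    have ee : cexp (1 * u%:C) * cexp (- 1 * u%:C) = 1 by rewrite -cexpD mulN1r mul1r subrr cexp0.
    rewrite /G key// opprB addrC subrK.
    transitivity (cexp (1 * u%:C) * cexp (- 1 * u%:C) * p.[u%:C] * (u%:C ^+ n.+2 * u%:C ^- n.+2)).
      by rewrite ee mul1r divff ?mulr1// expf_neq0.
    move: (u%:C ^- n.+2) (cexp (1 * _)) (cexp (- 1 * _)) (p.[_]) (u%:C ^+ n.+2) => *.
    ring.
  rewrite (Normc.normcM (_ * _)) (Normc.normcM (cexp _)) normcX normc_real gtr0_norm//.
  by rewrite ler_wpM2r ?exprn_ge0 ?(ltW u0)// ler_pM ?normc_ge0 ?hK ?hC.
by rewrite key// p0 horner0 !mulr0 subr0.
Qed.

End Bernoulli.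

(** * Asymptotic expansions in s^m log s and s^m, and their uniqueness *)

Section Expansions.
Context {R : realType}.
Implicit Types (u v : nat -> R[i]) (A B p : {poly R[i]}) (d : nat -> R[i]).
Local Notation normc := Normc.normc.

Lemma cvg0_normcP u : ((fun s : nat => u s : R[i]^o) @ \oo --> (0 : R[i]^o)) <->
  ((fun s => normc (u s)) @ \oo --> (0 : R)).
Proof.
split.
  move=> /cvgr0Pnorm_lt h; apply/cvgr0Pnorm_lt => e e0.
  have e0' : 0 < e%:C :> R[i] by rewrite ltcR.
  have := h _ e0'; apply: filterS => s.
  by rewrite norm_normcE ltcR ger0_norm ?normc_ge0.
move=> /cvgr0Pnorm_lt h; apply/cvgr0Pnorm_lt => -[e e'].
rewrite ltcE /= => /andP[/eqP-> e0].
have := h _ e0; apply: filterS => s.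
by rewrite -[e +i* 0]/(e%:C) norm_normcE ltcR ger0_norm ?normc_ge0.
Qed.

Lemma asym_eq k u v A B d : (forall s, (k <= s)%N -> u s = v s) ->
  asymptotic_expansion u A B d -> asymptotic_expansion v A B d.
Proof.
move=> uv hu N; apply: cvg_trans (hu N); apply: near_eq_cvg; near=> s.
by rewrite uv//; near: s; exact: nbhs_infty_ge.
Unshelve. all: by end_near. Qed.

Lemma asymP u A B d : asymptotic_expansion u A B d <->
  forall N : nat, (fun s : nat => normc (s%:R ^+ N *
      (u s - (A.[s%:R] * (ln (s%:R : R))%:C + B.[s%:R]
              + \sum_(1 <= j < N.+1) d j * s%:R ^- j)))) @ \oo --> (0 : R).
Proof. by split=> h N; apply/cvg0_normcP; exact: h. Qed.

Lemma asymD u v A A' B B' d d' : asymptotic_expansion u A B d ->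
  asymptotic_expansion v A' B' d' ->
  asymptotic_expansion (fun s => u s + v s) (A + A') (B + B') (fun j => d j + d' j).
Proof.
move=> /asymP hu /asymP hv; apply/asymP => N.
have l : (fun s : nat => normc (s%:R ^+ N *
      (u s - (A.[s%:R] * (ln (s%:R : R))%:C + B.[s%:R]
              + \sum_(1 <= j < N.+1) d j * s%:R ^- j))) + normc (s%:R ^+ N *
      (v s - (A'.[s%:R] * (ln (s%:R : R))%:C + B'.[s%:R]
              + \sum_(1 <= j < N.+1) d' j * s%:R ^- j)))) @ \oo --> 0 + (0 : R).
  by apply: cvgD; [exact: hu|exact: hv].
rewrite addr0 in l; apply: (@squeeze_cvgr _ _ _ _ (fun=> 0) _ _ _ _ _ l).
  apply: nearW => s; rewrite normc_ge0 /=; apply: le_trans (normcD _ _).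
  rewrite le_eqVlt; apply/orP; left; apply/eqP; congr normc.
  rewrite !hornerD; under eq_bigr do rewrite mulrDl.
  by rewrite big_split /=; ring.
exact: cvg_cst.
Qed.

Lemma asymZ c u A B d : asymptotic_expansion u A B d ->
  asymptotic_expansion (fun s => c * u s) (c *: A) (c *: B) (fun j => c * d j).
Proof.
move=> /asymP hu; apply/asymP => N.
have l : (fun s : nat => normc c * normc (s%:R ^+ N *
      (u s - (A.[s%:R] * (ln (s%:R : R))%:C + B.[s%:R]
              + \sum_(1 <= j < N.+1) d j * s%:R ^- j)))) @ \oo --> normc c * (0 : R).
  by apply: cvgM; [exact: cvg_cst|exact: hu].
rewrite mulr0 in l; apply: cvg_trans l; apply: near_eq_cvg; apply: nearW => s.
rewrite -Normc.normcM; congr normc.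
have -> : \sum_(1 <= j < N.+1) c * d j * s%:R ^- j =
    c * \sum_(1 <= j < N.+1) d j * s%:R ^- j.
  by rewrite mulr_sumr; apply: eq_bigr => j _; rewrite mulrA.
by rewrite !hornerZ; ring.
Qed.

(** [is_SR] for an arbitrary sequence instead of partial sums, so that the sum can be treated piece
    by piece, up to finitely many s. *)
Definition has_const u c := exists A B d, asymptotic_expansion u A B d /\ c = B`_0.

Lemma has_const_eq k u v c : (forall s, (k <= s)%N -> u s = v s) ->
  has_const u c -> has_const v c.
Proof. by move=> uv [A [B [d [h cB]]]]; exists A, B, d; split=> //; exact: asym_eq uv h. Qed.

Lemma has_constD u v c c' : has_const u c -> has_const v c' ->
  has_const (fun s => u s + v s) (c + c').
Proof.
move=> [A [B [d [h ->]]]] [A' [B' [d' [h' ->]]]].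
exists (A + A'), (B + B'), (fun j => d j + d' j); split; first exact: asymD.
by rewrite coefD.
Qed.

Lemma has_constZ z u c : has_const u c -> has_const (fun s => z * u s) (z * c).
Proof.
move=> [A [B [d [h ->]]]]; exists (z *: A), (z *: B), (fun j => z * d j).
by split; [exact: asymZ|rewrite coefZ].
Qed.

Lemma has_const_log_poly A B :
  has_const (fun s => A.[s%:R] * (ln (s%:R : R))%:C + B.[s%:R]) B`_0.
Proof.
exists A, B, (fun=> 0); split => // N.
rewrite (_ : (fun s : nat => _) = fun=> 0); first exact: cvg_cst.
apply/funext => s; rewrite big1 ?addr0 ?subrr ?mulr0// => j _.
by rewrite mul0r.
Qed.

Lemma has_const_poly p : has_const (fun s => p.[s%:R]) p`_0.
Proof.
apply: (has_const_eq 0) (has_const_log_poly 0 p) => s _.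
by rewrite horner0 mul0r add0r.
Qed.

Lemma ln_nat_cvgy : (fun s : nat => ln (s%:R : R)) @ \oo --> +oo.
Proof.
apply/cvgryPge => M; near=> s.
have sM : expR M <= s%:R by near: s; exact: nbhs_infty_ger.
by rewrite -[M]expRK ler_ln ?posrE ?expR_gt0// (lt_le_trans _ sM)// expR_gt0.
Unshelve. all: by end_near. Qed.

Lemma invn_cvg0 (C : R) : (fun s : nat => C / s%:R) @ \oo --> (0 : R).
Proof.
apply/cvgr0Pnorm_le => e e0; near=> s.
have s0 : 0 < s%:R :> R by near: s; exact: nbhs_infty_gtr.
rewrite normrM normfV (gtr0_norm s0) ler_pdivrMr// mulrC -ler_pdivrMr//.
by near: s; exact: nbhs_infty_ger.
Unshelve. all: by end_near. Qed.

(** From (log s)^2 <= 4 s, the case n = 2 of [exprn_le_expR] at log s. *)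
Lemma ln_div_cvg0 (C : R) : (fun s : nat => C * (ln s%:R / s%:R)) @ \oo --> (0 : R).
Proof.
apply/cvgr0Pnorm_le => e e0.
have l := ln_nat_cvgy; move/cvgryPge : l => l.
near=> s.
have s0 : 0 < s%:R :> R by near: s; exact: nbhs_infty_gtr.
have l1 : (4 * `|C|) / e + 1 <= ln (s%:R : R) by near: s; exact: l.
have l0 : 0 < ln (s%:R : R).
  by apply: lt_le_trans l1; rewrite ltr_wpDl// divr_ge0 ?mulr_ge0// ltW.
rewrite normrM (ger0_norm (divr_ge0 (ltW l0) (ltW s0))) mulrA ler_pdivrMr//.
have := exprn_le_expR 2 _ (ltW l0); rewrite lnK ?posrE// => h.
have : 4 * `|C| <= e * ln (s%:R : R).
  have : 4 * `|C| / e <= ln (s%:R : R) by lra.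
  by rewrite ler_pdivrMr// [_ * e]mulrC.
rewrite -(ler_pM2r l0) => h2.
have : `|C| * ln (s%:R : R) * 4 <= e * ((2 * 2) * s%:R).
  apply: le_trans (_ : e * (ln s%:R * ln s%:R) <= _); first lra.
  by rewrite ler_pM2l// -expr2; move: h; rewrite expr2.
lra.
Unshelve. all: by end_near. Qed.

Lemma poly_lead_approx n p : (size p <= n.+1)%N -> exists C : R, forall s : nat, (0 < s)%N ->
  normc (p.[s%:R] / s%:R ^+ n - p`_n) <= C / s%:R.
Proof.
move=> sp; exists (\sum_(i < n) normc p`_i) => s s0.
have sR : 0 < s%:R :> R by rewrite ltr0n.
have sC : s%:R != 0 :> R[i] by rewrite pnatr_eq0 -lt0n.
rewrite (horner_coef_wide _ sp) big_ord_recr/= mulrDl mulfK ?expf_neq0// addrK.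
rewrite !mulr_suml; apply: le_trans (normc_sum _ _ _ _) _; apply: ler_sum => i _.
rewrite -mulrA !Normc.normcM Normc.normcV !normcX normc_nat.
rewrite ler_wpM2l ?normc_ge0// ler_pdivrMr ?exprn_gt0//.
have -> : s%:R ^+ n = s%:R ^+ (n - i.+1) * (s%:R * s%:R ^+ i) :> R.
  by rewrite -exprS -exprD subnK.
rewrite [leRHS]mulrCA [_^-1 * _]mulrA mulVf ?gt_eqF// mul1r.
by rewrite ler_peMl ?exprn_ge0 ?(ltW sR)// exprn_ege1// ler1n.
Qed.

(** Divided by the top power s^n, the hypothesis gives A_n log s + B_n -> 0. As log s is unbounded,
    A_n = 0, then B_n = 0, and the degree bound drops. *)
Lemma log_poly_unique n A B : (size A <= n)%N -> (size B <= n)%N ->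
  (fun s : nat => normc (A.[s%:R] * (ln (s%:R : R))%:C + B.[s%:R])) @ \oo --> (0 : R) ->
  A = 0 /\ B = 0.
Proof.
elim: n A B => [|n IH] A B.
  by rewrite !leqn0 !size_poly_eq0 => /eqP-> /eqP->.
move=> sA sB h; have [CA hA] := poly_lead_approx n A sA.
have [CB hB] := poly_lead_approx n B sB.
have lim : (fun s : nat => normc (A`_n * (ln (s%:R : R))%:C + B`_n)) @ \oo --> (0 : R).
  have l0 : (fun s : nat => normc (A.[s%:R] * (ln (s%:R : R))%:C + B.[s%:R]) +
      (CA * (ln s%:R / s%:R) + CB / s%:R)) @ \oo --> 0 + (0 + (0 : R)).
    by apply: cvgD => //; apply: cvgD; [exact: ln_div_cvg0|exact: invn_cvg0].
  rewrite !addr0 in l0.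
  apply: (@squeeze_cvgr _ _ _ _ (fun=> 0) _ _ _ _ _ l0); last exact: cvg_cst.
  near=> s.
  have s0 : (0 < s)%N by near: s; exact: nbhs_infty_gt.
  rewrite normc_ge0 /=.
  have lg : 0 <= ln (s%:R : R) by rewrite ln_ge0// ler1n.
  set D := A.[s%:R] * _ + _.
  have -> : A`_n * (ln s%:R)%:C + B`_n = D / s%:R ^+ n -
     ((A.[s%:R] / s%:R ^+ n - A`_n) * (ln s%:R)%:C + (B.[s%:R] / s%:R ^+ n - B`_n)).
    by rewrite /D; ring.
  apply: le_trans (normcB _ _) _; apply: lerD.
    rewrite Normc.normcM Normc.normcV normcX normc_nat ler_piMr ?normc_ge0//.
    by rewrite invf_le1 ?exprn_gt0 ?ltr0n// exprn_ege1// ler1n.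
  apply: le_trans (normcD _ _) _; apply: lerD; last exact: hB.
  rewrite Normc.normcM normc_real ger0_norm//.
  by apply: le_trans (ler_wpM2r lg (hA s s0)) _; rewrite mulrAC [leRHS]mulrA.
have An : A`_n = 0.
  apply: Normc.eq0_normc; apply/eqP; rewrite eq_le normc_ge0 andbT leNgt; apply/negP => a0.
  move/cvgr0Pnorm_lt : lim => /(_ 1 ltr01) lim.
  have l := ln_nat_cvgy; move/cvgryPge : l => l.
  have [s [/= l1]] := filter_ex (filterI (l ((normc B`_n + 1) / normc A`_n)) lim).
  rewrite ger0_norm ?normc_ge0// ltNge => /negP; apply.
  have lg : 0 <= ln (s%:R : R).
    by apply: le_trans l1; rewrite divr_ge0 ?addr_ge0 ?normc_ge0.
  rewrite ler_pdivrMr// in l1.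
  have := normcB (A`_n * (ln (s%:R : R))%:C + B`_n) B`_n.
  rewrite addrK Normc.normcM normc_real ger0_norm//; lra.
have Bn : B`_n = 0.
  apply: Normc.eq0_normc; move: lim; rewrite An.
  under eq_fun do rewrite mul0r add0r.
  by move=> lim; exact: (cvg_unique _ (@cvg_cst _ _ _ _ _) lim).
have sz p : (size p <= n.+1)%N -> p`_n = 0 -> (size p <= n)%N.
  move=> sp pn; apply/leq_sizeP => j; rewrite leq_eqVlt => /predU1P[<-//|nj].
  by rewrite nth_default// (leq_trans sp).
by apply: (IH A B) => //; apply: sz.
Unshelve. all: by end_near. Qed.

(** The remainders of order N = 0, from which the terms in s^(-j) are absent, already determine A
    and B. *)
Lemma has_const_unique u c c' : has_const u c -> has_const u c' -> c = c'.
Proof.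
move=> [A [B [d [h ->]]]] [A' [B' [d' [h' ->]]]].
have l : (fun s : nat => normc ((A - A').[s%:R] * (ln (s%:R : R))%:C + (B - B').[s%:R])) @ \oo --> (0 : R).
  have := (asymP _ _ _ _).1 (asymD _ _ _ _ _ _ _ _ h' (asymZ (-1) _ _ _ _ h)) 0%N.
  apply: cvg_trans; apply: near_eq_cvg; apply: nearW => s.
  by congr normc; rewrite big_geq// expr0 !hornerD !hornerN !hornerZ; ring.
move: l.
move=> /(log_poly_unique (maxn (size (A - A')) (size (B - B')))).
rewrite leq_maxl leq_maxr => /(_ isT isT)[_ /eqP].
by rewrite subr_eq0 => /eqP->.
Qed.

End Expansions.

(** * Watson's lemma for [psi] *)

Section Watson.
Context {R : realType} (w : R[i]).
Local Notation normc := Normc.normc.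

(** A positive real with Re(k1 + w) > 0; it bounds the exponential growth rate of every
    [theta w N]. *)
Let k1 : R := normc w + 1.

Lemma theta_bound N : exists2 C : R, 0 <= C & forall t : R, 0 < t ->
  normc (theta w N t) <= C * expR (k1 * t).
Proof.
have k0 : 0 < k1 by rewrite ltr_wpDl ?normc_ge0.
have kw : 0 < complex.Re (k1%:C + w).
  rewrite ReD /= /k1; have := Re_le_normc w; rewrite ler_norml => /andP[h _]; lra.
have [_ hb hd] := theta_integrable w N k1%:C k0 kw.
have [C [d [d0 C0 hC]]] := integrable_exp_bound _ hb hd; exists C => // t t0.
have := hC t t0; rewrite Normc.normcM normc_cexp Re_mulr ReN /= mulNr => h.
have -> : normc (theta w N t) = expR (k1 * t) * (expR (- (k1 * t)) * normc (theta w N t)).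
  by rewrite mulrA -expRD subrr expR0 mul1r.
rewrite [leRHS]mulrC ler_wpM2l ?expR_ge0//; apply: le_trans h _.
by rewrite ler_piMr// -expR0 ler_expR oppr_le0 mulr_ge0// ltW.
Qed.

Lemma exprn_cint n (s : R) : 0 < s ->
  cint (fun t => t%:C ^+ n * cexp (- s%:C * t%:C)) (n`!%:R / s%:C ^+ n.+1).
Proof.
move=> s0; have := cint_real _ _ (exprn_improper n s s0).
rewrite rmorphM fmorphV rmorphXn rmorph_nat; apply: cint_eq => t t0.
have -> : - s%:C * t%:C = (- (s * t))%:C :> R[i] by rewrite rmorphN rmorphM mulNr.
by rewrite cexp_real rmorphM rmorphXn.
Qed.

(** In [theta_iter] the term t^j contributes j! / s^(j+1), and the remainder is at most C t^J e^(k1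
    t), whose integral against e^(-st) is C J! / (s - k1)^(J+1). For s >= 2 k1 one has s - k1 >= s /
    2, whence the power of 2. *)
Lemma psi_remainder N J : exists C : R, forall s : R, 2 * k1 <= s ->
  normc (psi w N s%:C - \sum_(j < J) bern w (N + j) * (j`!%:R / s%:C ^+ j.+1)) <=
    C / s ^+ J.+1.
Proof.
have k0 : 0 < k1 by rewrite ltr_wpDl ?normc_ge0.
have [C C0 hC] := theta_bound (N + J).
exists (2 * (C * (J`!%:R * 2 ^+ J.+1))) => s sk.
have s0 : 0 < s by lra.
have sw : 0 < complex.Re (s%:C + w).
  rewrite ReD /=; have := Re_le_normc w; rewrite ler_norml => /andP[h _].
  move: sk; rewrite /k1; have := normc_ge0 w; lra.
have I := cintB _ _ _ _ (psi_cint w N s%:C s0 sw)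
  (cint_sum J (fun j t => bern w (N + j) * (t%:C ^+ j * cexp (- s%:C * t%:C))) _
    (fun j _ => cintZ _ (bern w (N + j)) _ (exprn_cint j s s0))).
have sk0 : 0 < s - k1 by lra.
have J' := improperZ _ _ C (exprn_improper J (s - k1) sk0).
apply: le_trans (cint_le _ _ _ _ _ I J') _.
  move=> t t0; rewrite (theta_iter w N J t t0) mulrDr mulr_sumr.
  under [X in _ - X]eq_bigr do rewrite mulrA mulrC.
  rewrite addrAC subrr add0r (Normc.normcM (cexp _)) (Normc.normcM (_ ^+ _)) normcX normc_real gtr0_norm//.
  rewrite normc_cexp Re_mulr ReN /= mulNr.
  have -> : - ((s - k1) * t) = - (s * t) + k1 * t by ring.
  rewrite expRD mulrCA [leRHS]mulrCA ler_wpM2l ?exprn_ge0 ?(ltW t0)//.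
  by rewrite [leRHS]mulrCA ler_wpM2l ?expR_ge0// hC.
rewrite -!mulrA ler_wpM2l// ler_wpM2l// ler_wpM2l//.
rewrite -[leLHS]mul1r ler_pdivrMr ?exprn_gt0// -mulrA mulrC -mulrA.
rewrite -exprVn -!exprMn exprn_ege1//.
by rewrite mulrC ler_pdivlMr// mul1r; lra.
Qed.

Lemma has_const_psi N : has_const (fun s => psi w N s%:R) 0.
Proof.
(* Indices are shifted by one because t^j integrates to j! / s^(j+1). *)
exists 0, 0, (fun j => bern w (N + j.-1) * (j.-1)`!%:R); split; last by rewrite coef0.
move=> J; apply/cvg0_normcP.
have [C hC] := psi_remainder N J.
apply: (@squeeze_cvgr _ _ _ _ (fun=> 0) (fun s : nat => C / s%:R)).
- near=> s; rewrite normc_ge0/= !horner0 mul0r !add0r.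
  have s0 : 0 < s%:R :> R by near: s; exact: nbhs_infty_gtr.
  have sk : 2 * k1 <= s%:R by near: s; exact: nbhs_infty_ger.
  have := hC _ sk; rewrite rmorph_nat.
  rewrite big_add1 big_mkord /= Normc.normcM normcX normc_nat => h.
  rewrite mulrC -ler_pdivlMr ?exprn_gt0//.
  under eq_bigr do rewrite -mulrA.
  apply: le_trans h _; rewrite exprS invfM mulrA.
  by [].
- exact: cvg_cst.
- exact: invn_cvg0.
Unshelve. all: by end_near. Qed.

End Watson.

(** * Subfields of the complex numbers and polynomials over them *)

Section Subfields.
Context {R : realType}.
Implicit Types (K G : set R[i]) (x y : R[i]) (p q : {poly R[i]}).

Definition is_subfield K := [/\ K 1, forall x y, K x -> K y -> K (x - y)
  & forall x y, K x -> K y -> K (x / y)].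

Lemma subfield_genP G : is_subfield (subfield_gen G).
Proof.
split.
- by move=> M [[M1 _ _] _]; rewrite -[M 1]in_setE.
- move=> x y Kx Ky M hM; have [[_ MB _] _] := hM.
  have := MB x y; rewrite -!topredE /= !in_setE; apply; [exact: Kx|exact: Ky].
- move=> x y Kx Ky M hM; have [[_ _ MV] _] := hM.
  have := MV x y; rewrite -!topredE /= !in_setE; apply; [exact: Kx|exact: Ky].
Qed.

Lemma sub_subfield_gen G : G `<=` subfield_gen G.
Proof. by move=> x Gx M [_]; apply. Qed.

Context {K : set R[i]} (HK : is_subfield K).

Lemma sf1 : K 1. Proof. by have [] := HK. Qed.
Lemma sfB x y : K x -> K y -> K (x - y). Proof. by have [_ + _] := HK; apply. Qed.
Lemma sf_div x y : K x -> K y -> K (x / y). Proof. by have [_ _] := HK; apply. Qed.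
Lemma sf0 : K 0. Proof. by rewrite -(subrr 1); exact: sfB sf1 sf1. Qed.
Lemma sfN x : K x -> K (- x).
Proof. by move=> Kx; rewrite -sub0r; exact: sfB sf0 Kx. Qed.
Lemma sfD x y : K x -> K y -> K (x + y).
Proof. by move=> Kx Ky; rewrite -[y]opprK; apply: sfB => //; exact: sfN. Qed.
Lemma sfV x : K x -> K x^-1.
Proof. by move=> Kx; rewrite -div1r; exact: sf_div sf1 Kx. Qed.
Lemma sfM x y : K x -> K y -> K (x * y).
Proof. by move=> Kx Ky; rewrite -[y]invrK; apply: sf_div => //; exact: sfV. Qed.
Lemma sf_nat n : K n%:R.
Proof. by elim: n => [|n IH]; [exact: sf0|rewrite -natr1; exact: sfD IH sf1]. Qed.
Lemma sfX x n : K x -> K (x ^+ n).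
Proof. by move=> Kx; elim: n => [|n IH]; [exact: sf1|rewrite exprS; exact: sfM]. Qed.
Lemma sf_sum (I : Type) (r : seq I) (P : pred I) (F : I -> R[i]) :
  (forall i, P i -> K (F i)) -> K (\sum_(i <- r | P i) F i).
Proof. by move=> hF; elim/big_ind : _ => //; [exact: sf0|exact: sfD]. Qed.
Lemma sf_prod (I : eqType) (r : seq I) (F : I -> R[i]) :
  (forall i, i \in r -> K (F i)) -> K (\prod_(i <- r) F i).
Proof. by move=> hF; rewrite big_seq; elim/big_ind : _ => //; [exact: sf1|exact: sfM]. Qed.

Definition sf_poly p := forall i, K p`_i.

Lemma sfpC x : K x -> sf_poly x%:P.
Proof. by move=> Kx i; rewrite coefC; case: ifP => // _; exact: sf0. Qed.
Lemma sfpX : sf_poly 'X.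
Proof. by move=> i; rewrite coefX; exact: sf_nat. Qed.
Lemma sfpD p q : sf_poly p -> sf_poly q -> sf_poly (p + q).
Proof. by move=> hp hq i; rewrite coefD; exact: sfD. Qed.
Lemma sfpN p : sf_poly p -> sf_poly (- p).
Proof. by move=> hp i; rewrite coefN; exact: sfN. Qed.
Lemma sfpM p q : sf_poly p -> sf_poly q -> sf_poly (p * q).
Proof. by move=> hp hq i; rewrite coefM; apply: sf_sum => j _; exact: sfM. Qed.
Lemma sfpXn p n : sf_poly p -> sf_poly (p ^+ n).
Proof.
move=> hp; elim: n => [|n IH]; first by rewrite expr0; apply: sfpC; exact: sf1.
by rewrite exprS; exact: sfpM.
Qed.
Lemma sfpZ x p : K x -> sf_poly p -> sf_poly (x *: p).
Proof. by move=> Kx hp i; rewrite coefZ; exact: sfM. Qed.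
Lemma sfp_sum n (F : nat -> {poly R[i]}) : (forall i, sf_poly (F i)) ->
  sf_poly (\sum_(i < n) F i).
Proof. by move=> hF i; rewrite coef_sum; apply: sf_sum => j _; exact: hF. Qed.
Lemma sf_horner p x : sf_poly p -> K x -> K p.[x].
Proof. by move=> hp Kx; rewrite horner_coef; apply: sf_sum => i _; apply: sfM => //; exact: sfX. Qed.
Lemma sfp_comp p q : sf_poly p -> sf_poly q -> sf_poly (p \Po q).
Proof.
move=> hp hq; rewrite comp_polyE.
by apply: (sfp_sum _ (fun i => p`_i *: q ^+ i)) => i; apply: sfpZ => //; exact: sfpXn.
Qed.

Lemma sfp_taylorp x n : K x -> sf_poly (taylorp x n).
Proof.
move=> Kx i; rewrite coef_poly; case: ifP => _; last exact: sf0.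
by apply: sf_div; [exact: sfX|exact: sf_nat].
Qed.

Lemma sfp_bernp w N : K w -> sf_poly (bernp w N).
Proof.
move=> Kw; elim: N => [|N IH] /=; first by move=> i; rewrite coef0; exact: sf0.
apply: sfpD => //; apply: sfpZ; last by apply: sfpXn; exact: sfpX.
apply: sfB; first by apply: sf_div; [apply: sfX; exact: sfN|exact: sf_nat].
apply: sfpM => //; apply: sfpD; first by apply: sfpC; exact: sf1.
by apply: sfpN; apply: sfp_taylorp; apply: sfN; exact: sf1.
Qed.

Lemma sf_bern w N : K w -> K (bern w N).
Proof.
move=> Kw; apply: sfB; first by apply: sf_div; [apply: sfX; exact: sfN|exact: sf_nat].
apply: sfpM; last exact: sfp_bernp; apply: sfpD; first by apply: sfpC; exact: sf1.
by apply: sfpN; apply: sfp_taylorp; apply: sfN; exact: sf1.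
Qed.

(** The polynomial part of [regint]. Its coefficients are rational, hence lie in every subfield,
    which is what makes its constant term and its values at integers periods. *)
Fixpoint regpoly n : {poly R[i]} :=
  if n is m.+1 then m.+1%:R^-1 *: (- 'X * regpoly m + m.+1`!%:R^-1 *: (1 - 'X) ^+ m.+1)
  else 0.

Lemma regintE n x : regint n x = - ((- x) ^+ n / n`!%:R) * clog x + (regpoly n).[x].
Proof.
elim: n => [|n IH]; first by rewrite horner0 addr0 expr0 fact0 divr1 mulN1r.
rewrite [LHS]/= IH /= hornerZ hornerD hornerM hornerN hornerX hornerZ horner_exp.
rewrite hornerD hornerN hornerC hornerX.
rewrite [in RHS]exprS [n.+1`!]factS natrM.
have n0 : n.+1%:R != 0 :> R[i] by rewrite pnatr_eq0.
have f0 : n`!%:R != 0 :> R[i] by exact: fact_neq0.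
move: ((- x) ^+ n) ((1 - x) ^+ n.+1) (n`!%:R) f0 (n.+1%:R) n0 => a b f f0 m m0.
move: (clog x) ((regpoly n).[x]) => c r.
by field; rewrite f0 m0.
Qed.

Lemma sfp_regpoly n : sf_poly (regpoly n).
Proof.
elim: n => [|n IH] /=; first by move=> i; rewrite coef0; exact: sf0.
apply: sfpZ; first by apply: sfV; exact: sf_nat.
apply: sfpD; first by apply: sfpM => //; apply: sfpN; exact: sfpX.
apply: sfpZ; first by apply: sfV; exact: sf_nat.
apply: sfpXn; apply: sfpD; first by apply: sfpC; exact: sf1.
by apply: sfpN; exact: sfpX.
Qed.

End Subfields.

Arguments sf_poly {R} K p.

(** * Exponential periods, and sequences whose constant term is one *)

Section Periods.
Context {R : realType} {K W : set R[i]} (HK : is_subfield K).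
Implicit Types (f g : R[i] -> R[i]) (z : R[i]).
Let F := exp_field K W.

Lemma exp_field_cst z : K z -> F (fun=> z).
Proof. by move=> Kz M [_]; apply; left; left; left; exists z. Qed.

Lemma exp_field_id : F (fun t => t).
Proof. by move=> M [_]; apply; left; left; right. Qed.

Lemma exp_field_exp : F (fun t => cexp (- t)).
Proof. by move=> M [_]; apply; left; right. Qed.

Lemma exp_field_expW w : W w -> F (fun t => cexp (- (w * t))).
Proof. by move=> Ww M [_]; apply; right; exists w. Qed.

Lemma exp_fieldB f g : F f -> F g -> F (fun t => f t - g t).
Proof. by move=> Ff Fg M hM; have [[_ _ _ + _] _] := hM; apply; [exact: Ff|exact: Fg]. Qed.

Lemma exp_field_div f g : F f -> F g -> F (fun t => f t / g t).
Proof. by move=> Ff Fg M hM; have [[_ _ _ _ +] _] := hM; apply; [exact: Ff|exact: Fg]. Qed.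

Lemma exp_fieldV f : F f -> F (fun t => (f t)^-1).
Proof.
move=> Ff; have := exp_field_div _ _ (exp_field_cst _ (sf1 HK)) Ff.
by under eq_fun do rewrite div1r.
Qed.

Lemma exp_fieldM f g : F f -> F g -> F (fun t => f t * g t).
Proof.
move=> Ff Fg; have := exp_field_div _ _ Ff (exp_fieldV _ Fg).
by under eq_fun do rewrite invrK.
Qed.

Lemma exp_fieldN f : F f -> F (fun t => - f t).
Proof.
move=> Ff; have := exp_fieldB _ _ (exp_field_cst _ (sf0 HK)) Ff.
by under eq_fun do rewrite sub0r.
Qed.

Lemma exp_fieldD f g : F f -> F g -> F (fun t => f t + g t).
Proof.
move=> Ff Fg; have := exp_fieldB _ _ Ff (exp_fieldN _ Fg).
by under eq_fun do rewrite opprK.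
Qed.

Lemma exp_fieldX f n : F f -> F (fun t => f t ^+ n).
Proof.
move=> Ff; elim: n => [|n IH]; first exact: exp_field_cst (sf1 HK).
by under eq_fun do rewrite exprS; exact: exp_fieldM.
Qed.

Lemma exp_field_poly (p : {poly R[i]}) : sf_poly K p -> F (fun t => p.[t]).
Proof.
move=> hp.
have main n : F (fun t => \sum_(i < n) p`_i * t ^+ i).
  elim: n => [|n IH].
    by under eq_fun do rewrite big_ord0; exact: exp_field_cst (sf0 HK).
  under eq_fun do rewrite big_ord_recr/=; apply: exp_fieldD => //.
  apply: exp_fieldM; first by apply: exp_field_cst; exact: hp.
  exact: exp_fieldX exp_field_id.
have := main (size p); congr F; apply/funext => t; by rewrite horner_coef.
Qed.

Definition period z := exponential_period F z.

Lemma periodP z : period z <-> exists f, F f /\ cint (fun t => f t%:C) z.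
Proof. by split=> [[f [? ? ?]]|[f [Ff [? ?]]]]; exists f. Qed.

Lemma periodD z z' : period z -> period z' -> period (z + z').
Proof.
move=> /periodP[f [Ff hf]] /periodP[g [Fg hg]]; apply/periodP.
by exists (fun t => f t + g t); split; [exact: exp_fieldD|exact: cintD].
Qed.

Lemma periodM c z : K c -> period z -> period (c * z).
Proof.
move=> Kc /periodP[f [Ff hf]]; apply/periodP.
exists (fun t => c * f t); split; last exact: cintZ.
by apply: exp_fieldM => //; exact: exp_field_cst.
Qed.

(** Witnessed by e^(-t); with [periodM] it makes every element of K a period. *)
Lemma period1 : period 1.
Proof.
apply/periodP; exists (fun t => cexp (- t)); split; first exact: exp_field_exp.
have := @cexp_integral R 1; rewrite invr1 => /(_ ltr01).
by apply: cint_eq => t _; rewrite mulN1r.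
Qed.

Lemma period_subfield c : K c -> period c.
Proof. by move=> Kc; rewrite -[c]mulr1; exact: periodM period1. Qed.

Lemma period_sum (I : Type) (r : seq I) (P : pred I) (G : I -> R[i]) :
  (forall i, P i -> period (G i)) -> period (\sum_(i <- r | P i) G i).
Proof.
move=> hG; elim/big_ind : _ => //; last exact: periodD.
exact: period_subfield (sf0 HK).
Qed.

Lemma period_clog z : K z -> slit z -> period (clog z).
Proof.
move=> Kz sz; apply/periodP; exists (fun t => (1 + t)^-1 - (z + t)^-1); split.
  apply: exp_fieldB; apply: exp_fieldV; apply: exp_fieldD => //;
  try exact: exp_field_id; apply: exp_field_cst => //; exact: sf1.
exact: clog_integral.
Qed.

(** The integrand lies in the function field because k is a natural number: e^(-kt) is the k-th
    power of e^(-t). *)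
Lemma period_psi w N (k : nat) : K w -> W w -> (0 < k)%N -> 0 < complex.Re (k%:R + w) ->
  period (psi w N k%:R).
Proof.
move=> Kw Ww k0 kw; apply/periodP.
exists (fun t => cexp (- t) ^+ k * ((t ^+ N)^-1 * (t * cexp (- (w * t)) / (1 - cexp (- t)) - (bernp w N).[t]))).
split.
  apply: exp_fieldM; first exact: exp_fieldX exp_field_exp.
  apply: exp_fieldM; first by apply: exp_fieldV; exact: exp_fieldX exp_field_id.
  apply: exp_fieldB; last by apply: exp_field_poly; exact: sfp_bernp.
  apply: exp_field_div; first by apply: exp_fieldM; [exact: exp_field_id|exact: exp_field_expW].
  by apply: exp_fieldB; [exact: exp_field_cst (sf1 HK)|exact: exp_field_exp].
have kR : 0 < complex.Re (k%:R : R[i]) by rewrite -(rmorph_nat (real_complex R)) ltr0n.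
apply: cint_eq (psi_cint w N _ kR kw) => t t0.
by rewrite -cexpX /theta !mulNr mulrN mul1r.
Qed.

(** Existence of the expansion and the nature of its constant term are carried together, both being
    stable under K-linear combinations. *)
Definition good (u : nat -> R[i]) := exists2 c, has_const u c & period c.

Lemma good_eq k u v : (forall s, (k <= s)%N -> u s = v s) -> good u -> good v.
Proof. by move=> uv [c hc pc]; exists c => //; exact: has_const_eq uv hc. Qed.

Lemma goodD u v : good u -> good v -> good (fun s => u s + v s).
Proof.
move=> [c hc pc] [d hd pd]; exists (c + d); [exact: has_constD|exact: periodD].
Qed.

Lemma goodZ c u : K c -> good u -> good (fun s => c * u s).
Proof.
move=> Kc [d hd pd]; exists (c * d); [exact: has_constZ|exact: periodM].
Qed.

Lemma goodN u : good u -> good (fun s => - u s).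
Proof.
move=> /(goodZ _ _ (sfN HK _ (sf1 HK))); apply: (good_eq 0) => s _.
by rewrite mulN1r.
Qed.

Lemma good_cst c : period c -> good (fun=> c).
Proof.
move=> pc; exists c => //; have := has_const_poly c%:P; rewrite coefC /=.
by apply: (has_const_eq 0) => s _; rewrite hornerC.
Qed.

Lemma good_sum n (G : nat -> nat -> R[i]) : (forall i, (i < n)%N -> good (G i)) ->
  good (fun s => \sum_(i < n) G i s).
Proof.
elim: n => [|n IH] hG.
  under eq_fun do rewrite big_ord0; apply: good_cst.
  exact: period_subfield (sf0 HK).
under eq_fun do rewrite big_ord_recr/=; apply: goodD; last exact: hG.
by apply: IH => i ni; apply: hG; rewrite ltnS ltnW.
Qed.

Lemma good_log_poly (A B : {poly R[i]}) : K B`_0 ->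
  good (fun s => A.[s%:R] * (ln (s%:R : R))%:C + B.[s%:R]).
Proof.
by move=> KB; exists B`_0; [exact: has_const_log_poly|exact: period_subfield].
Qed.

Lemma good_psi w N : good (fun s => psi w N s%:R).
Proof. by exists 0; [exact: has_const_psi|exact: period_subfield (sf0 HK)]. Qed.

End Periods.

Arguments period {R} K W z.
Arguments good {R} K W u.

(** * Sums of polynomials and of p(k) log(k + w) *)

Section GoodSums.
Context {R : realType} (K W : set R[i]) (HK : is_subfield K).
Implicit Types (w : R[i]) (p : {poly R[i]}) (n s : nat).
Local Notation good := (good K W).
Local Notation period := (period K W).

Lemma Re_natr n : complex.Re (n%:R : R[i]) = n%:R.
Proof. by rewrite -(rmorph_nat (real_complex R)). Qed.

(** The telescoping sum of (k+1)^(n+1) - k^(n+1) is solved for the sum of the k^n, the lower powers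
    being known by strong induction. *)
Lemma sum_powers_poly n : exists S : {poly R[i]},
  forall s, \sum_(0 <= k < s) k%:R ^+ n = S.[s%:R].
Proof.
elim/ltn_ind: n => n IH.
have [T hT] : exists T : {poly R[i]}, forall s,
    \sum_(i < n) 'C(n.+1, i)%:R * \sum_(0 <= k < s) k%:R ^+ i = T.[s%:R].
  suff H m : (m <= n)%N -> exists T : {poly R[i]}, forall s,
    \sum_(i < m) 'C(n.+1, i)%:R * \sum_(0 <= k < s) k%:R ^+ i = T.[s%:R] by exact: H n (leqnn n).
  elim: m => [_|m IHm mn].
    by exists 0 => s; rewrite big_ord0 horner0.
  have [T hT] := IHm (ltnW mn); have [S hS] := IH m mn.
  exists (T + 'C(n.+1, m)%:R *: S) => s.
  by rewrite big_ord_recr/= hT hS hornerD hornerZ.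
exists (n.+1%:R^-1 *: ('X^(n.+1) - T)) => s.
rewrite hornerZ hornerD hornerN hornerXn -hT.
have n0 : n.+1%:R != 0 :> R[i] by rewrite pnatr_eq0.
have -> : s%:R ^+ n.+1 = \sum_(0 <= k < s) (k.+1%:R ^+ n.+1 - k%:R ^+ n.+1) :> R[i].
  by rewrite telescope_sumr// expr0n subr0.
have E k : k.+1%:R ^+ n.+1 - k%:R ^+ n.+1 =
    n.+1%:R * k%:R ^+ n + \sum_(i < n) 'C(n.+1, i)%:R * k%:R ^+ i :> R[i].
  have -> : k.+1%:R = 1 + k%:R :> R[i] by rewrite -natr1 addrC.
  rewrite exprDn big_ord_recr/= big_ord_recr/=.
  rewrite subnn binn expr0 mul1r mulr1n.
  rewrite addrK binSn addrC -[_ *+ n.+1]mulr_natl subSnn expr1n mul1r; congr (_ + _).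
  by apply: eq_bigr => i _; rewrite expr1n mul1r mulr_natl.
rewrite (eq_bigr _ (fun k _ => E k)).
rewrite big_split/= -mulr_sumr.
rewrite (_ : \sum_(0 <= k < s) \sum_(i < n) _ =
  \sum_(i < n) 'C(n.+1, i)%:R * \sum_(0 <= k < s) k%:R ^+ i); last first.
  by rewrite exchange_big/=; apply: eq_bigr => i _; rewrite mulr_sumr.
by rewrite addrK mulrA mulVf// mul1r.
Qed.

(** The constant term is 0 because the sum is empty at s = 0; this is what removes log b from the
    result. *)
Lemma sum_poly_poly p : exists S : {poly R[i]},
  S`_0 = 0 /\ forall s, \sum_(0 <= k < s) p.[k%:R] = S.[s%:R].
Proof.
suff [S hS] : exists S : {poly R[i]}, forall s, \sum_(0 <= k < s) p.[k%:R] = S.[s%:R].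
  by exists S; split => //; rewrite -horner_coef0 -(hS 0%N) big_geq.
have [S hS] : exists S : {poly R[i]}, forall s,
    \sum_(i < size p) p`_i * \sum_(0 <= k < s) k%:R ^+ i = S.[s%:R].
  elim: (size p) => [|m [S hS]]; first by exists 0 => s; rewrite big_ord0 horner0.
  have [T hT] := sum_powers_poly m; exists (S + p`_m *: T) => s.
  by rewrite big_ord_recr/= hS hT hornerD hornerZ.
exists S => s; rewrite -hS.
under eq_bigr do rewrite horner_coef.
by rewrite exchange_big/=; apply: eq_bigr => i _; rewrite mulr_sumr.
Qed.

Lemma has_const_poly_sum p : has_const (fun s => \sum_(0 <= k < s) p.[k%:R]) 0.
Proof.
have [S [S0 hS]] := sum_poly_poly p.
have h := has_const_poly S; rewrite S0 in h.
by apply: (has_const_eq 0) h => s _; rewrite hS.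
Qed.

Lemma good_sum_from k0 (g : nat -> R[i]) : period (\sum_(0 <= k < k0) g k) ->
  good (fun s => \sum_(0 <= k < s) g k) -> good (fun s => \sum_(k0 <= k < s) g k).
Proof.
move=> pg gg; have := goodD HK _ _ gg (goodN HK _ (good_cst _ pg)).
apply: (good_eq k0) => s ks.
by rewrite (big_cat_nat (leq0n k0) ks)/= addrAC subrr add0r.
Qed.

Lemma good_poly_sum k0 p : sf_poly K p -> good (fun s => \sum_(k0 <= k < s) p.[k%:R]).
Proof.
move=> hp; apply: good_sum_from _; last first.
  by exists 0; [exact: has_const_poly_sum|exact: period_subfield (sf0 HK)].
apply: period_subfield => //.
by apply: sf_sum => // k _; apply: sf_horner => //; exact: sf_nat.
Qed.

(** * The contribution of a single root - w, from k0 on *)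

Section Root.
Context (w : R[i]) (k0 : nat) (Kw : K w) (Ww : W w) (k0_gt0 : (0 < k0)%N).
Context (k0w : 0 < complex.Re (k0%:R + w)).

Let Re_k k : (k0 <= k)%N -> 0 < complex.Re (k%:R + w).
Proof.
move=> kk; apply: lt_le_trans k0w _.
by rewrite !ReD !Re_natr lerD2r ler_nat.
Qed.

Lemma regint_sum n s : (k0 <= s)%N -> \sum_(k0 <= k < s) regint n (k%:R + w) =
  phi w n k0%:R - phi w n s%:R + (psi w n.+2 k0%:R - psi w n.+2 s%:R).
Proof.
elim: s => [|s IH].
  by rewrite leqn0 => /eqP->; rewrite big_geq// !subrr addr0.
rewrite leq_eqVlt => /predU1P[<-|ks]; first by rewrite big_geq// !subrr addr0.
have s0 : 0 < complex.Re (s%:R : R[i]) by rewrite Re_natr ltr0n (leq_trans k0_gt0).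
rewrite big_nat_recr//= IH//.
have := psi_step w n s%:R s0 (Re_k _ ks); rewrite natr1 => h.
have -> : regint n (s%:R + w) = psi w n.+2 s%:R - psi w n.+2 s.+1%:R +
   (phi w n s%:R - phi w n s.+1%:R) by rewrite h subrK.
move: (phi w n k0%:R) (phi w n s%:R) (phi w n s.+1%:R) => a b c.
by move: (psi _ _ k0%:R) (psi _ _ s%:R) (psi _ _ s.+1%:R) => a' b' c'; ring.
Qed.

Lemma period_regint n k : (0 < k)%N -> period (regint n k%:R).
Proof.
move=> k1; rewrite regintE; apply: periodD => //.
  apply: periodM => //.
    apply: sfN => //; apply: sf_div => //; last exact: sf_nat.
    by apply: sfX => //; apply: sfN => //; exact: sf_nat.
  apply: period_clog => //; first exact: sf_nat.
  by apply: slit_Re; rewrite Re_natr ltr0n.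
apply: period_subfield => //; apply: sf_horner => //; last exact: sf_nat.
exact: sfp_regpoly.
Qed.

(** At an integer s > 0 the logarithm is the real log s, so the constant term is that of
    [regpoly n]. *)
Lemma good_regint n : good (fun s => regint n s%:R).
Proof.
pose A : {poly R[i]} := - n`!%:R^-1 *: (- 'X) ^+ n.
apply: (good_eq 1) (good_log_poly HK A (regpoly n) _); last exact: sfp_regpoly.
move=> s s0; rewrite regintE /A hornerZ horner_exp hornerN hornerX.
rewrite -[in clog _](rmorph_nat (real_complex R)) clog_real ?ltr0n//; ring.
Qed.

Lemma good_regint_sum n : good (fun s => \sum_(k0 <= k < s) regint n (k%:R + w)).
Proof.
have gphi : good (fun s => phi w n s%:R).
  apply: (good_sum HK _ (fun j s => bern w j * regint (n.+1 - j) s%:R)) => j _.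
  by apply: goodZ => //; [exact: sf_bern|exact: good_regint].
have pphi : period (phi w n k0%:R).
  apply: period_sum => // j _; apply: periodM => //; first exact: sf_bern.
  exact: period_regint.
have ppsi : period (psi w n.+2 k0%:R) by exact: period_psi.
have := goodD HK _ _ (goodD HK _ _ (good_cst _ pphi) (goodN HK _ gphi))
  (goodD HK _ _ (good_cst _ ppsi) (goodN HK _ (good_psi HK w n.+2))).
by apply: (good_eq k0) => s ks; rewrite regint_sum.
Qed.

(** [regintE] at x = k + w is solved for x^n log x; its polynomial part is summed by
    [good_poly_sum]. *)
Lemma good_pow_clog_sum n :
  good (fun s => \sum_(k0 <= k < s) (k%:R + w) ^+ n * clog (k%:R + w)).
Proof.
have g1 := good_regint_sum n.
have hp : sf_poly K (regpoly n \Po ('X + w%:P)).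
  apply: sfp_comp => //; first exact: sfp_regpoly.
  by apply: sfpD => //; [exact: sfpX|exact: sfpC].
have g2 := good_poly_sum k0 _ hp.
(* The inverse of the coefficient - (-1)^n / n! of x^n log x in [regint n x]. *)
have Kc : K (- (-1) ^+ n * n`!%:R).
  by apply: sfM => //; [apply: sfN => //; apply: sfX => //; apply: sfN => //; exact: sf1|exact: sf_nat].
have := goodZ HK _ _ Kc (goodD HK _ _ g1 (goodN HK _ g2)).
apply: (good_eq 0) => s _.
rewrite -sumrB mulr_sumr; apply: eq_bigr => k _.
rewrite horner_comp hornerD hornerX hornerC regintE addrK.
rewrite [(- (k%:R + w)) ^+ n]exprNn.
have s2 : (-1) ^+ n * (-1) ^+ n = 1 :> R[i] by rewrite -exprMn mulrNN mulr1 expr1n.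
have f0 : n`!%:R != 0 :> R[i] by exact: fact_neq0.
move: ((-1) ^+ n) s2 (n`!%:R) f0 ((k%:R + w) ^+ n) (clog _) => e e2 f f0 x c.
have -> : - e * f * (- (e * x / f) * c) = e * e * x * c by field.
by rewrite e2 mul1r.
Qed.

Lemma good_poly_clog_sum p : sf_poly K p ->
  good (fun s => \sum_(k0 <= k < s) p.[k%:R] * clog (k%:R + w)).
Proof.
move=> hp; pose q := p \Po ('X - w%:P).
have hq : sf_poly K q.
  apply: sfp_comp => //; apply: sfpD => //; first exact: sfpX.
  by apply: sfpN => //; exact: sfpC.
have := good_sum HK (size q)
  (fun i s => q`_i * \sum_(k0 <= k < s) (k%:R + w) ^+ i * clog (k%:R + w))
  (fun i _ => goodZ HK _ _ (hq i) (good_pow_clog_sum i)).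
apply: (good_eq 0) => s _.
under eq_bigr do rewrite mulr_sumr.
rewrite exchange_big/=; apply: eq_bigr => k _.
under eq_bigr do rewrite mulrA.
rewrite -mulr_suml -horner_coef; congr (_ * _).
by rewrite /q horner_comp hornerD hornerX hornerN hornerC addrK.
Qed.

End Root.
End GoodSums.

(** * The principal logarithm of a product *)

Section LogProducts.
Context {R : realType}.
Implicit Types (z : R[i]).

(** The arguments add up to less than pi in absolute value, so the principal branch never jumps. The
    bound on the argument of the product is carried through the induction for the sake of the next
    factor. *)
Lemma clog_prod (rs : seq R[i]) (e : R) : (size rs)%:R * e < pi -> 0 < e ->
  (forall z, z \in rs -> z != 0 /\ `|carg z| < e) ->
  clog (\prod_(z <- rs) z) = \sum_(z <- rs) clog z /\
  `|carg (\prod_(z <- rs) z)| <= (size rs)%:R * e.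
Proof.
move=> + e0; elim: rs => [_ _|z rs IH].
  rewrite !big_nil mul0r; have h := clog_real (1 : R) ltr01; rewrite ln1 in h.
  split; first exact: h.
  by rewrite -[carg 1]/(complex.Im (clog 1)) h normr0.
rewrite /= -natr1 mulrDl mul1r => hs hz.
have [||IH1 IH2] := IH; first by lra.
  by move=> y yrs; apply: hz; rewrite inE yrs orbT.
have [z0 za] := hz z (mem_head _ _).
have p0 : \prod_(y <- rs) y != 0.
  rewrite prodf_seq_neq0; apply/allP => y yrs /=.
  by have [] := hz y; rewrite ?inE ?yrs ?orbT.
have b : `|carg z + carg (\prod_(y <- rs) y)| <= (size rs)%:R * e + e.
  by apply: le_trans (ler_normD _ _) _; lra.
rewrite !big_cons; have L : clog (z * \prod_(y <- rs) y) = clog z + clog (\prod_(y <- rs) y).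
  by apply: clogM => //; rewrite -ltr_norml (le_lt_trans b).
rewrite L IH1; split => //.
by rewrite -[carg _]/(complex.Im (clog _)) L ImD.
Qed.

End LogProducts.

(** * Splitting log Q(k): leading coefficient and linear factors *)

Section LogOfPolynomial.
Context {R : realType}.
Local Notation normc := Normc.normc.

(** Both arguments are below pi / 2 in absolute value, so their difference stays in ]-pi, pi[.
    Applied to the leading coefficient and Q(k), this is where the positivity hypotheses of the
    theorem enter. *)
Lemma Re_gt0_ratio (b z : R[i]) : 0 < complex.Re b -> 0 < complex.Re z ->
  slit (z / b) /\ clog z = clog b + clog (z / b).
Proof.
move=> b0 z0; have bn0 := Re_gt0_neq0 _ b0; have zn0 := Re_gt0_neq0 _ z0.
split.
  rewrite /slit; case: eqVneq => //= i0; rewrite ltNge; apply/negP => r0.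
  move: z0; rewrite -(divfK bn0 z) Re_mul i0 mul0r subr0.
  by rewrite ltNge mulr_le0_ge0// ltW.
have h1 := carg_Re_gt0 _ b0; have h2 := carg_Re_gt0 _ z0.
rewrite clog_div//; first by rewrite addrC subrK.
rewrite -ltr_norml; apply: le_lt_trans (ler_normB _ _) _; lra.
Qed.

(** For large k, k - z is close in direction to the positive axis, and finitely many roots share one
    k0. Positive real parts give convergent integrals, small arguments allow [clog_prod]. *)
Lemma eventually_carg_lt (rs : seq R[i]) (e : R) : 0 < e -> exists k0 : nat,
  (0 < k0)%N /\ forall z k, z \in rs -> (k0 <= k)%N ->
    0 < complex.Re (k%:R - z) /\ `|carg (k%:R - z)| < e.
Proof.
move=> e0.
suff [k0 _ hk0] : \forall k \near \oo, forall z, z \in rs ->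
    0 < complex.Re (k%:R - z) /\ `|carg (k%:R - z)| < e.
  exists k0.+1; split => // z k zrs kk; apply: hk0 => //; exact: ltnW.
elim: rs => [|z rs IH]; first by near=> k.
have [T hT] := cvg_carg_shift (- z) e e0.
near=> k => y; rewrite inE => /predU1P[->|yrs]; last by move: y yrs; near: k.
have kT : T <= k%:R by near: k; exact: nbhs_infty_ger.
split; last by have := hT _ kT; rewrite addrC rmorph_nat.
have kz : complex.Re z < k%:R by near: k; exact: nbhs_infty_gtr.
by rewrite ReD ReN Re_natr subr_gt0.
Unshelve. all: by end_near. Qed.

End LogOfPolynomial.

(** * Decomposition of the sum of P(k) log Q(k) *)

Theorem theorem1p3 (R : realType) (P Q : {poly R[i]})
    (hb : 0 < complex.Re (lead_coef Q))
    (hQ : forall k : nat, 0 < complex.Re Q.[k%:R]) :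
  let Omega : set R[i] := [set w | root Q (- w)] in
  let K := adjoin (coef_field P) Omega in
  let f := fun k : nat => P.[k%:R - 1] * clog Q.[k%:R - 1] in
  (exists c, is_SR f c) /\ exponential_period (exp_field K Omega) (SR f).
Proof.
move=> Omega K f.
have HK : is_subfield K by exact: subfield_genP.
have KO : Omega `<=` K by move=> w Ow; apply: sub_subfield_gen; right.
have KP : sf_poly K P.
  move=> i; apply: sub_subfield_gen; left; apply: sub_subfield_gen.
  by exists i.
suff [c hc pc] : good K Omega (fun s => \sum_(1 <= k < s.+1) f k).
  have ex : exists c, is_SR f c by exists c.
  (* As the expansion exists, [SR f] is one of the admissible constant terms and not the default 0;
     uniqueness identifies it with c. *)
  split => //; have hS : is_SR f (SR f) by apply: (@xgetPex _ 0 [set c | is_SR f c]).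
  by rewrite (has_const_unique _ _ _ hS hc).
set b := lead_coef Q in hb.
have [rs hrs] := closed_field_poly_normal Q.
pose q (k : nat) : R[i] := \prod_(z <- rs) (k%:R - z).
have Qq k : Q.[k%:R] = b * q k.
  rewrite {1}hrs hornerZ horner_prod; congr (_ * _).
  by apply: eq_bigr => z _; rewrite hornerXsubC.
(* A root z is - w with w in [Omega], so that k - z = k + w; [rs] repeats it according to its
   multiplicity. *)
have rsO z : z \in rs -> Omega (- z).
  move=> zrs; rewrite /Omega /= opprK hrs rootZ ?root_prod_XsubC//.
  by rewrite (Re_gt0_neq0 _ hb).
have Kq k : K (q k).
  apply: (sf_prod HK) => z zrs; apply: (sfD HK); first exact: sf_nat.
  by apply: KO; exact: rsO.
have b0 : b != 0 := Re_gt0_neq0 _ hb.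
have qE k : q k = Q.[k%:R] / b by rewrite Qq mulrC mulKf.
(* With this bound the arguments of all factors add up to less than pi in absolute value; the
   successor keeps this strict and covers constant Q. *)
have [k0 [k00 hk0]] := eventually_carg_lt rs (pi / (size rs).+1%:R) (divr_gt0 (pi_gt0 R) (ltr0Sn _ _)).
have e0 : 0 < (pi : R) / (size rs).+1%:R by rewrite divr_gt0 ?pi_gt0.
have clog_q k : (k0 <= k)%N -> clog (q k) = \sum_(i < size rs) clog (k%:R + - rs`_i).
  move=> kk; rewrite /q -(big_map (fun z => k%:R - z) xpredT id).
  have [||-> _] := clog_prod [seq k%:R - z | z <- rs] _ _ e0.
  - rewrite size_map mulrA ltr_pdivrMr// mulrC ltr_pM2l ?pi_gt0// ltr_nat //.
  - move=> _ /mapP[z zrs ->]; have [h1 h2] := hk0 z k zrs kk.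
    by split => //; exact: Re_gt0_neq0.
  by rewrite big_map (big_nth 0) big_mkord.
(* log b is only a complex factor here; the constant term 0 of the polynomial sum makes the product
   a period. *)
have g1 : good K Omega (fun s => clog b * \sum_(0 <= k < s) P.[k%:R]).
  exists (clog b * 0); first by apply: has_constZ; exact: has_const_poly_sum.
  by rewrite mulr0; exact: period_subfield (sf0 HK).
(* Below k0 the logarithm is not split: q(k) lies in K and off the cut, so log q(k) is a period as
   it stands. *)
have g2 : good K Omega (fun=> \sum_(0 <= k < k0) P.[k%:R] * clog (q k)).
  apply: good_cst; apply: period_sum => // k _; apply: periodM => //.
    by apply: (sf_horner HK) => //; exact: (sf_nat HK).
  by apply: period_clog => //; rewrite qE; have [] := Re_gt0_ratio _ _ hb (hQ k).
have g3 : good K Omega (fun s => \sum_(i < size rs)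
    \sum_(k0 <= k < s) P.[k%:R] * clog (k%:R + - rs`_i)).
  apply: (good_sum HK (size rs)
    (fun i s => \sum_(k0 <= k < s) P.[k%:R] * clog (k%:R + - rs`_i))) => i irs.
  have zrs : rs`_i \in rs by exact: mem_nth.
  have O := rsO _ zrs; have [h _] := hk0 _ k0 zrs (leqnn _).
  by apply: good_poly_clog_sum => //; exact: KO.
apply: (good_eq k0) (goodD HK _ _ g1 (goodD HK _ _ g2 g3)) => s ks.
(* The sum over 1 <= k < s + 1 of P(k - 1) log Q(k - 1) becomes the sum over 0 <= k < s of P(k) log
   Q(k). *)
rewrite big_add1 /=.
have fE k : f k.+1 = clog b * P.[k%:R] + P.[k%:R] * clog (q k).
  rewrite /f -natr1 addrK; have [_ ->] := Re_gt0_ratio _ _ hb (hQ k).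
  by rewrite -qE mulrDr mulrC.
rewrite (eq_bigr _ (fun k _ => fE k)) big_split/= -mulr_sumr; congr (_ + _).
rewrite (big_cat_nat (leq0n k0) ks)/=; congr (_ + _).
rewrite exchange_big/=; apply: eq_big_nat => k /andP[kk _].
by rewrite clog_q// mulr_sumr.
Qed.
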